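(* Let $c_1\neq c_2\in\mathbb{R}^2$, $m_1\ge m_2>0$, and let $\Omega\subset\mathbb{R}^2$ be a bounded domain (open connected set) containing the closed segment $[c_1,c_2]$, whose boundary $\partial\Omega$ is a simple closed curve of class $\mathcal{C}^1$. Assume that $\partial\Omega$ is not an ellipse with foci $c_1$ and $c_2$. Then, for every energy $h\ge 0$, the two-centre billiard map $\mathcal{B}$ in $\Omega$ at energy $h$ admits an invariant set $\Lambda_h$ on which it is semiconjugate to the full shift on a countably infinite alphabet $\mathcal{S}$; that is, there is a continuous surjection $\Pi:\Lambda_h\to\mathcal{S}^{\mathbb{Z}}$ with $\Pi\circ\mathcal{B}=\mathfrak{s}\circ\Pi$, where $\mathfrak{s}$ is the shift. Moreover, $\mathcal{B}$ contains compact invariant subsystems of arbitrarily large topological entropy.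
   Context: Potential and trajectories. $U(x)=\frac{m_1}{|x-c_1|}+\frac{m_2}{|x-c_2|}$. An energy-$h$ trajectory of the two-centre problem is a solution of $\ddot x=\nabla U(x)$ with $\frac12|\dot x|^2-U(x)=h$, continued through collisions with the centres by the following regularisation. Put $d=|c_1-c_2|/2$, $e=(c_2-c_1)/(2d)$, $e^\perp$ the rotation of $e$ by $+\pi/2$, $\mathcal{C}=\mathbb{R}\times\mathbb{R}/2\pi\mathbb{Z}$ and $\Phi:\mathcal{C}\to\mathbb{R}^2$, $\Phi(\xi,\eta)=\frac{c_1+c_2}{2}+d(\cosh\xi\cos\eta\, e+\sinh\xi\sin\eta\, e^\perp)$ (a two-to-one branched covering, with deck transformation $(\xi,\eta)\mapsto(-\xi,-\eta)$, branched over $c_1,c_2$). On $T^*\mathcal{C}$ let $K=\frac12(p_\xi^2+p_\eta^2)-d(m_1+m_2)\cosh\xi+d(m_1-m_2)\cos\eta-hd^2(\cosh^2\xi-\cos^2\eta)$. Away from the centres, the projections by $\Phi$ of the orbits of the Hamiltonian flow $\Psi^t$ of $K$ on $\{K=0\}$ are exactly the energy-$h$ trajectories up to the time change $dt_{\mathrm{phys}}=|x-c_1||x-c_2|\,dt$; projections of orbits through the branch points define the continuation through collisions. Billiard map. Let $\gamma:\mathbb{S}^1\to\partial\Omega$ be a regular $\mathcal{C}^1$ parametrisation, $N(\theta)$ the inward unit normal and $T(\theta)=\dot\gamma(\theta)/|\dot\gamma(\theta)|$. $M_h$ is the set of pairs $(\gamma(\theta),v)$ with $\frac12|v|^2-U(\gamma(\theta))=h$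 and $v$ pointing strictly into $\Omega$; it is identified with $\mathbb{S}^1\times(-\frac\pi2,\frac\pi2)$ via $v/|v|=\cos\alpha\,N(\theta)+\sin\alpha\,T(\theta)$. For $z\in M_h$ the return time is the first $t>0$ at which the (regularised) trajectory issued from $z$ meets $\partial\Omega$ again ($+\infty$ if it never does). The domain $\mathcal{D}\subset M_h$ of the billiard map consists of the $z$ with finite return time whose trajectory is transversal to $\partial\Omega$ at the return point; for such $z$, $\mathcal{B}(z)\in M_h$ is the return point together with the velocity obtained from the arrival velocity by elastic reflection (tangential component preserved, normal component reversed). An invariant set $\Lambda$ is a subset of $\mathcal{D}$ with $\mathcal{B}(\Lambda)=\Lambda$. $\mathcal{S}^{\mathbb{Z}}$ carries the product topology of the discrete topology on $\mathcal{S}$. *)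

(* Defs.v *)
From HB Require Import structures.
From mathcomp Require Import all_boot all_order all_algebra.
From mathcomp Require Import all_classical all_reals all_analysis.

Set Implicit Arguments.
Unset Strict Implicit.
Unset Printing Implicit Defensive.

Import Order.TTheory GRing.Theory Num.Theory.
Import numFieldNormedType.Exports.

Local Open Scope classical_set_scope.
Local Open Scope ring_scope.

(* The plane is R * R.  The library norm on this product is the sup norm; it is
   used for the topology only, while lengths and angles are measured with the
   Euclidean product [dot] and norm [enorm]. *)
Definition dot (R : realType) (u v : R * R) : R := u.1 * v.1 + u.2 * v.2.
Definition enorm (R : realType) (u : R * R) : R := Num.sqrt (dot u u).
Definition rot90 (R : realType) (u : R * R) : R * R := (- u.2, u.1).

Definition cosh (R : realType) (x : R) : R := (expR x + expR (- x)) / 2.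
Definition sinh (R : realType) (x : R) : R := (expR x - expR (- x)) / 2.

Definition segment (R : realType) (a b : R * R) : set (R * R) :=
  [set a + s *: (b - a) | s in `[0, 1]].

Definition ellipse (R : realType) (c1 c2 : R * R) (L : R) : set (R * R) :=
  [set x | enorm (x - c1) + enorm (x - c2) = L].

(* For an open set this is the topological boundary. *)
Definition boundary (R : realType) (Omega : set (R * R)) : set (R * R) :=
  closure Omega `\` Omega.

(* S^1 is R / 2 pi Z: gam is 2 pi-periodic, and injective modulo the period. *)
Definition regular_C1_loop (R : realType) (gam : R -> R * R)
    (C : set (R * R)) : Prop :=
  [/\ forall s, gam (s + 2 * pi) = gam s,
      (forall s, derivable gam s 1 /\ derive1 gam s != 0),
      continuous (derive1 gam),
      (forall s t, gam s = gam t -> exists k : int, s - t = k%:~R * (2 * pi)) &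
      range gam = C].

Definition grad (R : realType) (f : R * R -> R) (x : R * R) : R * R :=
  ('D_((1, 0) : R * R) f x, 'D_((0, 1) : R * R) f x).

Definition potential (R : realType) (c1 c2 : R * R) (m1 m2 : R)
    (x : R * R) : R :=
  m1 / enorm (x - c1) + m2 / enorm (x - c2).

Definition half_dist (R : realType) (c1 c2 : R * R) : R := enorm (c1 - c2) / 2.
Definition axis (R : realType) (c1 c2 : R * R) : R * R :=
  (2 * half_dist c1 c2)^-1 *: (c2 - c1).

(* Curves on the cylinder R x R/2piZ are represented by their lifts to R x R;
   Phi and K below are 2 pi-periodic in eta. *)
Definition Phi (R : realType) (c1 c2 : R * R) (xi eta : R) : R * R :=
  2^-1 *: (c1 + c2) + half_dist c1 c2 *:
    ((cosh xi * cos eta) *: axis c1 c2 +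
     (sinh xi * sin eta) *: rot90 (axis c1 c2)).

Definition K (R : realType) (c1 c2 : R * R) (m1 m2 h : R)
    (xi eta pxi peta : R) : R :=
  let d := half_dist c1 c2 in
  (pxi ^+ 2 + peta ^+ 2) / 2 - d * (m1 + m2) * cosh xi
  + d * (m1 - m2) * cos eta
  - h * d ^+ 2 * (cosh xi ^+ 2 - cos eta ^+ 2).

(* An orbit segment, over the time interval ]a, b[, of the Hamiltonian flow of H
   on T^*(R x R/2piZ), contained in {H = 0}. *)
Definition hamiltonian_orbit0 (R : realType) (H : R -> R -> R -> R -> R)
    (a b : R) (xi eta pxi peta : R -> R) : Prop :=
  forall t, a < t < b ->
    [/\ is_derive t 1 xi
          (derive1 (fun s => H (xi t) (eta t) s (peta t)) (pxi t)),
        is_derive t 1 eta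
          (derive1 (fun s => H (xi t) (eta t) (pxi t) s) (peta t)),
        is_derive t 1 pxi
          (- derive1 (fun s => H s (eta t) (pxi t) (peta t)) (xi t)),
        is_derive t 1 peta
          (- derive1 (fun s => H (xi t) s (pxi t) (peta t)) (eta t)) &
        H (xi t) (eta t) (pxi t) (peta t) = 0].

Definition newton_at (R : realType) (c1 c2 : R * R) (m1 m2 h : R)
    (x : R -> R * R) (t : R) : Prop :=
  [/\ derivable x t 1,
      is_derive t 1 (derive1 x) (grad (potential c1 c2 m1 m2) (x t)) &
      enorm (derive1 x t) ^+ 2 / 2 - potential c1 c2 m1 m2 (x t) = h].

(* Near the collision time t0, the curve x is the projection by Phi of an orbit
   of K on {K = 0}, up to the time change sigma with
   d sigma = |x - c1| |x - c2| dt.  The factor vanishes only at collisions, so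
   that sigma is a homeomorphism from ]-eps, eps[ onto a neighbourhood of t0. *)
Definition regularised_at (R : realType) (c1 c2 : R * R) (m1 m2 h : R)
    (x : R -> R * R) (t0 : R) : Prop :=
  exists (eps : R) (xi eta pxi peta sigma : R -> R),
    [/\ 0 < eps,
        hamiltonian_orbit0 (K c1 c2 m1 m2 h) (- eps) eps xi eta pxi peta,
        sigma 0 = t0,
        (forall t, - eps < t < eps -> is_derive t 1 sigma
           (enorm (x (sigma t) - c1) * enorm (x (sigma t) - c2))) &
        forall t, - eps < t < eps -> x (sigma t) = Phi c1 c2 (xi t) (eta t)].

(* Energy-h trajectory, in physical time, over the time interval ]a, b[. *)
Definition trajectory (R : realType) (c1 c2 : R * R) (m1 m2 h a b : R)
    (x : R -> R * R) : Prop :=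
  forall t, a < t < b ->
    (x t <> c1 -> x t <> c2 -> newton_at c1 c2 m1 m2 h x t) /\
    (x t = c1 \/ x t = c2 -> regularised_at c1 c2 m1 m2 h x t).

Definition inward_normal (R : realType) (Omega : set (R * R))
    (gam : R -> R * R) (theta : R) (n : R * R) : Prop :=
  [/\ enorm n = 1, dot n (derive1 gam theta) = 0 &
      \forall s \near 0^'+, Omega (gam theta + s *: n)].

(* M_h.  The identification with S^1 x ]-pi/2, pi/2[ being a homeomorphism, the
   topology is that of a subspace of (R * R) * (R * R). *)
Definition phase_space (R : realType) (c1 c2 : R * R) (m1 m2 h : R)
    (Omega : set (R * R)) (gam : R -> R * R) : set ((R * R) * (R * R)) :=
  [set z | exists theta n,
    [/\ z.1 = gam theta,
        enorm z.2 ^+ 2 / 2 - potential c1 c2 m1 m2 z.1 = h,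
        inward_normal Omega gam theta n & 0 < dot z.2 n]].

Definition reflect (R : realType) (n v : R * R) : R * R :=
  v - (2 * dot v n) *: n.

(* The trajectory issued from z, followed up to its return time T; it meets the
   boundary transversally there, and is then reflected to w. *)
Definition billiard_rel (R : realType) (c1 c2 : R * R) (m1 m2 h : R)
    (Omega : set (R * R)) (gam : R -> R * R) (z w : (R * R) * (R * R)) : Prop :=
  phase_space c1 c2 m1 m2 h Omega gam z /\
  exists (x : R -> R * R) (a b T : R),
    [/\ a < 0 /\ 0 < T < b,
        trajectory c1 c2 m1 m2 h a b x,
        x 0 = z.1 /\ derive1 x 0 = z.2,
        boundary Omega (x T) /\ (forall t, 0 < t < T -> ~ boundary Omega (x t)) &
        exists theta n,
          [/\ x T = gam theta, inward_normal Omega gam theta n,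
              dot (derive1 x T) n != 0 &
              w = (x T, reflect n (derive1 x T))]].

Definition billiard_dom (R : realType) (c1 c2 : R * R) (m1 m2 h : R)
    (Omega : set (R * R)) (gam : R -> R * R) : set ((R * R) * (R * R)) :=
  [set z | exists w, billiard_rel c1 c2 m1 m2 h Omega gam z w].

(* Trajectories being determined by their initial condition, [billiard_rel] is
   functional; outside [billiard_dom] the value is irrelevant. *)
Definition billiard_map (R : realType) (c1 c2 : R * R) (m1 m2 h : R)
    (Omega : set (R * R)) (gam : R -> R * R) (z : (R * R) * (R * R)) :
    (R * R) * (R * R) :=
  xget z (billiard_rel c1 c2 m1 m2 h Omega gam z).

Definition invariant_set (X : Type) (D : set X) (f : X -> X) (L : set X) : Prop :=
  L `<=` D /\ f @` L = L.

Definition full_shift_space (S : choiceType) : topologicalType :=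
  prod_topology (fun _ : int => discrete_topology S).

Definition full_shift (S : choiceType) (s : full_shift_space S) :
    full_shift_space S :=
  fun k : int => s (k + 1).

(* (n, eps)-separated finite subsets of A for f *)
Definition separated (R : realType) (X : pseudoMetricType R) (f : X -> X)
    (A : set X) (n : nat) (eps : R) (s : seq X) : Prop :=
  [/\ uniq s, {in s, forall x, A x} &
      {in s &, forall x y, x != y ->
         exists2 k : nat, (k < n)%N & ~ ball (iter k f x) eps (iter k f y)}].

(* Bowen's definition; the supremum over eps > 0 is the limit as eps tends to
   0. *)
Definition topological_entropy (R : realType) (X : pseudoMetricType R)
    (f : X -> X) (A : set X) : \bar R :=
  ereal_sup [set limn_esup (fun n : nat =>
      ereal_sup [set (ln (size s)%:R / n%:R)%:E | s in separated f A n eps])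
    | eps in [set eps : R | 0 < eps]].

(* Main.v *)
(** In the elliptic coordinates y = sinh (xi / 2) >= 0 and eta the motion
    separates.  Let ym > 0 be the minimum of y on the boundary.  Near the place
    where it is attained the boundary is a flat graph y = u(eta); as it is not a
    confocal ellipse, it leaves the level ym on both sides, so u' takes small
    values of both signs, at angles e1 < e2.  A particle that leaves this arc
    downwards with p_xi^2 = 2 (E_y - E), E > 0, turns at a level 0 < r < ym
    (E_r = E), so it avoids the segment and the centres, and it climbs back to
    the level of the arc while eta increases.  It hits nothing on the way, being
    steeper than the arc.  Near the arc a state is thus a pair (eta, E).

    As E tends to 0 the orbit approaches the segment and the flight time, hence
    the angle swept, tends to infinity; so there are infinitely many disjoint
    windows of values of E, accumulating at 0, on each of which the arrival
    angle modulo 2 pi sweeps [e1, e2].  The reflection at e1 and e2, where the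
    slopes have opposite signs, sends E below 0 and above all the windows, so
    that the image of each window stretches across all of them.  With arrival
    angles clamped to [e1, e2] the step becomes a continuous map defined
    everywhere: a finite itinerary is realised by a single use of the
    intermediate value theorem on a composite of clamped steps, a bi-infinite
    one by compactness.  The windows being disjoint, the itinerary is a
    continuous function of the state, and M windows give a compact invariant set
    of entropy at least ln M. *)

(* The boundary is only C^1, so no curvature and no hyperbolic estimate is at hand: the dynamics
   rests on signs, monotonicity and continuity alone, and gives a semiconjugacy. The value E = 0 is
   the separatrix of orbits asymptotic to the segment, whence the unbounded flight times. In y the
   time is singular at the turning level; the substitution y = r + tau^2 removes the singularity,
   and a whole flight becomes a passage of tau from a negative to a positive value. All smallness is
   put into one slope bound [ka]: it keeps reflected particles moving downwards with eta increasing,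
   makes arrival angles monotone and flights steeper than the arc. It is chosen after constants that
   depend on the level ym only, so the arc comes last. The past of a state is recovered because
   reflection is an involution: the previous E, hence the previous window, is read off the present
   state before the previous state is known. Finally, [billiard_map] is a choice in a relation whose
   trajectories may collide with the centres, so competitors of the constructed orbit must be shown
   not to. *)
Require Import Defs.
From mathcomp Require Import all_boot all_order all_algebra.
From mathcomp Require Import all_classical all_reals all_analysis.
From mathcomp Require Import ring lra zify.
Import Order.TTheory GRing.Theory Num.Theory.
Import numFieldNormedType.Exports.
Local Open Scope classical_set_scope.
Local Open Scope ring_scope.
Set Implicit Arguments.
Unset Strict Implicit.
Unset Printing Implicit Defensive.

(** * Calculus on the line *)

(* [lra] on the order hypotheses only: it is slow in the presence of equations
   between vectors and of local definitions. *)
Ltac olra :=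
  repeat match goal with x := _ |- _ => clearbody x end;
  repeat match goal with
  | H : ?P |- _ => lazymatch P with
    | is_true (_ <= _) => fail
    | is_true (_ < _) => fail
    | is_true (_ && _) => fail
    | _ => clear H
    end
  end; lra.

Lemma is_derive_pair (R : realType) (f g : R -> R) (t df dg : R) :
  is_derive t 1 f df -> is_derive t 1 g dg ->
  is_derive t 1 (fun s => (f s, g s)) (df, dg).
Proof.
move=> Hf Hg.
have cv (k : R -> R) (dk : R) : is_derive t 1 k dk ->
    h^-1 *: ((k \o shift t) (h *: 1) - k t) @[h --> 0^'] --> dk.
  by case=> /cvg_ex[l Hl] <-; rewrite /derive (cvg_lim _ Hl).
have Hcvg : h^-1 *: (((fun s => (f s, g s)) \o shift t) (h *: 1) - (f t, g t))
    @[h --> 0^'] --> (df, dg).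
  exact: (cvg_pair (cv _ _ Hf) (cv _ _ Hg)).
constructor; first by apply/cvg_ex; exists (df, dg).
by apply/cvg_lim => //; exact: norm_hausdorff.
Qed.

Lemma is_derive_fst (R : realType) (x : R -> R * R) (t : R) (v : R * R) :
  is_derive t 1 x v -> is_derive t 1 (fun s => (x s).1) v.1.
Proof.
case=> /cvg_ex[l Hl] E.
have {}E : l = v by rewrite -E; apply/esym/cvg_lim => //; exact: norm_hausdorff.
subst v.
have Hcvg : h^-1 *: (((fun s => (x s).1) \o shift t) (h *: 1) - (x t).1)
    @[h --> 0^'] --> l.1.
  have Hc : y.1 @[y --> nbhs l] --> l.1 by exact: cvg_fst.
  exact: (cvg_comp _ _ Hl Hc).
constructor; first by apply/cvg_ex; exists l.1.
exact/cvg_lim.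
Qed.

Lemma is_derive_snd (R : realType) (x : R -> R * R) (t : R) (v : R * R) :
  is_derive t 1 x v -> is_derive t 1 (fun s => (x s).2) v.2.
Proof.
case=> /cvg_ex[l Hl] E.
have {}E : l = v by rewrite -E; apply/esym/cvg_lim => //; exact: norm_hausdorff.
subst v.
have Hcvg : h^-1 *: (((fun s => (x s).2) \o shift t) (h *: 1) - (x t).2)
    @[h --> 0^'] --> l.2.
  have Hc : y.2 @[y --> nbhs l] --> l.2 by exact: cvg_snd.
  exact: (cvg_comp _ _ Hl Hc).
constructor; first by apply/cvg_ex; exists l.2.
exact/cvg_lim.
Qed.

Lemma is_derive_derive1 (R : realType) (V : normedModType R) (f : R -> V) (t : R)
  (l : V) : is_derive t 1 f l -> derive1 f t = l.
Proof. by move=> H; rewrite derive1E derive_val. Qed.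

Lemma derivable_is_derive (R : realType) (V : normedModType R) (f : R -> V)
  (t : R) : derivable f t 1 -> is_derive t 1 f (derive1 f t).
Proof. by move=> H; rewrite derive1E; exact: derivableP. Qed.

Section is_derive_lambda.
Variable R : realType.
Implicit Types (f g : R -> R) (x a b : R).

Lemma dD f g x a b : is_derive x 1 f a -> is_derive x 1 g b ->
  is_derive x 1 (fun t => f t + g t) (a + b).
Proof. exact: is_deriveD. Qed.

Lemma dN f x a : is_derive x 1 f a -> is_derive x 1 (fun t => - f t) (- a).
Proof. exact: is_deriveN. Qed.

Lemma dM f g x a b : is_derive x 1 f a -> is_derive x 1 g b ->
  is_derive x 1 (fun t => f t * g t) (a * g x + f x * b).
Proof.
move=> Hf Hg.
have H : is_derive x 1 (fun t => f t * g t) (f x * b + g x * a) by exact: is_deriveM.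
by apply: is_derive_eq; rewrite [RHS]addrC [a * _]mulrC.
Qed.

Lemma dcst (c x : R) : is_derive x 1 (fun=> c) 0.
Proof. exact: is_derive_cst. Qed.

Lemma did x : is_derive x 1 (fun t => t) 1.
Proof. exact: is_derive_id. Qed.

Lemma dX f n x a : is_derive x 1 f a ->
  is_derive x 1 (fun t => f t ^+ n) (n%:R * f x ^+ n.-1 * a).
Proof.
move=> Hf; rewrite (_ : (fun t => _) = f ^+ n); last first.
  by apply/funext => t; rewrite exprfctE.
have H : is_derive x 1 (f ^+ n) (n%:R *: f x ^+ n.-1 *: a) by exact: is_deriveX.
by apply: is_derive_eq; rewrite /GRing.scale /= mulr_natl.
Qed.

Lemma dV f x a : f x != 0 -> is_derive x 1 f a ->
  is_derive x 1 (fun t => (f t)^-1) (- (a / f x ^+ 2)).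
Proof.
move=> f0 Hf; have H := is_deriveV f0 Hf.
by apply: is_derive_eq; rewrite /GRing.scale /= mulNr mulrC.
Qed.

Lemma dcomp f g x a b : is_derive (g x) 1 f a -> is_derive x 1 g b ->
  is_derive x 1 (fun t => f (g t)) (a * b).
Proof. exact: is_derive1_comp. Qed.

Lemma dcos f x a : is_derive x 1 f a ->
  is_derive x 1 (fun t => cos (f t)) (- sin (f x) * a).
Proof. by apply: dcomp; exact: is_derive_cos. Qed.

Lemma dsin f x a : is_derive x 1 f a ->
  is_derive x 1 (fun t => sin (f t)) (cos (f x) * a).
Proof. by apply: dcomp; exact: is_derive_sin. Qed.

Lemma dexp f x a : is_derive x 1 f a ->
  is_derive x 1 (fun t => expR (f t)) (expR (f x) * a).
Proof. by apply: dcomp; exact: is_derive_expR. Qed.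

Lemma dsqrt f x a : 0 < f x -> is_derive x 1 f a ->
  is_derive x 1 (fun t => Num.sqrt (f t)) ((2 * Num.sqrt (f x))^-1 * a).
Proof. by move=> f0; apply: dcomp; exact: is_derive1_sqrt. Qed.

Lemma is_derive_cts f x a : is_derive x 1 f a -> {for x, continuous f}.
Proof.
by case=> H _; apply/differentiable_continuous; apply/derivable1_diffP.
Qed.

End is_derive_lambda.

Ltac dauto :=
  lazymatch goal with
  | |- is_derive _ _ (fun _ => ?c) _ => eapply dcst
  | |- is_derive _ _ (fun s => s) _ => eapply did
  | |- is_derive _ _ (@GRing.mul _ ?c) _ => eapply (@dM _ (fun=> c) (fun s => s)); dauto
  | |- is_derive _ _ (@Algebra.add _ ?c) _ => eapply (@dD _ (fun=> c) (fun s => s)); dauto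
  | |- is_derive _ _ (@Algebra.opp _) _ => eapply (@dN _ (fun s => s)); dauto
  | |- is_derive _ _ (@expR _) _ => eapply is_derive_expR
  | |- is_derive _ _ (@cos _) _ => eapply is_derive_cos
  | |- is_derive _ _ (@sin _) _ => eapply is_derive_sin
  | |- is_derive _ _ (fun s => @?f s + @?g s) _ => eapply dD; dauto
  | |- is_derive _ _ (fun s => @?f s * @?g s) _ => eapply dM; dauto
  | |- is_derive _ _ (fun s => - @?f s) _ => eapply dN; dauto
  | |- is_derive _ _ (fun s => @?f s ^+ _) _ => eapply dX; dauto
  | |- is_derive _ _ (fun s => (@?f s)^-1) _ => eapply dV; [cbv beta | dauto]
  | |- is_derive _ _ (fun s => cos (@?f s)) _ => eapply dcos; dauto
  | |- is_derive _ _ (fun s => sin (@?f s)) _ => eapply dsin; dauto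
  | |- is_derive _ _ (fun s => expR (@?f s)) _ => eapply dexp; dauto
  | |- is_derive _ _ (fun s => Num.sqrt (@?f s)) _ => eapply dsqrt; [cbv beta | dauto]
  | _ => first [ eassumption | idtac ]
  end.

(** * Continuity of composite expressions *)

Section continuous_lambda.
Variables (R : realType) (T : topologicalType).
Implicit Types (f g : T -> R) (p : T).

Lemma cD f g p : continuous_at p f -> continuous_at p g ->
  continuous_at p (fun t => f t + g t).
Proof. exact: cvgD. Qed.

Lemma cN f p : continuous_at p f -> continuous_at p (fun t => - f t).
Proof. exact: cvgN. Qed.

Lemma cM f g p : continuous_at p f -> continuous_at p g ->
  continuous_at p (fun t => f t * g t).
Proof. exact: cvgM. Qed.

Lemma ccst (U : topologicalType) (c : U) p : continuous_at p (fun _ : T => c).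
Proof. exact: cvg_cst. Qed.

Lemma ccomp (U V : topologicalType) (f : U -> V) (g : T -> U) p :
  continuous_at (g p) f -> continuous_at p g ->
  continuous_at p (fun t => f (g t)).
Proof. by move=> Hf Hg; apply: (@continuous_comp _ _ _ g f). Qed.

Lemma cX f n p : continuous_at p f -> continuous_at p (fun t => f t ^+ n).
Proof. exact: (@ccomp R R (fun x => x ^+ n) f p (@exprn_continuous R n _)). Qed.

Lemma cV f p : f p != 0 -> continuous_at p f ->
  continuous_at p (fun t => (f t)^-1).
Proof. by move=> f0 Hf; apply: cvgV. Qed.

Lemma ccos f p : continuous_at p f -> continuous_at p (fun t => cos (f t)).
Proof. exact: (@ccomp R R cos f p (@continuous_cos R _)). Qed.

Lemma csin f p : continuous_at p f -> continuous_at p (fun t => sin (f t)).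
Proof. exact: (@ccomp R R sin f p (@continuous_sin R _)). Qed.

Lemma csqrt f p : continuous_at p f -> continuous_at p (fun t => Num.sqrt (f t)).
Proof. exact: (@ccomp R R Num.sqrt f p (@sqrt_continuous R _)). Qed.

Lemma cmax f g p : continuous_at p f -> continuous_at p g ->
  continuous_at p (fun t => Num.max (f t) (g t)).
Proof. exact: continuous_max. Qed.

Lemma cmin f g p : continuous_at p f -> continuous_at p g ->
  continuous_at p (fun t => Num.min (f t) (g t)).
Proof. exact: continuous_min. Qed.

Lemma cpair (U V : topologicalType) (f : T -> U) (g : T -> V) p :
  continuous_at p f -> continuous_at p g ->
  continuous_at p (fun t => (f t, g t)).
Proof. exact: cvg_pair. Qed.

Lemma cfst (U V : topologicalType) (f : T -> U * V) p :
  continuous_at p f -> continuous_at p (fun t => (f t).1).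
Proof. by move=> Hf; apply: (cvg_comp _ _ Hf); exact: cvg_fst. Qed.

Lemma csnd (U V : topologicalType) (f : T -> U * V) p :
  continuous_at p f -> continuous_at p (fun t => (f t).2).
Proof. by move=> Hf; apply: (cvg_comp _ _ Hf); exact: cvg_snd. Qed.

Lemma cidt p : continuous_at p (fun t : T => t).
Proof. exact: cvg_id. Qed.

End continuous_lambda.

Lemma cfst0 (U V : topologicalType) (p : U * V) : continuous_at p fst.
Proof. exact: cvg_fst. Qed.

Lemma csnd0 (U V : topologicalType) (p : U * V) : continuous_at p snd.
Proof. exact: cvg_snd. Qed.

Ltac cauto :=
  lazymatch goal with
  | |- continuous_at _ (fun _ => ?c) => eapply ccst
  | |- continuous_at _ (fun s => s) => eapply cidt
  | |- continuous_at _ fst => eapply cfst0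
  | |- continuous_at _ snd => eapply csnd0
  | |- continuous_at _ (@GRing.mul _ ?c) => eapply (@cM _ _ (fun=> c) (fun s => s)); cauto
  | |- continuous_at _ (@Algebra.add _ ?c) => eapply (@cD _ _ (fun=> c) (fun s => s)); cauto
  | |- continuous_at _ (@Algebra.opp _) => eapply (@cN _ _ (fun s => s)); cauto
  | |- continuous_at _ (@cos _) => eapply (@ccos _ _ (fun s => s)); cauto
  | |- continuous_at _ (@sin _) => eapply (@csin _ _ (fun s => s)); cauto
  | |- continuous_at _ (@Num.sqrt _) => eapply (@csqrt _ _ (fun s => s)); cauto
  | |- continuous_at _ (fun s => @?f s + @?g s) => eapply cD; cauto
  | |- continuous_at _ (fun s => @?f s * @?g s) => eapply cM; cauto
  | |- continuous_at _ (fun s => - @?f s) => eapply cN; cauto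
  | |- continuous_at _ (fun s => @?f s ^+ _) => eapply cX; cauto
  | |- continuous_at _ (fun s => (@?f s)^-1) => eapply cV; [cbv beta | cauto]
  | |- continuous_at _ (fun s => cos (@?f s)) => eapply ccos; cauto
  | |- continuous_at _ (fun s => sin (@?f s)) => eapply csin; cauto
  | |- continuous_at _ (fun s => Num.sqrt (@?f s)) => eapply csqrt; cauto
  | |- continuous_at _ (fun s => Num.max (@?f s) (@?g s)) => eapply cmax; cauto
  | |- continuous_at _ (fun s => Num.min (@?f s) (@?g s)) => eapply cmin; cauto
  | |- continuous_at _ (fun s => (@?f s, @?g s)) => eapply cpair; cauto
  | |- continuous_at _ (fun s => (@?f s).1) => eapply cfst; cauto
  | |- continuous_at _ (fun s => (@?f s).2) => eapply csnd; cauto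
  | _ => first [ eassumption | idtac ]
  end.

Definition derives (R : realType) (f : R -> R) (x a : R) : Prop :=
  is_derive x 1 f a.

(* [is_derive] is a class; hiding it keeps typeclass resolution from closing
   the premise before its value is known. *)
Lemma deq (R : realType) (f : R -> R) (x a b : R) :
  derives f x a -> a = b -> is_derive x 1 f b.
Proof. by move=> H <-. Qed.

Ltac dtac := apply: deq; [unfold derives; dauto|cbv beta].

(** * Mean values, antiderivatives, inverse functions and roots *)

Lemma derive0_cst (R : realType) (f : R -> R) (a b : R) :
  (forall x : R, a < x < b -> is_derive x 1 f 0) ->
  forall x y, a < x < b -> a < y < b -> f x = f y.
Proof.
move=> H x y; wlog xy : x y / x <= y.
  by move=> W ax ay; case: (leP x y) => [|/ltW] yx; [exact: W|exact/esym/W].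
move=> /andP[ax xb] /andP[ay yb].
have [||c _] := @MVT_segment _ f (fun=> 0) x y xy.
- by move=> z; rewrite in_itv/= => /andP[xz zy]; apply: H; lra.
- apply: derivable_within_continuous => z; rewrite in_itv/= => /andP[xz zy].
  by have [] : is_derive z 1 f 0 by apply: H; lra.
- by rewrite mul0r => /eqP; rewrite subr_eq0 => /eqP.
Qed.

Lemma MVT_oo (R : realType) (f df : R -> R) (x y : R) : x < y ->
  (forall z : R, x <= z <= y -> is_derive z 1 f (df z)) ->
  exists2 z, x < z < y & f y - f x = df z * (y - x).
Proof.
move=> xy H.
have [||z] := @MVT _ f df x y xy.
- by move=> z; rewrite in_itv/= => /andP[xz zy]; apply: H; lra.
- apply: derivable_within_continuous => z; rewrite in_itv/= => /andP[xz zy].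
  by have [] : is_derive z 1 f (df z) by apply: H; lra.
- by rewrite in_itv/= => zi E; exists z.
Qed.

Lemma antiderivative_exists (R : realType) (q : R -> R) :
  (forall x, {for x, continuous q}) ->
  exists F : R -> R, F 0 = 0 /\ forall x : R, is_derive x 1 F (q x).
Proof.
move=> cq.
(* Integration from a left end -1 gives an antiderivative on ]-1, +oo[ only; the half-line ]-oo, 1[
   is obtained by reflection, and the two are glued on their overlap ]-1, 1[. *)
have half (p : R -> R) : (forall x, {for x, continuous p}) ->
    exists H : R -> R, forall x : R, -1 < x -> is_derive x 1 H (p x).
  move=> cp.
  exists (fun x0 => \int[lebesgue_measure]_(t in `[-1, x0]) p t) => x x1.
  have [||] := @continuous_FTC1_closed R p (-1) x (x + 1) _ _ x1 (cp x).
  - by rewrite ltrDl.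
  - apply: continuous_compact_integrable; first exact: segment_compact.
    by apply: continuous_subspaceT => z; exact: cp.
  - by move=> D E; rewrite -E; exact: derivable_is_derive.
have [H HH] := half q cq.
have [H' HH'] : exists H : R -> R, forall x : R, -1 < x -> is_derive x 1 H (q (- x)).
  apply: half => x; have c1 : continuous_at x (fun t : R => - t) by cauto.
  exact: (ccomp (cq _) c1).
pose K x := - H' (- x).
have HK (x : R) : x < 1 -> is_derive x 1 K (q x).
  move=> x1; have x1' : -1 < - x by lra.
  have h : is_derive x 1 K (- (q (- - x) * - 1)) := dN (dcomp (HH' _ x1') (dN (did x))).
  by apply: is_derive_eq; rewrite opprK; ring.
have HKE (x : R) : -1 < x < 1 -> H x - H 0 = K x - K 0.
  move=> x1.
  have Hd (z : R) : -1 < z < 1 -> is_derive z 1 (fun t => H t - K t) 0.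
    move=> z1; apply: deq.
      apply: dD; first by apply: HH; lra.
      by apply: dN; apply: HK; lra.
    by rewrite subrr.
  have := @derive0_cst _ (fun t => H t - K t) (-1) 1 Hd x 0 x1 ltac:(lra).
  lra.
exists (fun x => if 0 <= x then H x - H 0 else K x - K 0); split.
  by rewrite lexx subrr.
move=> x; have [x0|x0|x0] := ltgtP 0 x.
- apply: (@near_eq_is_derive _ _ _ (fun x => H x - H 0)).
    near=> y; have y0 : 0 < y by near: y; exact: lt_nbhsr.
    by rewrite (ltW y0).
  have x0' : -1 < x by lra.
  apply: deq; first exact: (dD (HH x x0') (dcst (- H 0) x)).
  by rewrite addr0.
- apply: (@near_eq_is_derive _ _ _ (fun x => K x - K 0)).
    near=> y; have y0 : y < 0 by near: y; exact: lt_nbhsl.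
    by rewrite leNgt y0.
  have x0' : x < 1 by lra.
  apply: deq; first exact: (dD (HK x x0') (dcst (- K 0) x)).
  by rewrite addr0.
- apply: (@near_eq_is_derive _ _ _ (fun x => K x - K 0)).
    near=> y; case: ifP => // y0; rewrite HKE//.
    have : -1 < y by near: y; apply: lt_nbhsr; lra.
    have : y < 1 by near: y; apply: lt_nbhsl; lra.
    lra.
  have x0' : x < 1 by lra.
  apply: deq; first exact: (dD (HK x x0') (dcst (- K 0) x)).
  by rewrite addr0.
Unshelve. all: by end_near. Qed.

Lemma MVT_bound (R : realType) (f df : R -> R) (a b C : R) :
  (forall z : R, a <= z <= b -> is_derive z 1 f (df z)) ->
  (forall z : R, a <= z <= b -> `|df z| <= C) ->
  forall x y, a <= x <= b -> a <= y <= b -> `|f x - f y| <= C * `|x - y|.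
Proof.
move=> H HC x y; wlog xy : x y / x < y.
  move=> W ax ay; have [xy|yx|->] := ltgtP x y; first exact: W.
  - by rewrite distrC [X in _ * X]distrC; exact: W.
  - by rewrite !subrr normr0 mulr0.
move=> /andP[ax xb] /andP[ay yb].
have [z zi E] := @MVT_oo R f df x y xy ltac:(by move=> z zi; apply: H; lra).
rewrite distrC E normrM [X in _ * X]distrC ler_wpM2r//; apply: HC; lra.
Qed.

Lemma near_fst (T U : topologicalType) (p : T) (x : U) (P : set T) :
  (\forall t \near p, P t) -> \forall z \near (p, x), P z.1.
Proof.
move=> HP; exists (P, setT) => /=; first by split => //; exact: filterT.
by move=> z [].
Qed.

Lemma near_snd (T U : topologicalType) (p : T) (x : U) (P : set U) :
  (\forall t \near x, P t) -> \forall z \near (p, x), P z.2.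
Proof.
move=> HP; exists (setT, P) => /=; first by split => //; exact: filterT.
by move=> z [].
Qed.

(** By compactness [q p] is uniformly close to [q p0] on [[- M, M]]; the mean value bound carries
    this over to the antiderivatives, which agree at 0. Nothing is asked of [F p] for [p] away from
    [p0], where it may be a default value. *)
Lemma param_antiderivative_continuous (R : realType) (T : topologicalType)
    (q F : T -> R -> R) (p0 : T) (x0 : R) :
  (forall x : R, continuous_at (p0, x) (fun z : T * R => q z.1 z.2)) ->
  (\forall p \near p0, F p 0 = 0 /\ forall x : R, is_derive x 1 (F p) (q p x)) ->
  continuous_at (p0, x0) (fun z : T * R => F z.1 z.2).
Proof.
move=> cq HF.
set M := `|x0| + 1.
have M0 : 0 < M by rewrite ltr_wpDl.
have unif e : 0 < e ->
    \forall p \near p0, (`[- M, M]%classic : set R) `<=` (fun y => `|q p y - q p0 y| < e).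
  move=> e0.
  have /compact_near_coveringP cov := @segment_compact R (- M) M.
  apply: cov => y _.
  have e20 : 0 < e / 2 by lra.
  have /cvgrPdist_lt /(_ _ e20) [[U V] /= [Up0 Vy] UV] := cq y.
  exists (V, U) => //= -[y' p] [/= Vy' Up].
  have h1 := UV (p, y') (conj Up Vy').
  have h2 := UV (p0, y') (conj (nbhs_singleton Up0) Vy').
  rewrite /= in h1 h2.
  have -> : q p y' - q p0 y' = (q p0 y - q p0 y') - (q p0 y - q p y') by ring.
  rewrite (le_lt_trans (ler_normB _ _))//; lra.
have [F0 dF] := nbhs_singleton HF.
apply/cvgrPdist_lt => e e0.
have e20 : 0 < e / 2 by lra.
have e'0 : 0 < e / 2 / M by rewrite divr_gt0.
have cF : continuous_at x0 (F p0) := is_derive_cts (dF x0).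
have /cvgrPdist_lt /(_ _ e20) HV := cF.
have HU := unif _ e'0.
have N1 := near_snd p0 HV.
have N2 := near_fst x0 HF.
have N3 := near_fst x0 HU.
have N4 := near_snd p0 (nbhsx_ballx x0 1 ltr01).
near=> z => /=.
have Hz2 : `|F p0 x0 - F p0 z.2| < e / 2 by near: z.
have [Fz0 dFz] : F z.1 0 = 0 /\ forall x : R, is_derive x 1 (F z.1) (q z.1 x).
  by near: z.
have Hq : (`[- M, M]%classic : set R) `<=` (fun y => `|q z.1 y - q p0 y| < e / 2 / M).
  by near: z.
have zM : - M <= z.2 <= M.
  have : ball x0 1 z.2 by near: z.
  move=> /ltW h; rewrite -ler_norml /M.
  have -> : z.2 = x0 - (x0 - z.2) by ring.
  by rewrite (le_trans (ler_normB _ _))// lerD2l.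
have : `|(F z.1 z.2 - F p0 z.2) - (F z.1 0 - F p0 0)| <= (e / 2 / M) * `|z.2 - 0|.
  apply: (@MVT_bound _ (fun x => F z.1 x - F p0 x) (fun x => q z.1 x - q p0 x) (- M) M) => //.
  - by move=> y yM; apply: ltW; apply: Hq; rewrite /= in_itv.
  - by rewrite oppr_le0 !ltW.
rewrite Fz0 F0 subr0 subr0 subr0 => h.
have {}h : `|F z.1 z.2 - F p0 z.2| <= e / 2.
  apply: (le_trans h).
  rewrite -[leRHS](divfK (lt0r_neq0 M0)) ler_wpM2l ?(ltW e'0)//.
  by rewrite ler_norml.
have -> : F p0 x0 - F z.1 z.2 = (F p0 x0 - F p0 z.2) - (F z.1 z.2 - F p0 z.2) by ring.
rewrite (le_lt_trans (ler_normB _ _))//; lra.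
Unshelve. all: by end_near. Qed.

Section increasing_inverse.
Variables (R : realType) (F q : R -> R).
Hypothesis dF : forall x : R, is_derive x 1 F (q x).
Hypothesis q0 : forall x, 0 < q x.

Lemma gt0_derive_incr x y : x < y -> F x < F y.
Proof.
move=> xy; have [z zi E] := @MVT_oo R F q x y xy (fun z _ => dF z).
by rewrite -subr_gt0 E mulr_gt0// subr_gt0.
Qed.

Lemma gt0_derive_inj : injective F.
Proof.
move=> x y E; have [/gt0_derive_incr|/gt0_derive_incr|//] := ltgtP x y;
  by rewrite E ltxx.
Qed.

(** The inverse is controlled on the range of [F] only, since [F] may be bounded; surjectivity is a
    separate matter. *)
Lemma gt0_derive_inverse :
  exists G : R -> R, cancel F G /\ forall x : R, is_derive (F x) 1 G (q x)^-1.
Proof.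
pose G t := xget 0 [set x | F x = t].
have GF : cancel F G.
  by move=> x; rewrite /G; case: xgetP => [y _ /= /gt0_derive_inj //|/(_ x) /=].
exists G; split => // x; apply: is_derive_inverse.
- by near=> y; exact: GF.
- by near=> y; exact: (is_derive_cts (dF y)).
- by rewrite gt_eqF.
Unshelve. all: by end_near. Qed.

Lemma gt0_derive_surj (c : R) : 0 < c -> (forall x, c <= q x) ->
  forall t, exists x, F x = t.
Proof.
move=> c0 cq t.
pose b := (`|t - F 0| + 1) / c.
have b0 : 0 < b by rewrite divr_gt0// ltr_wpDl.
have lo x y : x < y -> c * (y - x) <= F y - F x.
  move=> xy; have [z zi ->] := @MVT_oo R F q x y xy (fun z _ => dF z).
  by apply: ler_wpM2r; [lra|exact: cq].
have bE : c * b = `|t - F 0| + 1 by rewrite /b mulrC divfK// gt_eqF.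
have h1 := lo 0 b b0.
have h2 := lo (- b) 0 ltac:(by rewrite oppr_lt0).
have h3 := ler_norm (t - F 0).
have h4 := ler_norm (- (t - F 0)).
rewrite normrN in h4.
have [|||x _ E] := @IVT R F (- b) b t.
- lra.
- by apply: continuous_subspaceT => z; exact: (is_derive_cts (dF z)).
- have -> : Num.min (F (- b)) (F b) = F (- b).
    by apply: min_l; apply/ltW/gt0_derive_incr; lra.
  have -> : Num.max (F (- b)) (F b) = F b.
    by apply: max_r; apply/ltW/gt0_derive_incr; lra.
  rewrite subr0 bE in h1; rewrite sub0r opprK bE in h2; lra.
by exists x.
Qed.

End increasing_inverse.

(** The root of an increasing function, replaced by the nearer end when there is none inside, stays
    continuous in the parameter even when the root leaves the interval. Arrival and departure angles
    are defined in this way. *)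
Lemma clamped_root (R : realType) (T : topologicalType) (H : T -> R -> R)
    (a b : R) : a < b ->
  (forall p x y, a <= x -> x < y -> y <= b -> H p x < H p y) ->
  (forall p (y : R), a <= y <= b -> continuous_at y (H p)) ->
  (forall y, a <= y <= b -> continuous (fun p => H p y)) ->
  exists g : T -> R, [/\ continuous g, forall p, a <= g p <= b,
    forall p, H p a <= 0 <= H p b -> H p (g p) = 0,
    forall p, 0 <= H p a -> g p = a & forall p, H p b <= 0 -> g p = b].
Proof.
move=> ab inc cy cp.
(* The signs of [H p] on the two sides of [g] characterise [g], and each sign is an open condition
   on [p]; both halves of continuity come from this. *)
have ex p : exists g, [/\ a <= g <= b, H p a <= 0 <= H p b -> H p g = 0,
    0 <= H p a -> g = a, H p b <= 0 -> g = b &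
    forall y, a <= y <= b -> (y < g -> H p y < 0) /\ (g < y -> 0 < H p y)].
  have iab := inc p a b (lexx _) ab (lexx _).
  have [h1|h1] := leP 0 (H p a).
    exists a; split => //; try lra.
    move=> y /andP[ay yb]; split => [|ay']; first lra.
    by have := inc p a y (lexx _) ay' yb; lra.
  have [h2|h2] := leP (H p b) 0.
    exists b; split => //; try lra.
    move=> y /andP[ay yb]; split => [ay'|]; last lra.
    by have := inc p y b ay ay' (lexx _); lra.
  have [||x xi E] := @IVT R (H p) a b 0 (ltW ab).
  - by apply: continuous_in_subspaceT => y; rewrite inE/= in_itv/=; exact: cy.
  - by rewrite (min_l (ltW iab)) (max_r (ltW iab)) !ltW.
  rewrite in_itv/= in xi; exists x; split => //; try lra.
  move=> y yi; split => xy; first by have := inc p y x; rewrite E; apply; lra.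
  by have := inc p x y; rewrite E; apply; lra.
have [g Hg] := choice ex.
exists g; split => //; try by move=> p; case: (Hg p).
move=> p; apply/cvgrPdist_lt => e e0.
have [gab _ _ _ gp] := Hg p.
have up : \forall p' \near p, g p' < g p + e.
  have [h|h] := ltP b (g p + e / 2).
    by near=> p'; have [+ _ _ _ _] := Hg p'; lra.
  have yab : a <= g p + e / 2 <= b by lra.
  have pos : 0 < H p (g p + e / 2) by apply: (gp _ yab).2; lra.
  have : \forall p' \near p, 0 < H p' (g p + e / 2).
    by apply: (cvgr_gt _ (cp _ yab p)).
  apply: filterS => p' h'; have [_ _ _ _ gp'] := Hg p'.
  have [//|h''] := ltP (g p') (g p + e).
  have := (gp' _ yab).1; lra.
have lo : \forall p' \near p, g p - e < g p'.
  have [h|h] := ltP (g p - e / 2) a.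
    by near=> p'; have [+ _ _ _ _] := Hg p'; lra.
  have yab : a <= g p - e / 2 <= b by lra.
  have neg : H p (g p - e / 2) < 0 by apply: (gp _ yab).1; lra.
  have : \forall p' \near p, H p' (g p - e / 2) < 0.
    by apply: (cvgr_lt _ (cp _ yab p)).
  apply: filterS => p' h'; have [_ _ _ _ gp'] := Hg p'.
  have [//|h''] := ltP (g p - e) (g p').
  have := (gp' _ yab).2; lra.
near=> p'; rewrite ltr_norml.
have h1 : g p' < g p + e by near: p'.
have h2 : g p - e < g p' by near: p'.
by apply/andP; split; lra.
Unshelve. all: by end_near. Qed.

(** * Uniqueness of regularised trajectories *)

(** Continuity induction: the supremum of the times up to which [P] holds is itself such a time by
    the second hypothesis, and cannot be less than [T] by the third. *)
Lemma real_induction (R : realType) (T : R) (P : R -> Prop) :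
  P 0 ->
  (forall t, 0 < t <= T -> (forall s, 0 <= s < t -> P s) -> P t) ->
  (forall t, 0 <= t < T -> P t ->
     exists2 e, 0 < e & forall s, t < s < t + e -> P s) ->
  forall t, 0 <= t <= T -> P t.
Proof.
move=> P0 Pc Po.
have [T0|T0] := ltP T 0; first by move=> t; lra.
pose A := [set t | 0 <= t <= T /\ forall s, 0 <= s <= t -> P s].
have A0 : A 0.
  split; first lra.
  by move=> s s0; have -> : s = 0 by lra.
have hsA : has_sup A by split; [exists 0|exists T => t [] /=; lra].
pose t := sup A.
have tub s : A s -> s <= t by move=> As; exact: sup_upper_bound.
have t0 : 0 <= t by exact: tub.
have tT : t <= T by apply: sup_le_ub => //; [exists 0|move=> s [] /=; lra].
have Plt s : 0 <= s < t -> P s.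
  move=> st.
  have [|u [uT Pu] su] := @sup_adherent _ A (t - s) _ hsA; first lra.
  by apply: Pu; rewrite -/t in su; lra.
have Pt : P t.
  have [->//|t1] := eqVneq t 0.
  apply: Pc => //; rewrite tT andbT lt_neqAle t0 andbT eq_sym//.
have Ple s : 0 <= s <= t -> P s.
  move=> st; have [st'|st'] := ltP s t; first by apply: Plt; lra.
  by have -> : s = t by lra.
move=> s sT; apply: (Ple s).
suff : t = T by lra.
apply/eqP; rewrite eq_le tT/= leNgt; apply/negP => tT'.
have [e e0 He] := Po t ltac:(lra) Pt.
pose u := t + Num.min (e / 2) (T - t).
have u1 : t < u by rewrite /u ltrDl lt_min; apply/andP; split; lra.
have u2 : u < t + e.
  rewrite /u ltrD2l; apply: (le_lt_trans (y := e / 2)); last lra.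
  by rewrite ge_min lexx.
have u3 : u <= T.
  by rewrite /u -lerBrDl ge_min lexx orbT.
have Au : A u.
  split; first lra.
  move=> r ru; have [rt|rt] := leP r t; first by apply: (Ple r); lra.
  by apply: He; lra.
by have := tub _ Au; lra.
Qed.

(** The product of [W t] and exp (- C t) has a nonpositive derivative and starts at 0. *)
Lemma gronwall_eq0 (R : realType) (W W' : R -> R) (C t0 s : R) : t0 < s ->
  (forall t : R, t0 <= t <= s -> is_derive t 1 W (W' t)) ->
  (forall t, t0 <= t <= s -> W' t <= C * W t) ->
  W t0 = 0 -> 0 <= W s -> W s = 0.
Proof.
move=> ts dW WC Wt0 Ws0.
have dWe (t : R) : t0 <= t <= s -> is_derive t 1 (fun t => W t * expR (- (C * t)))
    ((W' t - C * W t) * expR (- (C * t))).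
  by move=> /dW dWt; dtac; ring.
have [z zi] := MVT_oo ts dWe.
rewrite Wt0 mul0r subr0 => E.
have h1 : W' z - C * W z <= 0 by rewrite subr_le0; apply: WC; lra.
have h2 : W s * expR (- (C * s)) <= 0.
  rewrite E; apply: mulr_le0_ge0; last lra.
  by apply: mulr_le0_ge0 => //; exact: expR_ge0.
apply/eqP; rewrite eq_le Ws0 andbT.
by rewrite pmulr_lle0 ?expR_gt0 in h2.
Qed.

(** * Euclidean norm and Lipschitz bounds for the force *)

Section euclidean_plane.
Variable R : realType.
Implicit Types u v w : R * R.

Lemma dot_ge0 u : 0 <= dot u u.
Proof. by rewrite /dot addr_ge0// -expr2 sqr_ge0. Qed.

Lemma enorm_ge0 u : 0 <= enorm u.
Proof. exact: sqrtr_ge0. Qed.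

Lemma enorm_sqr u : enorm u ^+ 2 = dot u u.
Proof. by rewrite sqr_sqrtr// dot_ge0. Qed.

Lemma dot_eq0 u : dot u u = 0 -> u = 0.
Proof.
case: u => a b; rewrite /dot /= => /eqP.
rewrite paddr_eq0 -?expr2 ?sqr_ge0// !sqrf_eq0 => /andP[/eqP -> /eqP ->].
by [].
Qed.

Lemma dot_sum_eq0 u v : dot u u + dot v v = 0 -> u = 0 /\ v = 0.
Proof.
move/eqP; rewrite paddr_eq0 ?dot_ge0// => /andP[/eqP u0 /eqP v0].
by split; exact: dot_eq0.
Qed.

Lemma enorm_gt0 u : u <> 0 -> 0 < enorm u.
Proof.
move=> u0; rewrite sqrtr_gt0 lt_neqAle dot_ge0 andbT.
by apply/eqP => /esym/dot_eq0.
Qed.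

Lemma enorm0 : enorm (0 : R * R) = 0.
Proof. by rewrite /enorm /dot /= mulr0 addr0 sqrtr0. Qed.

Lemma cauchy_schwarz u v : dot u v <= enorm u * enorm v.
Proof.
have [h|h] := leP (dot u v) 0.
  by apply: (le_trans h); rewrite mulr_ge0// enorm_ge0.
rewrite -(@ler_pXn2r _ 2)// ?nnegrE ?mulr_ge0 ?enorm_ge0 ?(ltW h)//.
rewrite exprMn !enorm_sqr /dot.
rewrite -subr_ge0 (_ : _ - _ = (u.1 * v.2 - u.2 * v.1) ^+ 2) ?sqr_ge0//.
by ring.
Qed.

Lemma enorm_sub_sqr u v : (enorm u - enorm v) ^+ 2 <= dot (u - v) (u - v).
Proof.
have h := cauchy_schwarz u v.
have -> : dot (u - v) (u - v) = dot u u + dot v v - 2 * dot u v.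
  by rewrite /dot /=; ring.
rewrite -!enorm_sqr; nra.
Qed.

(** With r and s the two norms, the left side is (r - s)^2 times three monomials of degree -6, plus
    |u - v|^2 / (r s)^3. Since |r - s| <= |u - v|, four terms of size at most e^-6 remain. *)
Lemma kepler_field_lipschitz u v (e : R) : 0 < e -> e <= enorm u -> e <= enorm v ->
  dot (enorm u ^- 3 *: u - enorm v ^- 3 *: v) (enorm u ^- 3 *: u - enorm v ^- 3 *: v)
  <= 4 / e ^+ 6 * dot (u - v) (u - v).
Proof.
move=> e0 eu ev.
have hr := enorm_sub_sqr u v.
set r := enorm u in eu hr *; set s := enorm v in ev hr *.
have r0 : 0 < r by lra. have s0 : 0 < s by lra.
set D := dot (u - v) (u - v) in hr *.
have D0 : 0 <= D by exact: dot_ge0.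
have -> : dot (r ^- 3 *: u - s ^- 3 *: v) (r ^- 3 *: u - s ^- 3 *: v) =
   (r - s) ^+ 2 * (r ^- 4 * s ^- 2 + r ^- 3 * s ^- 3 + r ^- 2 * s ^- 4)
   + D * (r ^- 3 * s ^- 3).
  have ru : r ^+ 2 = dot u u by exact: enorm_sqr.
  have sv : s ^+ 2 = dot v v by exact: enorm_sqr.
  have DE : D = r ^+ 2 + s ^+ 2 - 2 * dot u v by rewrite ru sv /D /dot /=; ring.
  have -> : dot (r ^- 3 *: u - s ^- 3 *: v) (r ^- 3 *: u - s ^- 3 *: v) =
     r ^- 6 * dot u u + s ^- 6 * dot v v - 2 * (r ^- 3 * s ^- 3) * dot u v.
    rewrite /dot /= /GRing.scale /=.
    have -> : r ^- 6 = r ^- 3 * r ^- 3 by rewrite -invfM -exprD.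
    have -> : s ^- 6 = s ^- 3 * s ^- 3 by rewrite -invfM -exprD.
    ring.
  rewrite DE -ru -sv; field.
  by rewrite !gt_eqF.
have ie : 0 < e^-1 by rewrite invr_gt0.
have ir : 0 < r^-1 <= e^-1 by rewrite invr_gt0 r0 lef_pV2 ?posrE.
have is_ : 0 < s^-1 <= e^-1 by rewrite invr_gt0 s0 lef_pV2 ?posrE.
have pw (m n : nat) : (m + n = 6)%N -> 0 <= r ^- m * s ^- n <= e ^- 6.
  move=> mn; rewrite -!exprVn; apply/andP; split.
    by rewrite mulr_ge0// exprn_ge0//; lra.
  rewrite -mn exprD ler_pM ?exprn_ge0//; try lra.
    by apply: lerXn2r; rewrite ?nnegrE; lra.
  by apply: lerXn2r; rewrite ?nnegrE; lra.
have := pw 4 2 erefl; have := pw 3 3 erefl; have := pw 2 4 erefl.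
set A := r ^- 4 * _; set B := r ^- 3 * _; set C := r ^- 2 * _; set E := e ^- 6.
move=> hC hB hA.
apply: (@le_trans _ _ (D * (A + B + C) + D * B)).
  rewrite lerD2r; apply: ler_wpM2r => //; lra.
have -> : 4 / e ^+ 6 * D = D * (4 * E) by rewrite /E; ring.
rewrite -mulrDr; apply: ler_wpM2l => //; lra.
Qed.

Lemma continuous_enorm u : continuous_at u (@enorm R).
Proof.
have : continuous_at u (fun w : R * R => Num.sqrt (w.1 * w.1 + w.2 * w.2)) by cauto.
by [].
Qed.

End euclidean_plane.

Lemma is_derive_dot (R : realType) (x y : R -> R * R) (t : R) (dx dy : R * R) :
  is_derive t 1 x dx -> is_derive t 1 y dy ->
  is_derive t 1 (fun s => dot (x s) (y s)) (dot dx (y t) + dot (x t) dy).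
Proof.
move=> Hx Hy.
have x_1 := is_derive_fst Hx; have x_2 := is_derive_snd Hx.
have y_1 := is_derive_fst Hy; have y_2 := is_derive_snd Hy.
apply: deq; first exact: (dD (dM x_1 y_1) (dM x_2 y_2)).
by rewrite /dot; ring.
Qed.

Section newton.
Variables (R : realType) (c1 c2 : R * R) (m1 m2 h : R).

Definition force (x : R * R) : R * R :=
  - (m1 / enorm (x - c1) ^+ 3) *: (x - c1)
  - (m2 / enorm (x - c2) ^+ 3) *: (x - c2).

Lemma is_derive_inv_enorm (c x v : R * R) (m : R) : x <> c ->
  is_derive (0 : R) 1 (fun t : R => m / enorm (t *: v + x - c))
    (- (m / enorm (x - c) ^+ 3) * dot v (x - c)).
Proof.
move=> xc.
have r0 : 0 < enorm (x - c) by apply: enorm_gt0 => /eqP; rewrite subr_eq0 => /eqP.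
have E (t : R) : dot (t *: v + x - c) (t *: v + x - c) =
  (t * v.1 + (x.1 - c.1)) * (t * v.1 + (x.1 - c.1)) +
  (t * v.2 + (x.2 - c.2)) * (t * v.2 + (x.2 - c.2)).
  by rewrite /dot /= /GRing.scale /= !addrA.
have r0' : 0 < dot (x - c) (x - c) by rewrite -enorm_sqr exprn_gt0.
rewrite /enorm; under eq_fun do rewrite E.
have s0 : (0 * v.1 + (x.1 - c.1)) * (0 * v.1 + (x.1 - c.1)) +
  (0 * v.2 + (x.2 - c.2)) * (0 * v.2 + (x.2 - c.2)) = dot (x - c) (x - c).
  by rewrite /dot /= !mul0r !add0r.
dtac; rewrite s0 //; last first.
  rewrite -/(enorm (x - c)) /dot /=; set r := enorm (x - c).
  field; by rewrite gt_eqF.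
by rewrite sqrtr_eq0 -ltNge.
Qed.

Lemma directional_derive (f : R * R -> R) (x v : R * R) (l : R) :
  is_derive (0 : R) 1 (fun t : R => f (t *: v + x)) l -> 'D_v f x = l.
Proof.
case=> _ <-; rewrite /derive.
rewrite (_ : (fun h0 => h0^-1 *: ((f \o shift x) (h0 *: v) - f x)) =
  (fun h0 => h0^-1 *: (((fun t : R => f (t *: v + x)) \o shift 0) (h0 *: 1)
     - f (0 *: v + x))))//.
apply/funext => t /=; rewrite scale0r add0r addr0.
by rewrite /GRing.scale /= mulr1.
Qed.

Lemma grad_potential (x : R * R) : x <> c1 -> x <> c2 ->
  grad (potential c1 c2 m1 m2) x = force x.
Proof.
move=> x1 x2; rewrite /grad /force.
have H v : 'D_v (potential c1 c2 m1 m2) x =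
   - (m1 / enorm (x - c1) ^+ 3) * dot v (x - c1)
   + - (m2 / enorm (x - c2) ^+ 3) * dot v (x - c2).
  by apply: directional_derive; apply: dD; exact: is_derive_inv_enorm.
rewrite !H; move: (enorm (x - c1)) (enorm (x - c2)) => r1 r2.
move: (x - c1) (x - c2) => [a b] [c d].
have -> : - (m1 / r1 ^+ 3) *: (a, b) - (m2 / r2 ^+ 3) *: (c, d) =
  (- (m1 / r1 ^+ 3) * a - (m2 / r2 ^+ 3) * c,
   - (m1 / r1 ^+ 3) * b - (m2 / r2 ^+ 3) * d) by [].
by congr pair; rewrite /dot /=; ring.
Qed.

Lemma force_lipschitz (x y : R * R) (e : R) : 0 < e ->
  e <= enorm (x - c1) -> e <= enorm (y - c1) ->
  e <= enorm (x - c2) -> e <= enorm (y - c2) ->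
  dot (force x - force y) (force x - force y) <=
  8 * (m1 ^+ 2 + m2 ^+ 2) / e ^+ 6 * dot (x - y) (x - y).
Proof.
move=> e0 x1 y1 x2 y2.
have h1 := kepler_field_lipschitz e0 x1 y1.
have h2 := kepler_field_lipschitz e0 x2 y2.
have E c : x - c - (y - c) = x - y by rewrite opprB addrA subrK.
rewrite !E in h1 h2.
set k := 4 / e ^+ 6 * _ in h1 h2.
set F1 := _ *: (x - c1) - _ in h1.
set F2 := _ *: (x - c2) - _ in h2.
have -> : force x - force y = - (m1 *: F1 + m2 *: F2).
  rewrite /force /F1 /F2; apply/pair_equal_spec; split; rewrite /= /GRing.scale /=; ring.
have -> : 8 * (m1 ^+ 2 + m2 ^+ 2) / e ^+ 6 * dot (x - y) (x - y) =
   2 * m1 ^+ 2 * k + 2 * m2 ^+ 2 * k by rewrite /k; ring.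
have : dot (- (m1 *: F1 + m2 *: F2)) (- (m1 *: F1 + m2 *: F2)) <=
   2 * m1 ^+ 2 * dot F1 F1 + 2 * m2 ^+ 2 * dot F2 F2.
  have := dot_ge0 (m1 *: F1 - m2 *: F2).
  rewrite /dot /= /GRing.scale /=; nra.
move/le_trans; apply; apply: lerD; apply: ler_wpM2l => //;
  by rewrite mulr_ge0// sqr_ge0.
Qed.

End newton.

Section uniqueness.
Variables (R : realType) (c1 c2 : R * R) (m1 m2 h : R).
Local Notation newton := (newton_at c1 c2 m1 m2 h).
Local Notation F := (force c1 c2 m1 m2).

Lemma newton_force (x : R -> R * R) (t : R) : x t <> c1 -> x t <> c2 ->
  newton x t -> is_derive t 1 x (derive1 x t) /\ is_derive t 1 (derive1 x) (F (x t)).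
Proof.
move=> x1 x2 [dx ddx _]; split; first exact: derivable_is_derive.
by rewrite -(grad_potential m1 m2 x1 x2).
Qed.

Lemma continuous_at_curve (x : R -> R * R) (t : R) (v : R * R) :
  is_derive t 1 x v -> continuous_at t x.
Proof. by case=> H _; apply/differentiable_continuous/derivable1_diffP. Qed.

(** As long as both curves keep the distance [d] from the centres the force is Lipschitz, so [W],
    the squared distance of positions plus that of velocities, satisfies W' <= (2 + L) W, and
    Gronwall applies. *)
Lemma newton_local_unique (x y : R -> R * R) (t0 : R) (b : R) :
  t0 < b -> x t0 <> c1 -> x t0 <> c2 ->
  (forall t, t0 <= t < b -> x t <> c1 -> x t <> c2 -> newton x t) ->
  (forall t, t0 <= t < b -> y t <> c1 -> y t <> c2 -> newton y t) ->
  x t0 = y t0 -> derive1 x t0 = derive1 y t0 ->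
  exists2 e, 0 < e & forall s, t0 < s < t0 + e ->
    x s = y s /\ derive1 x s = derive1 y s.
Proof.
move=> t0b p1 p2 nx ny xy dxy.
have n1 := enorm_gt0 (fun e => p1 (subr0_eq e)).
have n2 := enorm_gt0 (fun e => p2 (subr0_eq e)).
pose d := Num.min (enorm (x t0 - c1)) (enorm (x t0 - c2)) / 2.
have d0 : 0 < d by rewrite divr_gt0// lt_min n1.
have d1 : d < enorm (x t0 - c1).
  have : Num.min (enorm (x t0 - c1)) (enorm (x t0 - c2)) <= enorm (x t0 - c1) by rewrite ge_min lexx.
  by rewrite /d; lra.
have d2 : d < enorm (x t0 - c2).
  have : Num.min (enorm (x t0 - c1)) (enorm (x t0 - c2)) <= enorm (x t0 - c2) by rewrite ge_min lexx orbT.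
  by rewrite /d; lra.
have far (z : R -> R * R) : z t0 = x t0 ->
    (forall t, t0 <= t < b -> z t <> c1 -> z t <> c2 -> newton z t) ->
    exists2 e, 0 < e & forall s, t0 <= s < t0 + e ->
      d < enorm (z s - c1) /\ d < enorm (z s - c2).
  move=> zx nz.
  have [dz _] : is_derive t0 1 z (derive1 z t0) /\ is_derive t0 1 (derive1 z) (F (z t0)).
    have ti : t0 <= t0 < b by lra.
    have [z1 z2] : z t0 <> c1 /\ z t0 <> c2 by rewrite zx.
    exact: (newton_force z1 z2 (nz _ ti z1 z2)).
  have cz := continuous_at_curve dz.
  have cc (c : R * R) : continuous_at t0 (fun t => enorm (z t - c)).
    apply: (@ccomp _ _ _ (@enorm R) (fun t => z t - c) t0).
      exact: continuous_enorm.
    by apply: cvgB => //; exact: cvg_cst.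
  have c1' : \forall s \near t0, d < enorm (z s - c1).
    by apply: (cvgr_gt _ (cc c1)); rewrite zx.
  have c2' : \forall s \near t0, d < enorm (z s - c2).
    by apply: (cvgr_gt _ (cc c2)); rewrite zx.
  have /nbhs_ballP[e /= e0 He] : \forall s \near t0, d < enorm (z s - c1) /\ d < enorm (z s - c2).
    by near=> s; split; near: s.
  exists e => // s st; apply: He; rewrite /ball/= distrC ger0_norm; lra.
have [ex ex0 Hx] := far x erefl nx.
have [ey ey0 Hy] := far y (esym xy) ny.
pose e := Num.min (b - t0) (Num.min ex ey).
have e0 : 0 < e by rewrite !lt_min; apply/and3P; split; lra.
have [eb [eex eey]] : e <= b - t0 /\ e <= ex /\ e <= ey.
  by rewrite /e !ge_min !lexx !orbT.
exists e; first exact: e0.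
move=> s st.
pose L := 8 * (m1 ^+ 2 + m2 ^+ 2) / d ^+ 6.
pose C := 2 + L.
have ncc (z : R * R) c : d < enorm (z - c) -> z <> c.
  by move=> dz zc; rewrite zc subrr enorm0 in dz; lra.
pose W t := dot (x t - y t) (x t - y t) +
            dot (derive1 x t - derive1 y t) (derive1 x t - derive1 y t).
pose W' t := 2 * dot (x t - y t) (derive1 x t - derive1 y t) +
             2 * dot (derive1 x t - derive1 y t) (F (x t) - F (y t)).
have dW t : t0 <= t <= s -> is_derive t 1 W (W' t).
  move=> ts.
  have [hx1 hx2] : d < enorm (x t - c1) /\ d < enorm (x t - c2) by apply: Hx; lra.
  have [hy1 hy2] : d < enorm (y t - c1) /\ d < enorm (y t - c2) by apply: Hy; lra.
  have [dx ddx] : is_derive t 1 x (derive1 x t) /\ is_derive t 1 (derive1 x) (F (x t)).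
    by apply: newton_force; try exact: ncc; apply: nx; try exact: ncc; lra.
  have [dy ddy] : is_derive t 1 y (derive1 y t) /\ is_derive t 1 (derive1 y) (F (y t)).
    by apply: newton_force; try exact: ncc; apply: ny; try exact: ncc; lra.
  have dxy' := is_deriveB dx dy; have ddxy := is_deriveB ddx ddy.
  apply: deq; first exact: (dD (is_derive_dot dxy' dxy') (is_derive_dot ddxy ddxy)).
  have ES (u v : R * R) : dot u v + dot v u = 2 * dot v u by rewrite /dot; ring.
  by rewrite !ES.
have W0 t : 0 <= W t by rewrite addr_ge0// dot_ge0.
have WC t : t0 <= t <= s -> W' t <= C * W t.
  move=> ts.
  have [hx1 hx2] : d < enorm (x t - c1) /\ d < enorm (x t - c2) by apply: Hx; lra.
  have [hy1 hy2] : d < enorm (y t - c1) /\ d < enorm (y t - c2) by apply: Hy; lra.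
  have hL := force_lipschitz m1 m2 d0 (ltW hx1) (ltW hy1) (ltW hx2) (ltW hy2).
  rewrite -/L in hL.
  have L0 : 0 <= L by rewrite divr_ge0 ?exprn_ge0 ?(ltW d0)// mulr_ge0// addr_ge0// sqr_ge0.
  rewrite /W' /C /W.
  move: (x t - y t) (derive1 x t - derive1 y t) (F (x t) - F (y t)) hL => u v w hL.
  have h1 := dot_ge0 (u - v); have h2 := dot_ge0 (v - w).
  have h3 : 0 <= L * dot v v by rewrite mulr_ge0// dot_ge0.
  have h4 := dot_ge0 u; have h5 := dot_ge0 v.
  have E1 : dot (u - v) (u - v) = dot u u + dot v v - 2 * dot u v.
    by rewrite /dot /=; ring.
  have E2 : dot (v - w) (v - w) = dot v v + dot w w - 2 * dot v w.
    by rewrite /dot /=; ring.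
  by move: h1 h2; rewrite {}E1 {}E2 => h1 h2; lra.
have Wt0 : W t0 = 0 by rewrite /W xy dxy !subrr /dot /= !mulr0 !addr0.
have ts : t0 < s by case/andP: st.
have Ws : W s = 0 := gronwall_eq0 ts dW WC Wt0 (W0 s).
have [E1 E2] := dot_sum_eq0 Ws.
by split; exact: subr0_eq.
Unshelve. all: by end_near. Qed.

Lemma is_derive_cosh (x : R) : is_derive x 1 (@cosh R) (sinh x).
Proof. by rewrite /cosh /sinh; dtac; ring. Qed.

Lemma is_derive_sinh (x : R) : is_derive x 1 (@sinh R) (cosh x).
Proof. by rewrite /cosh /sinh; dtac; ring. Qed.

Lemma cosh_sinh (x : R) : cosh x ^+ 2 - sinh x ^+ 2 = 1.
Proof.
have : expR x * expR (- x) = 1 by rewrite -expRD subrr expR0.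
by rewrite /cosh /sinh => H; rewrite -[RHS]H; field.
Qed.

Lemma cosh_gt0 (x : R) : 0 < cosh x.
Proof. by rewrite divr_gt0// addr_gt0// expR_gt0. Qed.

Hypothesis c12 : c1 <> c2.
Local Notation d := (half_dist c1 c2).
Local Notation e := (axis c1 c2).

Lemma half_dist_gt0 : 0 < d.
Proof.
by rewrite divr_gt0// enorm_gt0// => /subr0_eq.
Qed.

Lemma dot_axis : dot e e = 1.
Proof.
have d0 := half_dist_gt0.
have h1 : enorm (c1 - c2) = 2 * d by rewrite /half_dist; field.
have h2 : (2 * d) ^+ 2 = dot (c2 - c1) (c2 - c1).
  by rewrite -h1 enorm_sqr /dot /=; ring.
rewrite /axis; move: (c2 - c1) h2 => u h2.
have -> : dot ((2 * d)^-1 *: u) ((2 * d)^-1 *: u) = (2 * d) ^- 2 * dot u u.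
  by rewrite /dot /= /GRing.scale /= -exprVn; ring.
by rewrite -h2 mulVf// expf_neq0// gt_eqF//; lra.
Qed.

Lemma focus1E : c1 = 2^-1 *: (c1 + c2) - d *: e.
Proof.
have d0 := half_dist_gt0.
rewrite /axis scalerA.
have -> : d * (2 * d)^-1 = 2^-1 by field; rewrite gt_eqF.
by case: (c1) (c2) => a b [c f]; apply/pair_equal_spec; split; rewrite /= /GRing.scale /=; field.
Qed.

Lemma focus2E : c2 = 2^-1 *: (c1 + c2) + d *: e.
Proof.
have d0 := half_dist_gt0.
rewrite /axis scalerA.
have -> : d * (2 * d)^-1 = 2^-1 by field; rewrite gt_eqF.
by case: (c1) (c2) => a b [c f]; apply/pair_equal_spec; split; rewrite /= /GRing.scale /=; field.
Qed.

(** The components along the axis and its normal give cosh xi cos eta = s and sinh xi sin eta = 0.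
    Either factor of the latter forces sinh xi = 0, as cosh xi >= 1 leaves no room when sin eta =
    0. *)
Lemma Phi_focus (xi eta s : R) : s = 1 \/ s = - 1 ->
  Phi c1 c2 xi eta = 2^-1 *: (c1 + c2) + s *: (d *: e) ->
  xi = 0 /\ cos eta = s.
Proof.
move=> s1; rewrite /Phi => /addrI H.
have d0 := half_dist_gt0.
have e1 := dot_axis.
have E1 : cosh xi * cos eta = s.
  have : dot (d *: (cosh xi * cos eta *: e + sinh xi * sin eta *: rot90 e)) e =
         dot (s *: (d *: e)) e by rewrite H.
  have -> : dot (d *: (cosh xi * cos eta *: e + sinh xi * sin eta *: rot90 e)) e
    = d * (cosh xi * cos eta) * dot e e by rewrite /dot /= /GRing.scale /=; ring.
  have -> : dot (s *: (d *: e)) e = d * s * dot e e.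
    by rewrite /dot /= /GRing.scale /=; ring.
  by rewrite e1 !mulr1; apply: mulfI; rewrite gt_eqF.
have E2 : sinh xi * sin eta = 0.
  have : dot (d *: (cosh xi * cos eta *: e + sinh xi * sin eta *: rot90 e)) (rot90 e) =
         dot (s *: (d *: e)) (rot90 e) by rewrite H.
  have -> : dot (d *: (cosh xi * cos eta *: e + sinh xi * sin eta *: rot90 e)) (rot90 e)
    = d * (sinh xi * sin eta) * dot e e by rewrite /dot /= /GRing.scale /=; ring.
  have -> : dot (s *: (d *: e)) (rot90 e) = 0.
    by rewrite /dot /= /GRing.scale /=; ring.
  by rewrite e1 mulr1 => /eqP; rewrite mulf_eq0 gt_eqF//= => /eqP.
have ch := cosh_sinh xi; have cp := cosh_gt0 xi; have cs := cos2Dsin2 eta.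
have s2 : s ^+ 2 = 1 by case: s1 => ->; rewrite ?sqrrN expr1n.
have sh0 : sinh xi = 0.
  move/eqP: E2; rewrite mulf_eq0 => /orP[/eqP//|/eqP sn0].
  rewrite sn0 expr0n addr0 in cs.
  have : (cosh xi * cos eta) ^+ 2 = 1 by rewrite E1.
  rewrite exprMn cs mulr1 => c2'; apply/eqP; rewrite -sqrf_eq0; apply/eqP; lra.
have ch1 : cosh xi = 1.
  rewrite sh0 expr0n subr0 in ch; apply/eqP.
  by rewrite -(@eqrXn2 _ 2)// ?ch ?expr1n// ltW.
split; last by rewrite -E1 ch1 mul1r.
have : expR xi = 1 by have := ch1; have := sh0; rewrite /cosh /sinh; lra.
by move/(congr1 (@ln R)); rewrite expRK ln1.
Qed.

Lemma continuous_Phi (xi eta : R -> R) (t : R) :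
  continuous_at t xi -> continuous_at t eta ->
  continuous_at t (fun s => Phi c1 c2 (xi s) (eta s)).
Proof.
move=> cx ce.
have c1' : continuous_at t (fun s => cosh (xi s)).
  by apply: (@ccomp _ _ _ (@cosh R) xi); last exact: cx;
    exact: (is_derive_cts (is_derive_cosh _)).
have c2' : continuous_at t (fun s => sinh (xi s)).
  by apply: (@ccomp _ _ _ (@sinh R) xi); last exact: cx;
    exact: (is_derive_cts (is_derive_sinh _)).
have c3 : continuous_at t (fun s => cosh (xi s) * cos (eta s)) by cauto.
have c4 : continuous_at t (fun s => sinh (xi s) * sin (eta s)) by cauto.
apply: cvgD; first exact: cvg_cst.
apply: cvgZr; apply: cvgD; apply: cvgZl.
  exact: c3.
exact: c4.
Qed.

(* A regularised collision is never at rest in the elliptic coordinates: on the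
   fibre of a centre, [K = 0] forces a nonzero momentum. *)
Lemma regularised_not_stationary (xi eta pxi peta : R -> R) (a b s : R) :
  0 < m1 -> 0 < m2 -> s = 1 \/ s = - 1 -> a < b ->
  hamiltonian_orbit0 (K c1 c2 m1 m2 h) a b xi eta pxi peta ->
  ~ (forall t, a < t < b -> xi t = 0 /\ cos (eta t) = s).
Proof.
move=> m10 m20 s1 ab H HE.
have d0 := half_dist_gt0.
pose t := (a + b) / 2.
have tab : a < t < b by rewrite /t; lra.
have tI : \forall u \near t, a < u < b.
  have := @near_in_itvoo R a b t; rewrite in_itv/= => /(_ tab).
  by apply: filterS => u; rewrite in_itv.
have [xi0 ce] := HE t tab.
have [dxi deta _ _ K0] := H t tab.
have px : pxi t = 0.
  have z : is_derive t 1 xi 0.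
    have E0 : \forall u \near t, 0 = xi u by apply: filterS tI => u /HE[->].
    exact: (near_eq_is_derive E0 (dcst 0 t)).
  have := is_derive_derive1 dxi; rewrite (is_derive_derive1 z) => E.
  rewrite [RHS]E; apply/esym/is_derive_derive1.
  by rewrite /K; dtac; field.
have pe : peta t = 0.
  have se u : a < u < b -> sin (eta u) = 0.
    move=> /HE[_ cu]; have := cos2Dsin2 (eta u).
    have s2 : s ^+ 2 = 1 by case: s1 => ->; rewrite ?sqrrN expr1n.
    by rewrite cu s2 => h1; apply/eqP; rewrite -sqrf_eq0; apply/eqP; lra.
  have z : is_derive t 1 (fun u => sin (eta u)) 0.
    have E0 : \forall u \near t, 0 = sin (eta u) by apply: filterS tI => u /se ->.
    exact: (near_eq_is_derive E0 (dcst 0 t)).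
  have := is_derive_derive1 (dsin deta); rewrite (is_derive_derive1 z).
  have -> : derive1 (fun s0 => K c1 c2 m1 m2 h (xi t) (eta t) (pxi t) s0) (peta t) = peta t.
    by apply: is_derive_derive1; rewrite /K; dtac; field.
  move/esym/eqP; rewrite mulf_eq0 ce => /orP[|/eqP//].
  by case: s1 => ->; rewrite ?oppr_eq0 oner_eq0.
(* At a centre with zero momenta [K] equals -2 d m2 for s = 1 and -2 d m1 for s = -1. *)
move: K0; rewrite /K px pe xi0 ce.
have -> : cosh (0 : R) = 1 by rewrite /cosh oppr0 expR0; field.
have s2 : s ^+ 2 = 1 by case: s1 => ->; rewrite ?sqrrN expr1n.
rewrite s2 expr1n expr0n /=.
have : 0 < half_dist c1 c2 * m1 by rewrite mulr_gt0.
have : 0 < half_dist c1 c2 * m2 by rewrite mulr_gt0.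
by case: s1 => ->; lra.
Qed.

Lemma focusE (c : R * R) : c = c1 \/ c = c2 -> exists2 s : R, s = 1 \/ s = - 1 &
  c = 2^-1 *: (c1 + c2) + s *: (d *: e).
Proof.
case=> ->; last by exists 1; [left|rewrite scale1r -focus2E].
by exists (- 1); [right|rewrite scaleN1r -focus1E].
Qed.

(** The regularised orbit reaches the centre through times [sg u] strictly before [t0], where [x]
    and [y] agree, so [x] has the same limit. Strictness is the delicate point: the rate of [sg]
    vanishes at collisions, and a time change constant on an interval would hold the orbit at the
    centre, which [regularised_not_stationary] excludes. *)
Lemma no_collision_limit (x y : R -> R * R) (t0 : R) (c : R * R) : 0 < m1 -> 0 < m2 ->
  c = c1 \/ c = c2 -> y t0 = c -> 0 < t0 ->
  regularised_at c1 c2 m1 m2 h y t0 ->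
  continuous_at t0 x -> (forall t, 0 <= t < t0 -> x t = y t) -> x t0 = c.
Proof.
move=> m10 m20 cc yc t00 [eps [xi [eta [pxi [peta [sg [eps0 Hor sg0 dsg ysg]]]]]]] cx xy.
have mono u : - eps < u < 0 -> sg u <= t0.
  move=> u0; rewrite -sg0.
  have [||z zi E] := @MVT_oo R sg (fun t => enorm (y (sg t) - c1) * enorm (y (sg t) - c2)) u 0.
  - lra.
  - by move=> z zu; apply: dsg; lra.
  rewrite -subr_ge0 E mulr_ge0 ?mulr_ge0 ?enorm_ge0//; lra.
have strict u : - eps < u < 0 -> sg u < t0.
  move=> u0; rewrite lt_neqAle mono// andbT; apply/eqP => Eu.
  have cst v : u < v < 0 -> sg v = t0.
    move=> v0; apply/le_anti; rewrite mono//=; last lra.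
    rewrite -Eu.
    have [||z zi E] := @MVT_oo R sg (fun t => enorm (y (sg t) - c1) * enorm (y (sg t) - c2)) u v.
    - lra.
    - by move=> z zu; apply: dsg; lra.
    rewrite -subr_ge0 E mulr_ge0 ?mulr_ge0 ?enorm_ge0//; lra.
  have [s s1 cE] := focusE cc.
  apply: (@regularised_not_stationary xi eta pxi peta u 0 s) => //.
  - lra.
  - by move=> v v0; apply: Hor; lra.
  - move=> v v0; apply: Phi_focus => //.
    by rewrite -ysg ?cst ?yc -?cE//; lra.
have [dxi deta _ _ _] := Hor 0 ltac:(lra).
have cPhi : continuous_at 0 (fun s => Phi c1 c2 (xi s) (eta s)).
  by apply: continuous_Phi; [exact: (is_derive_cts dxi)|exact: (is_derive_cts deta)].
have csg : continuous_at 0 sg by apply: (is_derive_cts (dsg 0 _)); lra.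
have y0 : Phi c1 c2 (xi 0) (eta 0) = c by rewrite -ysg ?sg0//; lra.
have cxs : continuous_at 0 (fun s => x (sg s)).
  by apply: (@ccomp _ _ _ x sg) => //; rewrite sg0.
have L1 : x (sg s) @[s --> 0^'-] --> x t0.
  by rewrite -sg0; apply: cvg_at_left_filter; exact: cxs.
have csg' : sg s @[s --> 0^'-] --> sg 0 := cvg_at_left_filter csg.
have sgpos : \forall s \near 0^'-, 0 < sg s.
  by apply: (cvgr_gt (sg 0) csg'); rewrite sg0.
have L2 : x (sg s) @[s --> 0^'-] --> c.
  rewrite -y0; have := cvg_at_left_filter cPhi; apply: cvg_trans.
  apply: near_eq_cvg; near=> s.
  have s0 : s < 0 by near: s; exact: nbhs_left_lt.
  have s1 : - eps < s.
    by near: s; apply: nbhs_left_gt; lra.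
  have s2 : 0 < sg s by near: s.
  rewrite -ysg; last lra.
  by rewrite xy//; rewrite (ltW s2)/=; apply: strict; lra.
exact: (cvg_unique _ L1 L2).
Unshelve. all: by end_near. Qed.

Lemma newton_unique (x y : R -> R * R) (T : R) : 0 < m1 -> 0 < m2 ->
  (forall t, 0 <= t <= T -> x t <> c1 /\ x t <> c2 /\ newton x t) ->
  (forall t, 0 <= t <= T ->
    (y t <> c1 -> y t <> c2 -> newton y t) /\
    (y t = c1 \/ y t = c2 -> regularised_at c1 c2 m1 m2 h y t)) ->
  x 0 = y 0 -> derive1 x 0 = derive1 y 0 ->
  forall t, 0 <= t <= T -> x t = y t /\ derive1 x t = derive1 y t.
Proof.
move=> m10 m20 Hx Hy xy dxy.
apply: (@real_induction R T (fun t => x t = y t /\ derive1 x t = derive1 y t)).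
- by split.
- move=> t tT IH.
  have [x1 [x2 nx]] := Hx t ltac:(lra).
  have [dx ddx] := newton_force x1 x2 nx.
  have cx := continuous_at_curve dx; have cdx := continuous_at_curve ddx.
  have Hc : y t = c1 \/ y t = c2 -> False.
    move=> yc; have [_ /(_ yc) Hreg] := Hy t ltac:(lra).
    have E : x t = y t.
      apply: (@no_collision_limit x y t (y t)) => //; first by case/andP: tT.
      by move=> s /IH[].
    by case: yc => yc; rewrite E yc in x1 x2.
  have y1 : y t <> c1 by move=> ?; apply: Hc; left.
  have y2 : y t <> c2 by move=> ?; apply: Hc; right.
  have [/(_ y1 y2) ny _] := Hy t ltac:(lra).
  have [dy ddy] := newton_force y1 y2 ny.
  have cy := continuous_at_curve dy; have cdy := continuous_at_curve ddy.
  have lim (f g : R -> R * R) : continuous_at t f -> continuous_at t g ->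
      (forall s, 0 <= s < t -> f s = g s) -> f t = g t.
    move=> cf cg fg.
    have L1 : f s @[s --> t^'-] --> f t by apply: cvg_at_left_filter.
    have L2 : f s @[s --> t^'-] --> g t.
      have := cvg_at_left_filter cg; apply: cvg_trans.
      apply: near_eq_cvg; near=> s; rewrite fg//.
      have s0 : s < t by near: s; exact: nbhs_left_lt.
      have s1 : 0 < s by near: s; apply: nbhs_left_gt; lra.
      by rewrite s0 ltW.
    exact: (cvg_unique _ L1 L2).
  split; first exact: (lim _ _ cx cy (fun s hs => (IH s hs).1)).
  exact: (lim _ _ cdx cdy (fun s hs => (IH s hs).2)).
- move=> t tT [E dE].
  have [x1 [x2 _]] := Hx t ltac:(lra).
  apply: (@newton_local_unique x y t T); try assumption.
  - by case/andP: tT.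
  - by move=> s sT _ _; have [_ [_]] := Hx s ltac:(lra).
  - by move=> s sT y1 y2; have [/(_ y1 y2)] := Hy s ltac:(lra).
Unshelve. all: by end_near. Qed.

End uniqueness.

(** * Uniqueness of the image under the billiard relation *)

Lemma periodic_int (R : realType) (U : Type) (f : R -> U) (p : R) :
  (forall s, f (s + p) = f s) -> forall (k : int) s, f (s + k%:~R * p) = f s.
Proof.
move=> fp.
have nat_case (n : nat) s : f (s + n%:R * p) = f s.
  elim: n s => [|n IH] s; first by rewrite mul0r addr0.
  by rewrite -natr1 mulrDl mul1r addrA fp IH.
move=> [n|n] s; first by rewrite -pmulrn nat_case.
by rewrite -[in RHS](subrK (n.+1%:R * p) s) nat_case NegzE mulrNz mulNr.
Qed.

Lemma derive1_periodic (R : realType) (V : normedModType R) (f : R -> V) (p : R) :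
  (forall s, f (s + p) = f s) -> forall s, derive1 f (s + p) = derive1 f s.
Proof.
move=> fp s; rewrite /derive1.
rewrite (_ : (fun h => h^-1 *: (f (h + (s + p)) - f (s + p))) =
   (fun h => h^-1 *: (f (h + s) - f s)))//.
by apply/funext => h; rewrite addrA !fp.
Qed.

(** Two unit normals to the same tangent differ at most by a sign, which [dot v n *: n] does not
    see: multiplied by |g|^2 it is a polynomial in [v] and [g] alone. *)
Lemma reflect_tangent (R : realType) (n n' g v : R * R) : g != 0 ->
  enorm n = 1 -> enorm n' = 1 -> dot n g = 0 -> dot n' g = 0 ->
  Defs.reflect n v = Defs.reflect n' v.
Proof.
move=> g0 n1 n1' ng ng'.
have gg0 : dot g g <> 0 by move=> /dot_eq0 /eqP; rewrite (negbTE g0).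
have key (m : R * R) : enorm m = 1 -> dot m g = 0 ->
  dot v m * m.1 * dot g g = v.1 * g.2 ^+ 2 - v.2 * g.1 * g.2 /\
  dot v m * m.2 * dot g g = v.2 * g.1 ^+ 2 - v.1 * g.1 * g.2.
  move=> m1 mg; have : dot m m = 1 by rewrite -enorm_sqr m1 expr1n.
  move: m1 mg => _; case: m g v {g0 ng ng' gg0} => a b [c f] [p q]; rewrite /dot /= => mg mm.
  have E : a * c = - (b * f) by lra.
  have E1 : a * a * (c * c + f * f) = f * f.
    have -> : a * a * (c * c + f * f) = (a * c) * (a * c) + a * a * f * f by ring.
    by rewrite E -[RHS]mul1r -mm; ring.
  have E2 : b * b * (c * c + f * f) = c * c.
    have -> : b * b * (c * c + f * f) = (- (b * f)) * (- (b * f)) + b * b * c * c by ring.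
    by rewrite -E -[RHS]mul1r -mm; ring.
  have E3 : a * b * (c * c + f * f) = - (c * f).
    have -> : a * b * (c * c + f * f) = b * c * (a * c) + a * f * (b * f) by ring.
    have -> : b * c * (a * c) = b * c * - (b * f) by rewrite E.
    have -> : a * f * (b * f) = a * f * - (a * c) by rewrite E opprK.
    have -> : b * c * - (b * f) + a * f * - (a * c) = - (c * f) * (a * a + b * b) by ring.
    by rewrite mm mulr1.
  split.
    have -> : (p * a + q * b) * a * (c * c + f * f) =
      p * (a * a * (c * c + f * f)) + q * (a * b * (c * c + f * f)) by ring.
    by rewrite E1 E3; ring.
  have -> : (p * a + q * b) * b * (c * c + f * f) =
      p * (a * b * (c * c + f * f)) + q * (b * b * (c * c + f * f)) by ring.
  by rewrite E2 E3; ring.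
have [k1 k2] := key n n1 ng; have [k1' k2'] := key n' n1' ng'.
rewrite -k1' in k1; rewrite -k2' in k2.
have e1 := mulIf (introN eqP gg0) k1; have e2 := mulIf (introN eqP gg0) k2.
rewrite /Defs.reflect; congr (_ - _); rewrite -!scalerA; congr (_ *: _).
case: n n' e1 e2 {n1 n1' ng ng' k1 k2 k1' k2' key} => a b [a' b'] /= e1 e2.
by apply/pair_equal_spec; split.
Qed.

(** Makes the choice in [billiard_map] harmless along an orbit free of collisions. If the return
    times differed, one trajectory would meet the boundary before its own first return. *)
Lemma billiard_rel_unique (R : realType) (c1 c2 : R * R) (m1 m2 h : R)
    (Omega : set (R * R)) (gam : R -> R * R) (z w w' : (R * R) * (R * R))
    (x : R -> R * R) (a b T theta : R) (n : R * R) :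
  c1 <> c2 -> 0 < m1 -> 0 < m2 -> regular_C1_loop gam (boundary Omega) ->
  a < 0 /\ 0 < T < b -> trajectory c1 c2 m1 m2 h a b x ->
  (forall t, 0 <= t <= T -> x t <> c1 /\ x t <> c2) ->
  x 0 = z.1 /\ derive1 x 0 = z.2 ->
  boundary Omega (x T) /\ (forall t, 0 < t < T -> ~ boundary Omega (x t)) ->
  x T = gam theta -> inward_normal Omega gam theta n ->
  w = (x T, Defs.reflect n (derive1 x T)) ->
  billiard_rel c1 c2 m1 m2 h Omega gam z w' -> w' = w.
Proof.
move=> c12 m10 m20 [gper gder _ ginj _] [a0 Tb] trx ncx [x0 dx0] [bT bx] xT [n1 ng _] ->.
case=> _ [y [a' [b' [T' [[a'0 Tb'] try_ [y0 dy0] [bT' by_] [theta' [n' [yT [n1' ng' _] _ ->]]]]]]]].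
pose S := Num.min T T'.
have [S1 S2] : S <= T /\ S <= T' by rewrite /S !ge_min !lexx orbT.
have uniq : forall t, 0 <= t <= S -> x t = y t /\ derive1 x t = derive1 y t.
  apply: (newton_unique (h := h) c12 m10 m20).
  - move=> t tS; have [h1 h2] := ncx t ltac:(olra).
    by split => //; split => //; have [/(_ h1 h2)] := trx t ltac:(olra).
  - by move=> t tS; apply: try_; olra.
  - by rewrite x0 y0.
  - by rewrite dx0 dy0.
have TT : T = T'.
  have [TT|TT|//] := ltgtP T T'.
  - have ST : S = T by rewrite /S; apply: min_l; exact: ltW.
    rewrite ST in uniq.
    have [E _] := uniq T ltac:(olra).
    by exfalso; apply: (by_ T); [olra|rewrite -E].
  - have ST : S = T' by rewrite /S; apply: min_r; exact: ltW.
    rewrite ST in uniq.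
    have [E _] := uniq T' ltac:(olra).
    by exfalso; apply: (bx T'); [olra|rewrite E].
have ST : S = T by rewrite /S -TT minxx.
rewrite ST in uniq.
have [E dE] := uniq T ltac:(olra).
rewrite -TT in yT *; rewrite -E -dE in yT *.
congr pair.
have [k Ek] : exists k : int, theta - theta' = k%:~R * (2 * pi) by apply: ginj; rewrite -xT.
have tE : theta = theta' + k%:~R * (2 * pi) by rewrite -Ek addrC subrK.
have gg := periodic_int (derive1_periodic gper) k theta'.
rewrite -tE in gg.
have [_ g0] := gder theta.
rewrite -gg in ng'.
exact: (reflect_tangent _ g0 n1' n1 ng' ng).
Qed.

(** * Orbits in elliptic coordinates *)

Lemma sqr_le1_bound (R : realType) (x : R) : x ^+ 2 <= 1 -> -1 <= x <= 1.
Proof. by move=> x2; apply/andP; split; nra. Qed.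

Section elliptic_frame.
Variables (R : realType) (c1 c2 : R * R).
Local Notation d := (half_dist c1 c2).
Local Notation e := (axis c1 c2).

Definition evec (u v : R) : R * R := u *: e + v *: rot90 e.
Definition eframe (u v : R) : R * R := 2^-1 *: (c1 + c2) + d *: evec u v.

Lemma evecE u v : evec u v = (u * e.1 - v * e.2, u * e.2 + v * e.1).
Proof. by apply/pair_equal_spec; split; rewrite /= /GRing.scale /=; ring. Qed.

Lemma eframeE u v : eframe u v =
  (2^-1 * (c1.1 + c2.1) + d * (u * e.1 - v * e.2),
   2^-1 * (c1.2 + c2.2) + d * (u * e.2 + v * e.1)).
Proof. by rewrite /eframe evecE; apply/pair_equal_spec; split. Qed.

Lemma is_derive_evec (f g : R -> R) (t f' g' : R) : is_derive t 1 f f' ->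
  is_derive t 1 g g' -> is_derive t 1 (fun s => evec (f s) (g s)) (evec f' g').
Proof.
move=> df dg; rewrite evecE; under eq_fun do rewrite evecE.
by apply: is_derive_pair; dtac; ring.
Qed.

Lemma is_derive_eframe (f g : R -> R) (t f' g' : R) : is_derive t 1 f f' ->
  is_derive t 1 g g' ->
  is_derive t 1 (fun s => eframe (f s) (g s)) (d *: evec f' g').
Proof.
move=> df dg; rewrite evecE; under eq_fun do rewrite eframeE.
have -> : d *: (f' * e.1 - g' * e.2, f' * e.2 + g' * e.1) =
  (d * (f' * e.1 - g' * e.2), d * (f' * e.2 + g' * e.1)) by [].
by apply: is_derive_pair; dtac; ring.
Qed.

Hypothesis c12 : c1 <> c2.

Lemma dot_evec u v u' v' : dot (evec u v) (evec u' v') = u * u' + v * v'.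
Proof.
have := dot_axis c12; rewrite !evecE /dot; case: e => g1 g2 /= e1.
rewrite -[RHS]mulr1 -e1; ring.
Qed.

Lemma evec_inj u v u' v' : evec u v = evec u' v' -> u = u' /\ v = v'.
Proof.
move=> H.
have h1 : dot (evec u v) (evec 1 0) = dot (evec u' v') (evec 1 0) by rewrite H.
have h2 : dot (evec u v) (evec 0 1) = dot (evec u' v') (evec 0 1) by rewrite H.
by move: h1 h2; rewrite !dot_evec !mulr0 !mulr1 !addr0 !add0r.
Qed.

Lemma eframe_inj u v u' v' : eframe u v = eframe u' v' -> u = u' /\ v = v'.
Proof.
move=> /addrI /(scalerI _) H; apply: evec_inj; apply: H.
by rewrite gt_eqF// half_dist_gt0.
Qed.

Lemma eframe_foci : eframe (- 1) 0 = c1 /\ eframe 1 0 = c2.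
Proof.
rewrite /eframe /evec !scale0r !addr0 scale1r scaleN1r scalerN; split.
  by rewrite -focus1E.
by rewrite -focus2E.
Qed.

Lemma eframeB u v u' v' : eframe u v - eframe u' v' = d *: evec (u - u') (v - v').
Proof.
rewrite !eframeE evecE; apply/pair_equal_spec; split; rewrite /= /GRing.scale /=; ring.
Qed.

Lemma eframeB_foci u v : eframe u v - c1 = d *: evec (u + 1) v /\
  eframe u v - c2 = d *: evec (u - 1) v.
Proof.
have [E1 E2] := eframe_foci; split.
  by rewrite -[Z in _ - Z = _]E1 eframeB subr0 opprK.
by rewrite -[Z in _ - Z = _]E2 eframeB subr0.
Qed.

Lemma enorm_evec u v (s : R) : 0 <= s -> u ^+ 2 + v ^+ 2 = s ^+ 2 ->
  enorm (d *: evec u v) = d * s.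
Proof.
move=> s0 H; have d0 := half_dist_gt0 c12.
have -> : enorm (d *: evec u v) = Num.sqrt ((d * s) ^+ 2).
  rewrite /enorm; congr Num.sqrt.
  have -> : dot (d *: evec u v) (d *: evec u v) = d ^+ 2 * dot (evec u v) (evec u v).
    by rewrite /dot /= /GRing.scale /=; ring.
  transitivity (d ^+ 2 * (u ^+ 2 + v ^+ 2)); first by rewrite dot_evec; ring.
  by rewrite H; ring.
by rewrite sqrtr_sqr ger0_norm// mulr_ge0// ltW.
Qed.

Lemma enorm_focal (X Y C S : R) : X ^+ 2 - Y ^+ 2 = 1 -> C ^+ 2 + S ^+ 2 = 1 -> 1 <= X ->
  enorm (eframe (X * C) (Y * S) - c1) = d * (X + C) /\
  enorm (eframe (X * C) (Y * S) - c2) = d * (X - C).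
Proof.
move=> XY CS X1; have [E1 E2] := eframeB_foci (X * C) (Y * S).
have Y2 : Y ^+ 2 = X ^+ 2 - 1 by rewrite -XY; ring.
have S2 : S ^+ 2 = 1 - C ^+ 2 by rewrite -CS; ring.
have C1 : -1 <= C <= 1.
  have : C ^+ 2 <= 1 by rewrite -CS lerDl sqr_ge0.
  exact: sqr_le1_bound.
rewrite E1 E2; split; apply: enorm_evec; try olra.
  by rewrite exprMn Y2 S2; ring.
by rewrite exprMn Y2 S2; ring.
Qed.

End elliptic_frame.

(** First component of the acceleration, cleared of denominators; [elliptic_numerator2] is the
    second. The energy relation eliminates the square of p, the other two identities those of Y and
    S, and the attractions of the two centres remain: their distances are proportional to X + C and
    X - C, and (a + c) / 2, (a - c) / 2 are d m1, d m2. *)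
Lemma elliptic_numerator1 (R : realType) (X Y C S p q a b c : R) :
  X ^+ 2 - Y ^+ 2 = 1 -> C ^+ 2 + S ^+ 2 = 1 ->
  p ^+ 2 + q ^+ 2 = 2 * (a * X - c * C + b * (X ^+ 2 - C ^+ 2)) ->
  (Y * (a + 2 * b * X) * Y * C + p * (X * p * C - Y * S * q)
    - S * (c + 2 * b * C) * X * S - q * (Y * p * S + X * C * q)) * (X ^+ 2 - C ^+ 2)
  - (p * Y * C - q * X * S) * (2 * X * Y * p + 2 * C * S * q) =
  - ((a + c) / 2) * (X * C + 1) * (X - C) ^+ 3
  - ((a - c) / 2) * (X * C - 1) * (X + C) ^+ 3.
Proof.
move=> XY CS pq.
have Y2 : Y ^+ 2 = X ^+ 2 - 1 by rewrite -XY; ring.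
have S2 : S ^+ 2 = 1 - C ^+ 2 by rewrite -CS; ring.
have p2 : p ^+ 2 = 2 * (a * X - c * C + b * (X ^+ 2 - C ^+ 2)) - q ^+ 2 by rewrite -pq; ring.
transitivity ((Y ^+ 2 * C * (a + 2 * b * X) - S ^+ 2 * X * (c + 2 * b * C)) * (X ^+ 2 - C ^+ 2)
  + p ^+ 2 * (X * C * (X ^+ 2 - C ^+ 2 - 2 * Y ^+ 2))
  + q ^+ 2 * (X * C * (2 * S ^+ 2 - X ^+ 2 + C ^+ 2))); first by ring.
by rewrite p2 Y2 S2; field.
Qed.

Lemma elliptic_numerator2 (R : realType) (X Y C S p q a b c : R) :
  X ^+ 2 - Y ^+ 2 = 1 -> C ^+ 2 + S ^+ 2 = 1 ->
  p ^+ 2 + q ^+ 2 = 2 * (a * X - c * C + b * (X ^+ 2 - C ^+ 2)) ->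
  (Y * (a + 2 * b * X) * X * S + p * (Y * p * S + X * C * q)
    + S * (c + 2 * b * C) * Y * C + q * (X * p * C - Y * S * q)) * (X ^+ 2 - C ^+ 2)
  - (p * X * S + q * Y * C) * (2 * X * Y * p + 2 * C * S * q) =
  - ((a + c) / 2) * (Y * S) * (X - C) ^+ 3
  - ((a - c) / 2) * (Y * S) * (X + C) ^+ 3.
Proof.
move=> XY CS pq.
have Y2 : Y ^+ 2 = X ^+ 2 - 1 by rewrite -XY; ring.
have S2 : S ^+ 2 = 1 - C ^+ 2 by rewrite -CS; ring.
have p2 : p ^+ 2 = 2 * (a * X - c * C + b * (X ^+ 2 - C ^+ 2)) - q ^+ 2 by rewrite -pq; ring.
transitivity (Y * S * (X * (a + 2 * b * X) + C * (c + 2 * b * C)) * (X ^+ 2 - C ^+ 2)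
  - p ^+ 2 * (Y * S * (X ^+ 2 + C ^+ 2))
  - q ^+ 2 * (Y * S * (X ^+ 2 + C ^+ 2))
  + p * q * (2 * X * C * (X ^+ 2 - C ^+ 2 - S ^+ 2 - Y ^+ 2))); first by ring.
by rewrite p2 Y2 S2; field.
Qed.

Section elliptic_newton.
Variables (R : realType) (c1 c2 : R * R) (m1 m2 h : R).
Hypothesis c12 : c1 <> c2.
Local Notation d := (half_dist c1 c2).
Let a := d * (m1 + m2).
Let b := h * d ^+ 2.
Let c := d * (m1 - m2).

(* The Hamiltonian orbits of [K], read in physical time: [X], [Y], [C], [S] stand
   for cosh xi, sinh xi, cos eta, sin eta, and [J] is the time change. *)
Lemma elliptic_newton (X Y C S p q : R -> R) (al be : R) :
  let J t := d ^+ 2 * (X t ^+ 2 - C t ^+ 2) in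
  (forall t, al < t < be -> [/\ X t ^+ 2 - Y t ^+ 2 = 1, C t ^+ 2 + S t ^+ 2 = 1, 1 < X t &
     p t ^+ 2 + q t ^+ 2 = 2 * (a * X t - c * C t + b * (X t ^+ 2 - C t ^+ 2))]) ->
  (forall t : R, al < t < be -> [/\ is_derive t 1 X (Y t * p t / J t),
     is_derive t 1 Y (X t * p t / J t), is_derive t 1 C (- S t * q t / J t) &
     is_derive t 1 S (C t * q t / J t)]) ->
  (forall t : R, al < t < be ->
     is_derive t 1 p (Y t * (a + 2 * b * X t) / J t) /\
     is_derive t 1 q (S t * (c + 2 * b * C t) / J t)) ->
  let x t := eframe c1 c2 (X t * C t) (Y t * S t) in
  forall t : R, al < t < be -> [/\ newton_at c1 c2 m1 m2 h x t, x t <> c1, x t <> c2 &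
    derive1 x t = evec c1 c2 ((p t * Y t * C t - q t * X t * S t) / (d * (X t ^+ 2 - C t ^+ 2)))
      ((p t * X t * S t + q t * Y t * C t) / (d * (X t ^+ 2 - C t ^+ 2)))].
Proof.
move=> J H1 H2 H3 x.
have d0 := half_dist_gt0 c12.
pose D t := X t ^+ 2 - C t ^+ 2.
have CX t : al < t < be -> 0 < X t + C t /\ 0 < X t - C t.
  case/H1 => _ cs x1 _.
  have : C t ^+ 2 <= 1 by rewrite -cs lerDl sqr_ge0.
  by move=> /sqr_le1_bound C1; split; olra.
have DE t : D t = (X t + C t) * (X t - C t) by rewrite /D; ring.
have D0 t : al < t < be -> 0 < D t.
  by move=> /CX[u v]; rewrite DE mulr_gt0.
pose v1 t := (p t * Y t * C t - q t * X t * S t) / (d * D t).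
pose v2 t := (p t * X t * S t + q t * Y t * C t) / (d * D t).
have dx t : al < t < be -> is_derive t 1 x (evec c1 c2 (v1 t) (v2 t)).
  move=> ti; have [dX dY dC dS] := H2 t ti; have Dt := D0 t ti.
  have dxt := is_derive_eframe c1 c2 (dM dX dC) (dM dY dS).
  apply: is_derive_eq; rewrite /evec scalerDr !scalerA.
  congr (_ *: _ + _ *: _); rewrite /v1 /v2 /J -/(D t); field;
    by rewrite !gt_eqF.
have dx1 t : al < t < be -> derive1 x t = evec c1 c2 (v1 t) (v2 t).
  by move=> /dx /is_derive_derive1.
move=> t ti.
have [XY CS X1 pq] := H1 t ti; have [cx1 cx2] := CX t ti; have Dt := D0 t ti.
have [r1 r2] := enorm_focal c12 XY CS (ltW X1).
have xc1 : x t <> c1.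
  by move=> E; move: r1; rewrite -/(x t) E subrr enorm0 => /esym; apply/eqP; rewrite gt_eqF// mulr_gt0.
have xc2 : x t <> c2.
  by move=> E; move: r2; rewrite -/(x t) E subrr enorm0 => /esym; apply/eqP; rewrite gt_eqF// mulr_gt0.
split => //; last exact: dx1.
split.
- by have [] := dx t ti.
- rewrite grad_potential//.
  have [dX dY dC dS] := H2 t ti; have [dp dq] := H3 t ti.
  have dJ : d * D t != 0 by rewrite gt_eqF// mulr_gt0.
  have n1 := elliptic_numerator1 XY CS pq; have n2 := elliptic_numerator2 XY CS pq.
  have dv1 : is_derive t 1 v1 (- (m1 / (d * (X t + C t)) ^+ 3) * (d * (X t * C t + 1))
      - (m2 / (d * (X t - C t)) ^+ 3) * (d * (X t * C t - 1))).
    rewrite /v1 /D; dtac; first by [].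
    transitivity ((- ((a + c) / 2) * (X t * C t + 1) * (X t - C t) ^+ 3
      - ((a - c) / 2) * (X t * C t - 1) * (X t + C t) ^+ 3) / (d ^+ 3 * D t ^+ 3)).
      by rewrite -n1 /J /D; field; rewrite gt_eqF// gt_eqF.
    by rewrite DE /a /c; field; rewrite !gt_eqF.
  have dv2 : is_derive t 1 v2 (- (m1 / (d * (X t + C t)) ^+ 3) * (d * (Y t * S t))
      - (m2 / (d * (X t - C t)) ^+ 3) * (d * (Y t * S t))).
    rewrite /v2 /D; dtac; first by [].
    transitivity ((- ((a + c) / 2) * (Y t * S t) * (X t - C t) ^+ 3
      - ((a - c) / 2) * (Y t * S t) * (X t + C t) ^+ 3) / (d ^+ 3 * D t ^+ 3)).
      by rewrite -n2 /J /D; field; rewrite gt_eqF// gt_eqF.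
    by rewrite DE /a /c; field; rewrite !gt_eqF.
  have := is_derive_evec c1 c2 dv1 dv2.
  have -> : force c1 c2 m1 m2 (x t) = evec c1 c2
    (- (m1 / (d * (X t + C t)) ^+ 3) * (d * (X t * C t + 1))
      - (m2 / (d * (X t - C t)) ^+ 3) * (d * (X t * C t - 1)))
    (- (m1 / (d * (X t + C t)) ^+ 3) * (d * (Y t * S t))
      - (m2 / (d * (X t - C t)) ^+ 3) * (d * (Y t * S t))).
    rewrite /force r1 r2.
    have [E1 E2] := eframeB_foci c12 (X t * C t) (Y t * S t).
    rewrite /x E1 E2 !evecE.
    by apply/pair_equal_spec; split; rewrite /= /GRing.scale /=; ring.
  apply: near_eq_is_derive.
  have := @near_in_itvoo R al be t; rewrite in_itv/= => /(_ ti).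
  by apply: filterS => u; rewrite in_itv/= => /dx1 ->.
- rewrite dx1// enorm_sqr dot_evec// /potential r1 r2.
  have Y2 : Y t ^+ 2 = X t ^+ 2 - 1 by rewrite -XY; ring.
  have S2 : S t ^+ 2 = 1 - C t ^+ 2 by rewrite -CS; ring.
  have -> : v1 t * v1 t + v2 t * v2 t = (p t ^+ 2 + q t ^+ 2) / (d ^+ 2 * D t).
    have -> : v1 t * v1 t + v2 t * v2 t = (p t ^+ 2 + q t ^+ 2) *
       (Y t ^+ 2 * C t ^+ 2 + X t ^+ 2 * S t ^+ 2) / (d * D t) ^+ 2.
      by rewrite /v1 /v2; field; rewrite !gt_eqF.
    by rewrite Y2 S2 /D; field; rewrite gt_eqF// gt_eqF.
  by rewrite pq DE /a /b /c; field; rewrite !gt_eqF.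
Qed.

End elliptic_newton.

Section elliptic_point.
Variables (R : realType) (c1 c2 : R * R).

Definition rt (y : R) : R := Num.sqrt (1 + y ^+ 2).
(* cosh xi and sinh xi in terms of y = sinh (xi / 2). *)
Definition chx (y : R) : R := 1 + 2 * y ^+ 2.
Definition shx (y : R) : R := 2 * y * rt y.

Definition ell_point (y eta : R) : R * R :=
  eframe c1 c2 (chx y * cos eta) (shx y * sin eta).

(** Physical velocity belonging to the momenta p_xi = p and p_eta = q: the differential of the point
    in (xi, eta), divided by the time change |x - c1| |x - c2|. *)
Definition ell_vel (y eta p q : R) : R * R :=
  evec c1 c2
    ((p * shx y * cos eta - q * chx y * sin eta) /
       (half_dist c1 c2 * (chx y ^+ 2 - cos eta ^+ 2)))
    ((p * chx y * sin eta + q * shx y * cos eta) /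
       (half_dist c1 c2 * (chx y ^+ 2 - cos eta ^+ 2))).

Lemma rt_gt0 y : 0 < rt y.
Proof. by rewrite sqrtr_gt0 ltr_wpDr// sqr_ge0. Qed.

Lemma rt_sqr y : rt y ^+ 2 = 1 + y ^+ 2.
Proof. by rewrite sqr_sqrtr// addr_ge0// sqr_ge0. Qed.

Lemma chx_shx y : chx y ^+ 2 - shx y ^+ 2 = 1.
Proof. by rewrite /chx /shx exprMn rt_sqr; ring. Qed.

Lemma chx_gt1 y : 0 < y -> 1 < chx y.
Proof. by move=> y0; rewrite /chx ltrDl mulr_gt0// exprn_gt0. Qed.

Lemma chx_ge1 y : 1 <= chx y.
Proof. by rewrite /chx lerDl mulr_ge0// sqr_ge0. Qed.

Lemma shx_gt0 y : 0 < y -> 0 < shx y.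
Proof. by move=> y0; rewrite /shx mulr_gt0 ?rt_gt0// mulr_gt0. Qed.

Lemma ell_disc_gt0 y eta : 0 < y -> 0 < chx y ^+ 2 - cos eta ^+ 2.
Proof.
move=> y0; have := chx_gt1 y0; have := cos2Dsin2 eta; have := sqr_ge0 (sin eta).
by move=> h1 h2 h3; nra.
Qed.

End elliptic_point.

(** * The separated motion and its quadratures *)

Section flight.
Variables (R : realType) (a b c : R).
Hypotheses (b0 : 0 <= b) (c0 : 0 <= c) (ca : c < a).
Local Notation A := (a + 2 * b).

(** With y = r + tau^2, [fl_E y - fl_E r] is 2 tau^2 [fl_N r tau], so p_xi = 2 tau sqrt N changes
    sign smoothly at the turning level. [fl_Q] is the speed of tau in regularised time; it does not
    vanish there. *)
Definition fl_N (r tau : R) : R :=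
  (2 * r + tau ^+ 2) * (A + 2 * b * ((r + tau ^+ 2) ^+ 2 + r ^+ 2)).
Definition fl_Q (r tau : R) : R := rt (r + tau ^+ 2) / 2 * Num.sqrt (fl_N r tau).
(** The separation constant whose turning level is r: a X + b X^2 - a - b at X = cosh xi = 1 + 2
    r^2. It vanishes on the segment; [fl_g] is the matching p_eta. *)
Definition fl_E (r : R) : R := 2 * r ^+ 2 * (A + 2 * b * r ^+ 2).
Definition fl_g (E eta : R) : R :=
  Num.sqrt (2 * (a + b + E - c * cos eta - b * cos eta ^+ 2)).
Definition fl_p (r tau : R) : R := 2 * tau * Num.sqrt (fl_N r tau).

Lemma A_gt0 : 0 < A. Proof. by have := b0; have := c0; have := ca; lra. Qed.

Lemma fl_N_gt0 r tau : 0 < r -> 0 < fl_N r tau.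
Proof.
move=> r0; have := A_gt0 => A0; rewrite /fl_N mulr_gt0//.
  by have := sqr_ge0 tau; lra.
by rewrite ltr_wpDr// mulr_ge0 ?mulr_ge0// addr_ge0 ?sqr_ge0.
Qed.

Lemma fl_Q_gt0 r tau : 0 < r -> 0 < fl_Q r tau.
Proof.
move=> r0; rewrite /fl_Q mulr_gt0 ?sqrtr_gt0 ?fl_N_gt0// divr_gt0//; exact: rt_gt0.
Qed.

Lemma fl_E_ge0 r : 0 <= r -> 0 <= fl_E r.
Proof.
move=> r0; have A0 := A_gt0; rewrite /fl_E mulr_ge0 ?mulr_ge0 ?sqr_ge0//.
by rewrite addr_ge0 ?(ltW A0)// mulr_ge0 ?mulr_ge0// sqr_ge0.
Qed.

Lemma fl_g_arg_ge E eta : 0 <= E -> 2 * (a - c) <= 2 * (a + b + E - c * cos eta - b * cos eta ^+ 2).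
Proof.
move=> E0; have h1 := cos_le1 eta; have h2 := cos_geN1 eta.
have h3 : cos eta ^+ 2 <= 1 by nra.
have : c * cos eta <= c by rewrite -[leRHS]mulr1 ler_wpM2l.
have : b * cos eta ^+ 2 <= b by rewrite -[leRHS]mulr1 ler_wpM2l.
lra.
Qed.

Lemma fl_g_arg_le E eta : 2 * (a + b + E - c * cos eta - b * cos eta ^+ 2) <= 2 * (a + b + c + E).
Proof.
have h2 := cos_geN1 eta.
have : 0 <= c * (1 + cos eta) by rewrite mulr_ge0//; lra.
have : 0 <= b * cos eta ^+ 2 by rewrite mulr_ge0// sqr_ge0.
lra.
Qed.

Lemma fl_g_arg_gt0 E eta : 0 <= E -> 0 < 2 * (a + b + E - c * cos eta - b * cos eta ^+ 2).
Proof. by move=> E0; have := fl_g_arg_ge eta E0; have := ca; lra. Qed.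

Lemma fl_g_gt0 E eta : 0 <= E -> 0 < fl_g E eta.
Proof. by move=> E0; rewrite sqrtr_gt0 fl_g_arg_gt0. Qed.

Lemma fl_g_le E eta : 0 <= E -> fl_g E eta <= Num.sqrt (2 * (a + b + c + E)).
Proof.
move=> E0; rewrite ler_wsqrtr//; exact: fl_g_arg_le.
Qed.

Lemma fl_g_ge E eta : 0 <= E -> Num.sqrt (2 * (a - c)) <= fl_g E eta.
Proof.
move=> E0; rewrite ler_wsqrtr//; exact: fl_g_arg_ge.
Qed.

(** Regularised time since the turning level, as a function of tau; [fl_Theta] measures the same
    time by the angle. Along an orbit their difference is constant. *)
Definition fl_S (r : R) : R -> R := xget (fun=> 0)
  [set F : R -> R | F 0 = 0 /\ forall tau : R, is_derive tau 1 F (fl_Q r tau)^-1].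
Definition fl_Theta (E : R) : R -> R := xget (fun=> 0)
  [set F : R -> R | F 0 = 0 /\ forall x : R, is_derive x 1 F (fl_g E x)^-1].

Lemma fl_SP r : 0 < r ->
  fl_S r 0 = 0 /\ forall tau : R, is_derive tau 1 (fl_S r) (fl_Q r tau)^-1.
Proof.
move=> r0.
have [|F HF] := @antiderivative_exists R (fun x => (fl_Q r x)^-1).
  move=> x; apply: (@cV _ _ (fl_Q r)); first by rewrite gt_eqF// fl_Q_gt0.
  by rewrite /fl_Q /rt /fl_N; cauto.
by rewrite /fl_S; case: xgetP => [G _ //|/(_ F)].
Qed.

Lemma fl_ThetaP E : 0 <= E ->
  fl_Theta E 0 = 0 /\ forall x : R, is_derive x 1 (fl_Theta E) (fl_g E x)^-1.
Proof.
move=> E0.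
have [|F HF] := @antiderivative_exists R (fun x => (fl_g E x)^-1).
  move=> x; apply: (@cV _ _ (fl_g E)); first by rewrite gt_eqF// fl_g_gt0.
  by rewrite /fl_g; cauto.
by rewrite /fl_Theta; case: xgetP => [G _ //|/(_ F)].
Qed.

Lemma fl_Theta_inverse E : 0 <= E -> exists G : R -> R, (forall t, fl_Theta E (G t) = t) /\
  forall t : R, is_derive t 1 G (fl_g E (G t)).
Proof.
move=> E0; have [_ dT] := fl_ThetaP E0.
have g0 x : 0 < (fl_g E x)^-1 by rewrite invr_gt0 fl_g_gt0.
have [G [GK dG]] := gt0_derive_inverse dT g0.
pose M := Num.sqrt (2 * (a + b + c + E)).
have M0 : 0 < M.
  rewrite sqrtr_gt0; have := ca; have := c0; have := b0; move: E0; lra.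
have sj := @gt0_derive_surj R (fl_Theta E) _ dT g0 M^-1.
have {}sj t : exists x, fl_Theta E x = t.
  apply: sj; first by rewrite invr_gt0.
  move=> x; rewrite lef_pV2 ?posrE ?fl_g_gt0//; exact: fl_g_le.
have GT t : fl_Theta E (G t) = t by have [x <-] := sj t; rewrite GK.
exists G; split => // t; have := dG (G t); rewrite GT invrK; exact.
Qed.

(* The orbit of turning level [r] through [eta0], parametrised by physical time:
   y = r + tau^2, and [J / fl_Q], [J / fl_g] are dt/dtau and dt/deta. *)
Lemma flight_orbit (d r eta0 tau0 tau1 : R) : 0 < d -> 0 < r -> tau0 < tau1 ->
  let J (tau eta : R) := d ^+ 2 * (chx (r + tau ^+ 2) ^+ 2 - cos eta ^+ 2) in
  exists (al T be : R) (tau eta : R -> R),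
    [/\ al < 0 /\ 0 < T < be,
      forall t : R, al < t < be ->
        is_derive t 1 tau (fl_Q r (tau t) / J (tau t) (eta t)) /\
        is_derive t 1 eta (fl_g (fl_E r) (eta t) / J (tau t) (eta t)),
      [/\ tau 0 = tau0, tau T = tau1 & eta 0 = eta0],
      forall t, 0 < t < T -> tau0 < tau t < tau1 &
      forall t, al < t < be -> fl_Theta (fl_E r) (eta t) =
         fl_Theta (fl_E r) eta0 + (fl_S r (tau t) - fl_S r tau0)].
Proof.
move=> d0 r0 t01 J.
have E0 : 0 <= fl_E r by apply/fl_E_ge0/ltW.
have [G [TG dG]] := fl_Theta_inverse E0.
have [_ dS] := fl_SP r0; have [_ dT] := fl_ThetaP E0.
(* No existence theorem for differential equations is called upon: the conserved difference of
   [fl_Theta] and [fl_S] gives the angle as a function of tau, after which physical time is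
   integrated in tau and inverted. *)
pose he tau := G (fl_Theta (fl_E r) eta0 + (fl_S r tau - fl_S r tau0)).
have dhe (tau : R) : is_derive tau 1 he (fl_g (fl_E r) (he tau) * (fl_Q r tau)^-1).
  have dSt := dS tau.
  have dSt' : is_derive tau 1 (fun t => fl_Theta (fl_E r) eta0 + (fl_S r t - fl_S r tau0))
    (fl_Q r tau)^-1 by dtac; rewrite add0r addr0.
  exact: (dcomp (dG _) dSt').
have J0 tau eta : 0 < J tau eta.
  rewrite /J mulr_gt0 ?exprn_gt0//; apply: ell_disc_gt0.
  by rewrite ltr_wpDr// sqr_ge0.
have cq (tau : R) : {for tau, continuous (fun t => J t (he t) / fl_Q r t)}.
  have che := is_derive_cts (dhe tau).
  have : continuous_at tau (fun t => d ^+ 2 * (chx (r + t ^+ 2) ^+ 2 - cos (he t) ^+ 2) *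
     (rt (r + t ^+ 2) / 2 * Num.sqrt (fl_N r t))^-1).
    rewrite /chx /rt /fl_N; cauto.
    by rewrite gt_eqF//; exact: (fl_Q_gt0 tau r0).
  by [].
have [F0 [F00 dF0]] := antiderivative_exists cq.
pose F t := F0 t - F0 tau0.
have q0 t : 0 < J t (he t) / fl_Q r t by rewrite divr_gt0// fl_Q_gt0.
have dF (t : R) : is_derive t 1 F (J t (he t) / fl_Q r t).
  by apply: deq; [exact: (dD (dF0 t) (dcst (- F0 tau0) t))|rewrite addr0].
have [g [gK dg]] := gt0_derive_inverse dF q0.
have incF := gt0_derive_incr dF q0.
have Fs : F tau0 = 0 by rewrite /F subrr.
have im t : F (tau0 - 1) < t < F (tau1 + 1) -> exists2 x, F x = t & True.
  move=> ti; have [|||x _ Fx] := @IVT R F (tau0 - 1) (tau1 + 1) t.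
  - lra.
  - by apply: continuous_subspaceT => z; exact: (is_derive_cts (dF z)).
  - have ii := incF (tau0 - 1) (tau1 + 1) ltac:(lra).
    by rewrite (min_l (ltW ii)) (max_r (ltW ii)); move: ti; lra.
  by exists x.
(* One unit of tau is added at each end, so that the orbit lives on an open time interval around
   [0, T]. *)
exists (F (tau0 - 1)), (F tau1), (F (tau1 + 1)), g, (fun t => he (g t)).
have h1 := incF (tau0 - 1) tau0 ltac:(lra).
have h2 := incF tau0 tau1 t01.
have h3 := incF tau1 (tau1 + 1) ltac:(lra).
rewrite Fs in h1 h2.
split.
- by split => //; apply/andP.
- move=> t /im[x Fx _]; rewrite -Fx gK.
  have dgx : is_derive (F x) 1 g (fl_Q r x / J x (he x)).
    by have := dg x; rewrite invf_div.
  split => //.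
  apply: deq; first exact: (dcomp (dhe _) dgx).
  rewrite gK; have Q0 := fl_Q_gt0 x r0; have J0x := J0 x (he x).
  move: (fl_Q r x) (J x (he x)) (fl_g _ _) Q0 J0x => k j l k0 j0.
  by field; rewrite !gt_eqF.
- split; [by rewrite -Fs gK|by rewrite gK|].
  by rewrite -Fs gK /he subrr addr0 -[RHS](gt0_derive_inj dT _ (TG _))// => x; rewrite invr_gt0 fl_g_gt0.
- move=> t tT; have [|x Fx _] := im t; first by move: h1 h3; lra.
  rewrite -Fx gK; apply/andP; split; rewrite ltNge; apply/negP; rewrite le_eqVlt => /orP[/eqP E|/incF].
  + by move: tT; rewrite -Fx E Fs; lra.
  + by rewrite Fs Fx; lra.
  + by move: tT; rewrite -Fx -E; lra.
  + by rewrite Fx; lra.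
- by move=> t /im[x <- _]; rewrite gK /he TG.
Qed.

End flight.

Section bounce.
Variables (R : realType) (c1 c2 : R * R) (m1 m2 h : R).
Hypotheses (c12 : c1 <> c2) (m20 : 0 < m2) (m21 : m2 <= m1) (h0 : 0 <= h).
Local Notation d := (half_dist c1 c2).
Definition cA := d * (m1 + m2).
Definition cB := h * d ^+ 2.
Definition cC := d * (m1 - m2).

Lemma cB_ge0 : 0 <= cB.
Proof. by rewrite /cB mulr_ge0// sqr_ge0. Qed.

Lemma cC_ge0 : 0 <= cC.
Proof. by rewrite /cC mulr_ge0 ?subr_ge0// ltW// half_dist_gt0. Qed.

Lemma cC_lt : cC < cA.
Proof. by rewrite /cC /cA ltr_pM2l ?half_dist_gt0//; have := m20; lra. Qed.

Lemma bounce_trajectory (r eta0 tau0 tau1 : R) : 0 < r -> tau0 < tau1 ->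
  exists (al T be : R) (tau eta : R -> R),
    let x t := ell_point c1 c2 (r + tau t ^+ 2) (eta t) in
    [/\ al < 0 /\ 0 < T < be,
      forall t, al < t < be -> [/\ newton_at c1 c2 m1 m2 h x t, x t <> c1, x t <> c2 &
        derive1 x t = ell_vel c1 c2 (r + tau t ^+ 2) (eta t) (fl_p cA cB r (tau t))
          (fl_g cA cB cC (fl_E cA cB r) (eta t))],
      [/\ tau 0 = tau0, tau T = tau1 & eta 0 = eta0],
      forall t, 0 < t < T -> tau0 < tau t < tau1 &
      forall t, al < t < be -> fl_Theta cA cB cC (fl_E cA cB r) (eta t) =
         fl_Theta cA cB cC (fl_E cA cB r) eta0 +
         (fl_S cA cB r (tau t) - fl_S cA cB r tau0)].
Proof.
move=> r0 t01.
have [al [T [be [tau [eta [H1 H2 H3 H4 H5]]]]]] :=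
  flight_orbit cB_ge0 cC_ge0 cC_lt eta0 (half_dist_gt0 c12) r0 t01.
exists al, T, be, tau, eta => x; split => //.
have b0 := cB_ge0; have c0 := cC_ge0; have ca := cC_lt.
have E0 : 0 <= fl_E cA cB r by apply: (fl_E_ge0 b0 c0 ca); exact: ltW.
pose y t := r + tau t ^+ 2.
have y0 t : 0 < y t by rewrite /y ltr_wpDr// sqr_ge0.
apply: (@elliptic_newton R c1 c2 m1 m2 h c12 (fun t => chx (y t)) (fun t => shx (y t))
   (fun t => cos (eta t)) (fun t => sin (eta t)) (fun t => fl_p cA cB r (tau t))
   (fun t => fl_g cA cB cC (fl_E cA cB r) (eta t)) al be).
- move=> t _; split; [exact: chx_shx|exact: cos2Dsin2|exact: chx_gt1|].
  rewrite /fl_p /fl_g exprMn !sqr_sqrtr; last 2 first.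
  + exact/ltW/(fl_g_arg_gt0 b0 c0 ca).
  + exact/ltW/(fl_N_gt0 b0 c0 ca).
  rewrite -/cA -/cB -/cC /fl_N /fl_E /chx /y; ring.
- move=> t ti; have [dt de] := H2 t ti.
  have yt0 := y0 t.
  have dy : is_derive t 1 y (2 * tau t * (fl_Q cA cB r (tau t) / (d ^+ 2 * (chx (y t) ^+ 2 - cos (eta t) ^+ 2)))).
    by rewrite /y; dtac; rewrite expr1 add0r.
  have w0 := rt_gt0 (y t); have w2 := rt_sqr (y t).
  have Dd := ell_disc_gt0 (eta t) yt0; have d0 := half_dist_gt0 c12.
  have s0 : 0 < 1 + y t ^+ 2 by rewrite -w2 exprn_gt0.
  split.
  + rewrite /chx; dtac; rewrite -/(chx (y t)) /shx /fl_p /fl_Q -/(y t).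
    by field; rewrite !gt_eqF.
  + rewrite /shx /rt; dtac; first exact: s0.
    rewrite -/(chx (y t)) -/(rt (y t)) /fl_p /fl_Q -/(y t) -/(rt (y t)).
    have -> : chx (y t) * (2 * tau t * Num.sqrt (fl_N cA cB r (tau t))) =
      (rt (y t) ^+ 2 + y t ^+ 2) * (2 * tau t * Num.sqrt (fl_N cA cB r (tau t))).
      by rewrite w2 /chx; ring.
    by field; rewrite !gt_eqF.
  + by dtac; rewrite mulrA.
  + by dtac; rewrite mulrA.
- move=> t ti; have [dt de] := H2 t ti.
  have Dd := ell_disc_gt0 (eta t) (y0 t); have d0 := half_dist_gt0 c12.
  have N0 := fl_N_gt0 b0 c0 ca (tau t) r0.
  have g0 := fl_g_arg_gt0 b0 c0 ca (eta t) E0.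
  have sN0 : 0 < Num.sqrt (fl_N cA cB r (tau t)) by rewrite sqrtr_gt0.
  have sg0 := fl_g_gt0 b0 c0 ca (eta t) E0.
  have sN2 := sqr_sqrtr (ltW N0).
  split.
  + rewrite /fl_p /fl_N; dtac; first exact: N0.
    rewrite -/(fl_N cA cB r (tau t)).
    rewrite /fl_Q /shx -/(y t) -/cA -/cB.
    set s := Num.sqrt _ in sN0 sN2 *.
    transitivity (rt (y t) * (s ^+ 2 + tau t ^+ 2 * ((cA + 2 * cB + 2 * cB * (y t ^+ 2 + r ^+ 2))
       + (2 * r + tau t ^+ 2) * (4 * cB * y t)) ) / (d ^+ 2 * (chx (y t) ^+ 2 - cos (eta t) ^+ 2))).
      by field; rewrite !gt_eqF.
    by rewrite sN2 /fl_N /chx -/(y t) /y; field; rewrite !gt_eqF.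
  + rewrite /fl_g; dtac; first exact: g0.
    rewrite -/(fl_g cA cB cC (fl_E cA cB r) (eta t)) -/cC -/cB -/(y t).
    by field; rewrite !gt_eqF.
Qed.

End bounce.

(** * Elliptic coordinates along a curve *)

Section angles.
Variable R : realType.
Implicit Types x y z C S : R.

Lemma circle_angle C S : C ^+ 2 + S ^+ 2 = 1 -> exists t : R, cos t = C /\ sin t = S.
Proof.
move=> CS.
have C1 : -1 <= C <= 1.
  by apply: sqr_le1_bound; rewrite -CS lerDl sqr_ge0.
have sE : sin (acos C) = `|S|.
  by rewrite sin_acos// -sqrtr_sqr -CS; congr Num.sqrt; ring.
have [S0|S0] := leP 0 S.
  by exists (acos C); rewrite sE ger0_norm// acosK// in_itv.
exists (- acos C); rewrite cosN sinN sE ltr0_norm// opprK acosK// in_itv//.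
Qed.

Lemma two_pi_gt0 : 0 < 2 * pi :> R.
Proof. by rewrite mulr_gt0// pi_gt0. Qed.

Lemma floor_mod (p x : R) : 0 < p -> exists k : int, 0 <= x - k%:~R * p < p.
Proof.
move=> p0; exists (Num.floor (x / p)).
have h1 := floor_le (x / p); have h2 := floorD1_gt (x / p).
rewrite intrD mulr1z in h2.
have E : x = x / p * p by rewrite divfK// gt_eqF.
apply/andP; split.
  by rewrite subr_ge0 {2}E ler_wpM2r// ltW.
rewrite ltrBlDr {1}E.
have -> : p + (Num.floor (x / p))%:~R * p = ((Num.floor (x / p))%:~R + 1) * p by ring.
by rewrite ltr_pM2r.
Qed.

Lemma cosD_int (k : int) x : cos (x + k%:~R * (2 * pi)) = cos x.
Proof. by apply: periodic_int => s; rewrite mulr_natl cosD2pi. Qed.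

Lemma sinD_int (k : int) x : sin (x + k%:~R * (2 * pi)) = sin x.
Proof. by apply: periodic_int => s; rewrite mulr_natl sinD2pi. Qed.

Lemma cos_ge_mod (l z : R) : 0 <= l <= pi -> cos l <= cos z ->
  exists k : int, `|z - k%:~R * (2 * pi)| <= l.
Proof.
move=> lpi cz.
have [k kz] := floor_mod (z + pi) two_pi_gt0.
exists k; set w := z - _.
have wpi : - pi <= w <= pi by rewrite /w; move: kz; lra.
have cw : cos `|w| = cos z.
  by rewrite cos_norm /w -mulNr -mulrNz cosD_int.
have w0 : 0 <= `|w| <= pi by rewrite normr_ge0 ler_norml.
rewrite leNgt; apply/negP => lw.
have : cos `|w| < cos l by rewrite ltr_cos// in_itv/=.
by rewrite cw ltNge cz.
Qed.

Lemma angle_eq_mod x y : cos x = cos y -> sin x = sin y ->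
  exists k : int, x = y + k%:~R * (2 * pi).
Proof.
move=> cxy sxy.
have h : cos (0 : R) <= cos (x - y).
  by rewrite cos0 cosB cxy sxy -!expr2 cos2Dsin2.
have l0 : 0 <= (0 : R) <= pi by rewrite lexx pi_ge0.
have [k hk] := cos_ge_mod l0 h.
exists k; move: hk; rewrite normr_le0 => /eqP k0; lra.
Qed.

Lemma int_small (k : int) (p x y : R) : 0 < p -> x = y + k%:~R * p ->
  `|x - y| < p -> x = y.
Proof.
move=> p0 -> ; rewrite addrC addKr normrM (gtr0_norm p0).
rewrite -[ltRHS]mul1r ltr_pM2r// -intr_norm ltrz1.
by case: k => [[|n]|n] //; rewrite mul0r addr0.
Qed.

End angles.

Section elliptic_coordinates.
Variables (R : realType) (c1 c2 : R * R).
Hypothesis c12 : c1 <> c2.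
Local Notation d := (half_dist c1 c2).
Local Notation e := (axis c1 c2).
Local Notation P := (ell_point c1 c2).
Local Notation ctr := (2^-1 *: (c1 + c2)).

Lemma dot0 (w : R * R) : dot w 0 = 0.
Proof. by rewrite /dot /= !mulr0 addr0. Qed.

Lemma ell_point_dist y eta : enorm (P y eta - c1) = d * (chx y + cos eta) /\
  enorm (P y eta - c2) = d * (chx y - cos eta).
Proof.
exact: (enorm_focal c12 (chx_shx y) (cos2Dsin2 eta) (chx_ge1 y)).
Qed.

Lemma ell_point_inj y eta y' eta' : 0 < y -> 0 < y' -> P y eta = P y' eta' ->
  y = y' /\ exists k : int, eta = eta' + k%:~R * (2 * pi).
Proof.
move=> y0 y0' E; have d0 := half_dist_gt0 c12.
have [h1 h2] := ell_point_dist y eta; have [h1' h2'] := ell_point_dist y' eta'.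
rewrite E h1' in h1; rewrite E h2' in h2.
have k1 := mulfI (lt0r_neq0 d0) h1; have k2 := mulfI (lt0r_neq0 d0) h2.
have C : cos eta = cos eta' by lra.
have X : chx y = chx y' by lra.
have yy : y = y'.
  apply/eqP; rewrite -(@eqrXn2 _ 2)//; try exact: ltW.
  by apply/eqP; move: X; rewrite /chx; lra.
split => //; apply: angle_eq_mod => //.
move: E; rewrite /ell_point => /(eframe_inj c12)[_]; rewrite -yy.
by move/(mulfI (lt0r_neq0 (shx_gt0 y0))).
Qed.

Lemma ell_point_period y eta (k : int) : P y (eta + k%:~R * (2 * pi)) = P y eta.
Proof. by rewrite /ell_point cosD_int sinD_int. Qed.

Lemma ell_point_segment eta : segment c1 c2 (P 0 eta).
Proof.
exists ((1 + cos eta) / 2).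
  by rewrite /= in_itv/=; have := cos_le1 eta; have := cos_geN1 eta; lra.
rewrite /ell_point.
have -> : chx (0 : R) = 1 by rewrite /chx; ring.
have -> : shx (0 : R) = 0 by rewrite /shx; ring.
rewrite mul1r mul0r.
have [E1 E2] := eframe_foci c12.
have := eframeB c1 c2 1 0 (- 1) 0; rewrite E1 E2 => ->.
rewrite -[Z in Z + _ = _]E1 !eframeE evecE.
move: (axis c1 c2) (half_dist c1 c2) => [g1 g2] k.
by apply/pair_equal_spec; split; rewrite /= /GRing.scale /=; field.
Qed.

Lemma eframe_surj (p : R * R) : exists u v, p = eframe c1 c2 u v.
Proof.
have d0 := half_dist_gt0 c12; have e1 := dot_axis c12.
exists (dot (p - ctr) e / d), (dot (p - ctr) (rot90 e) / d).
rewrite eframeE; move: e1; rewrite /dot; case: e => g1 g2 /= e1.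
rewrite [LHS]surjective_pairing; apply/pair_equal_spec.
have E1 : g1 ^+ 2 = 1 - g2 ^+ 2 by rewrite -e1; ring.
rewrite /GRing.scale /=; split.
  set q1 := p.1 - _; set q2 := p.2 - _.
  transitivity (2^-1 * (c1.1 + c2.1) + q1 * (g1 ^+ 2 + g2 ^+ 2)); first by rewrite E1 /q1; ring.
  by field; rewrite gt_eqF.
set q1 := p.1 - _; set q2 := p.2 - _.
transitivity (2^-1 * (c1.2 + c2.2) + q2 * (g1 ^+ 2 + g2 ^+ 2)); first by rewrite E1 /q2; ring.
by field; rewrite gt_eqF.
Qed.

Lemma eframe_dist u v : enorm (eframe c1 c2 u v - c1) = d * Num.sqrt ((u + 1) ^+ 2 + v ^+ 2) /\
  enorm (eframe c1 c2 u v - c2) = d * Num.sqrt ((u - 1) ^+ 2 + v ^+ 2).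
Proof.
have [E1 E2] := eframeB_foci c12 u v.
rewrite E1 E2; split; apply: (enorm_evec c12); rewrite ?sqrtr_ge0// sqr_sqrtr//;
  by rewrite addr_ge0// sqr_ge0.
Qed.

(** Focal distances in units of [d]. Half their sum is cosh xi, half their difference cos eta; [ry]
    is then sinh (xi / 2), taken nonnegative. *)
Definition rho1 (u v : R) := Num.sqrt ((u + 1) ^+ 2 + v ^+ 2).
Definition rho2 (u v : R) := Num.sqrt ((u - 1) ^+ 2 + v ^+ 2).
Definition rX u v := (rho1 u v + rho2 u v) / 2.
Definition rC u v := (rho1 u v - rho2 u v) / 2.
Definition rY u v := Num.sqrt ((rX u v) ^+ 2 - 1).
Definition rS u v := v / rY u v.
Definition ry u v := Num.sqrt ((rX u v - 1) / 2).

(** The sum of the focal distances attains its minimum only on the segment, by the equality case of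
    the triangle inequality. *)
Lemma rX_gt1 u v : ~ segment c1 c2 (eframe c1 c2 u v) -> 1 < rX u v.
Proof.
apply: contra_notT; rewrite -leNgt => X1.
have a1 : `|u + 1| <= rho1 u v.
  by rewrite -sqrtr_sqr ler_wsqrtr// lerDl sqr_ge0.
have a2 : `|u - 1| <= rho2 u v.
  by rewrite -sqrtr_sqr ler_wsqrtr// lerDl sqr_ge0.
have s12 : rho1 u v + rho2 u v <= 2 by move: X1; rewrite /rX; lra.
have h1 := ler_norm (u + 1); have h2 := ler_norm (- (u - 1)).
have h3 := ler_norm (- (u + 1)); have h4 := ler_norm (u - 1).
rewrite normrN in h2; rewrite normrN in h3.
have E1 : `|u + 1| = rho1 u v by lra.
have u1 : -1 <= u <= 1 by lra.
have v0 : v = 0.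
  apply/eqP; rewrite -sqrf_eq0; apply/eqP.
  have : rho1 u v ^+ 2 = (u + 1) ^+ 2 + v ^+ 2.
    by rewrite sqr_sqrtr// addr_ge0// sqr_ge0.
  by rewrite -E1 real_normK ?num_real//; lra.
rewrite v0.
have [t [ct st]] : exists t : R, cos t = u /\ sin t = Num.sqrt (1 - u ^+ 2).
  apply: circle_angle; rewrite sqr_sqrtr; first by ring.
  by rewrite subr_ge0; nra.
have := ell_point_segment t; rewrite /ell_point ct st.
have -> : chx (0 : R) = 1 by rewrite /chx; ring.
have -> : shx (0 : R) = 0 by rewrite /shx; ring.
by rewrite mul1r mul0r.
Qed.

Lemma rho_relations u v : 1 < rX u v ->
  [/\ u = rX u v * rC u v, v = rY u v * rS u v, rX u v ^+ 2 - rY u v ^+ 2 = 1,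
    rC u v ^+ 2 + rS u v ^+ 2 = 1 & 0 < rY u v].
Proof.
move=> X1.
have X2 : 0 < rX u v ^+ 2 - 1 by nra.
have Y0 : 0 < rY u v by rewrite sqrtr_gt0.
have Y2 : rY u v ^+ 2 = rX u v ^+ 2 - 1 by rewrite sqr_sqrtr// ltW.
have r1 : rho1 u v ^+ 2 = (u + 1) ^+ 2 + v ^+ 2.
  by rewrite sqr_sqrtr// addr_ge0// sqr_ge0.
have r2 : rho2 u v ^+ 2 = (u - 1) ^+ 2 + v ^+ 2.
  by rewrite sqr_sqrtr// addr_ge0// sqr_ge0.
have uE : u = rX u v * rC u v.
  transitivity ((rho1 u v ^+ 2 - rho2 u v ^+ 2) / 4).
    by rewrite r1 r2; field.
  by rewrite /rX /rC; field.
have XC : rX u v ^+ 2 + rC u v ^+ 2 = u ^+ 2 + 1 + v ^+ 2.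
  transitivity ((rho1 u v ^+ 2 + rho2 u v ^+ 2) / 2).
    by rewrite /rX /rC; field.
  by rewrite r1 r2; field.
split => //.
- by rewrite /rS mulrCA mulfV ?mulr1// gt_eqF.
- by rewrite Y2; ring.
- have -> : rS u v ^+ 2 = v ^+ 2 / rY u v ^+ 2.
    by rewrite /rS; field; rewrite gt_eqF.
  rewrite Y2.
  have -> : v ^+ 2 = (rX u v ^+ 2 - 1) * (1 - rC u v ^+ 2).
    transitivity (rX u v ^+ 2 + rC u v ^+ 2 - (rX u v * rC u v) ^+ 2 - 1); last by ring.
    by rewrite -uE XC; ring.
  by field; rewrite gt_eqF.
Qed.

Lemma ry_relations u v : 1 < rX u v ->
  [/\ 0 < ry u v, chx (ry u v) = rX u v & shx (ry u v) = rY u v].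
Proof.
move=> X1; have y0 : 0 < ry u v by rewrite sqrtr_gt0; lra.
have XE : chx (ry u v) = rX u v by rewrite /chx /ry sqr_sqrtr; [field|lra].
split => //; apply/eqP; rewrite -(@eqrXn2 _ 2)//; last 2 first.
- by rewrite ltW// shx_gt0.
- exact: sqrtr_ge0.
have [_ _ XY _ _] := rho_relations X1.
by apply/eqP; have := chx_shx (ry u v); rewrite XE; lra.
Qed.

Lemma continuous_ell_rates (X Y C S u v : R -> R) (t : R) :
  continuous_at t X -> continuous_at t Y -> continuous_at t C ->
  continuous_at t S -> continuous_at t u -> continuous_at t v ->
  X t ^+ 2 - C t ^+ 2 != 0 ->
  continuous_at t (fun t => (Y t * C t * u t + X t * S t * v t) /
    (X t ^+ 2 - C t ^+ 2)) /\
  continuous_at t (fun t => (- (X t * S t * u t) + Y t * C t * v t) /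
    (X t ^+ 2 - C t ^+ 2)).
Proof. by move=> cX' cY cC cS cu cv z0; split; cauto. Qed.

(* The angle is lifted as an antiderivative of the closed form d eta along the
   curve. *)
Lemma elliptic_lift (x : R -> R * R) :
  (forall t, derivable x t 1) -> continuous (derive1 x) ->
  (forall t, ~ segment c1 c2 (x t)) ->
  exists y eta y' eta' : R -> R,
    [/\ forall t, 0 < y t /\ x t = P (y t) (eta t),
        forall t : R, is_derive t 1 y (y' t) /\ is_derive t 1 eta (eta' t),
        forall t : R, continuous_at t y' &
        forall t : R, continuous_at t eta'].
Proof.
move=> dx cx' xs; have d0 := half_dist_gt0 c12.
pose u t := dot (x t - ctr) e / d; pose v t := dot (x t - ctr) (rot90 e) / d.
pose u' t := dot (derive1 x t) e / d; pose v' t := dot (derive1 x t) (rot90 e) / d.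
have xE t : x t = eframe c1 c2 (u t) (v t).
  have e1 := dot_axis c12; rewrite eframeE /u /v.
  move: e1; rewrite /dot; case: e => g1 g2 /= e1.
  rewrite [LHS]surjective_pairing; apply/pair_equal_spec.
  have E1 : g1 ^+ 2 = 1 - g2 ^+ 2 by rewrite -e1; ring.
  rewrite /GRing.scale /=; split.
    set q1 := (x t).1 - _; set q2 := (x t).2 - _.
    transitivity (2^-1 * (c1.1 + c2.1) + q1 * (g1 ^+ 2 + g2 ^+ 2)); first by rewrite E1 /q1; ring.
    by field; rewrite gt_eqF.
  set q1 := (x t).1 - _; set q2 := (x t).2 - _.
  transitivity (2^-1 * (c1.2 + c2.2) + q2 * (g1 ^+ 2 + g2 ^+ 2)); first by rewrite E1 /q2; ring.
  by field; rewrite gt_eqF.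
have du (t : R) : is_derive t 1 u (u' t).
  have dxt := derivable_is_derive (dx t).
  have dd := is_derive_dot (is_deriveB dxt (is_derive_cst ctr t 1)) (is_derive_cst e t 1).
  apply: deq; first exact: (dM dd (dcst d^-1 t)).
  by rewrite subr0 dot0 addr0 mulr0 addr0.
have dv (t : R) : is_derive t 1 v (v' t).
  have dxt := derivable_is_derive (dx t).
  have dd := is_derive_dot (is_deriveB dxt (is_derive_cst ctr t 1)) (is_derive_cst (rot90 e) t 1).
  apply: deq; first exact: (dM dd (dcst d^-1 t)).
  by rewrite subr0 dot0 addr0 mulr0 addr0.
have cu' (t : R) : continuous_at t u'.
  have cx := cx' t; rewrite /u' /dot.
  have ca1 : continuous_at t (fun s => (derive1 x s).1) by apply: cfst; exact: cx.
  have ca2 : continuous_at t (fun s => (derive1 x s).2) by apply: csnd; exact: cx.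
  apply: cM; last exact: ccst.
  by apply: cD; apply: cM; [exact: ca1|exact: ccst|exact: ca2|exact: ccst].
have cv' (t : R) : continuous_at t v'.
  have cx := cx' t; rewrite /v' /dot.
  have ca1 : continuous_at t (fun s => (derive1 x s).1) by apply: cfst; exact: cx.
  have ca2 : continuous_at t (fun s => (derive1 x s).2) by apply: csnd; exact: cx.
  apply: cM; last exact: ccst.
  by apply: cD; apply: cM; [exact: ca1|exact: ccst|exact: ca2|exact: ccst].
have X1 t : 1 < rX (u t) (v t) by apply: rX_gt1; rewrite -xE.
move: u v u' v' xE du dv cu' cv' X1 => u v u' v' xE du dv cu' cv' X1.
pose X t := rX (u t) (v t); pose C t := rC (u t) (v t).
pose Y t := rY (u t) (v t); pose S t := rS (u t) (v t).
have rel t := rho_relations (X1 t).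
have D0 t : 0 < X t ^+ 2 - C t ^+ 2.
  have [_ _ _ CS _] := rel t; have x1 := X1 t.
  have : C t ^+ 2 <= 1 by rewrite -CS lerDl sqr_ge0.
  by rewrite /X; nra.
pose xi' t := (Y t * C t * u' t + X t * S t * v' t) / (X t ^+ 2 - C t ^+ 2).
pose om t := (- (X t * S t * u' t) + Y t * C t * v' t) / (X t ^+ 2 - C t ^+ 2).
have rho0 t : 0 < X t + C t /\ 0 < X t - C t.
  have [_ _ _ CS _] := rel t; have x1 := X1 t.
  have : C t ^+ 2 <= 1 by rewrite -CS lerDl sqr_ge0.
  by move=> /sqr_le1_bound; rewrite -/(X t) in x1; split; lra.
have r1E t : X t + C t = rho1 (u t) (v t) by rewrite /X /C /rX /rC; field.
have r2E t : X t - C t = rho2 (u t) (v t) by rewrite /X /C /rX /rC; field.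
have dr1 (t : R) : is_derive t 1 (fun t => rho1 (u t) (v t))
    (((X t * C t + 1) * u' t + Y t * S t * v' t) / (X t + C t)).
  have [uE vE _ _ _] := rel t; have dut := du t; have dvt := dv t.
  have [p1 _] := rho0 t.
  rewrite r1E in p1 *; rewrite -uE -vE.
  have p1' : 0 < (u t + 1) ^+ 2 + v t ^+ 2 by move: p1; rewrite sqrtr_gt0.
  rewrite /rho1; apply: deq.
    exact: (@dsqrt R (fun s => (u s + 1) ^+ 2 + v s ^+ 2) t _ p1'
      (dD (dX 2 (dD dut (dcst 1 t))) (dX 2 dvt))).
  by rewrite -/(rho1 _ _) /=; field; rewrite gt_eqF.
have dr2 (t : R) : is_derive t 1 (fun t => rho2 (u t) (v t))
    (((X t * C t - 1) * u' t + Y t * S t * v' t) / (X t - C t)).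
  have [uE vE _ _ _] := rel t; have dut := du t; have dvt := dv t.
  have [_ p1] := rho0 t.
  rewrite r2E in p1 *; rewrite -uE -vE.
  have p1' : 0 < (u t - 1) ^+ 2 + v t ^+ 2 by move: p1; rewrite sqrtr_gt0.
  rewrite /rho2; apply: deq.
    exact: (@dsqrt R (fun s => (u s - 1) ^+ 2 + v s ^+ 2) t _ p1'
      (dD (dX 2 (dD dut (dcst (-1) t))) (dX 2 dvt))).
  by rewrite -/(rho2 _ _) /=; field; rewrite gt_eqF.
have S2 t : S t ^+ 2 = 1 - C t ^+ 2.
  by have [_ _ _ CS _] := rel t; rewrite /S /C -CS; ring.
have Y2 t : Y t ^+ 2 = X t ^+ 2 - 1.
  by have [_ _ XY _ _] := rel t; rewrite /X /Y -XY; ring.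
have Y0 t : 0 < Y t by have [] := rel t.
have dX' (t : R) : is_derive t 1 X (Y t * xi' t).
  rewrite /X /rX; apply: deq; first exact: (dM (dD (dr1 t) (dr2 t)) (dcst 2^-1 t)).
  have [p1 p2] := rho0 t.
  transitivity ((C t * Y t ^+ 2 * u' t + X t * Y t * S t * v' t) / (X t ^+ 2 - C t ^+ 2)).
    rewrite Y2.
    have -> : X t ^+ 2 - C t ^+ 2 = (X t + C t) * (X t - C t) by ring.
    by field; rewrite !gt_eqF.
  by rewrite /xi'; field; rewrite gt_eqF.
have dC (t : R) : is_derive t 1 C (- S t * om t).
  rewrite /C /rC; apply: deq; first exact: (dM (dD (dr1 t) (dN (dr2 t))) (dcst 2^-1 t)).
  have [p1 p2] := rho0 t.
  transitivity ((X t * S t ^+ 2 * u' t - C t * Y t * S t * v' t) / (X t ^+ 2 - C t ^+ 2)).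
    rewrite S2.
    have -> : X t ^+ 2 - C t ^+ 2 = (X t + C t) * (X t - C t) by ring.
    by field; rewrite !gt_eqF.
  by rewrite /om; field; rewrite gt_eqF.
have dY (t : R) : is_derive t 1 Y (X t * xi' t).
  have x0 : 0 < X t ^+ 2 - 1 by rewrite -Y2 exprn_gt0.
  rewrite /Y /rY; apply: deq.
    exact: (@dsqrt R (fun s => X s ^+ 2 - 1) t _ x0 (dD (dX 2 (dX' t)) (dcst (-1) t))).
  by rewrite -/(rY _ _) -/(Y t) /=; field; rewrite gt_eqF.
have dS (t : R) : is_derive t 1 S (C t * om t).
  have y0 : Y t != 0 by rewrite gt_eqF.
  rewrite /S /rS; apply: deq; first exact: (dM (dv t) (dV y0 (dY t))).
  have [_ vE _ _ _] := rel t; rewrite -/(Y t) -/(S t) in vE; rewrite {1}vE.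
  transitivity ((v' t * (X t ^+ 2 * (1 - S t ^+ 2) - C t ^+ 2) - X t * Y t * S t * C t * u' t) / (Y t * (X t ^+ 2 - C t ^+ 2))).
    by rewrite /xi'; field; rewrite !gt_eqF.
  rewrite S2 /om.
  transitivity ((v' t * C t ^+ 2 * (X t ^+ 2 - 1) - X t * Y t * S t * C t * u' t) / (Y t * (X t ^+ 2 - C t ^+ 2))).
    by congr (_ / _); ring.
  by rewrite -Y2; field; rewrite !gt_eqF.
have cX' (t : R) : continuous_at t X := is_derive_cts (dX' t).
have cC' (t : R) : continuous_at t C := is_derive_cts (dC t).
have cY' (t : R) : continuous_at t Y := is_derive_cts (dY t).
have cS' (t : R) : continuous_at t S := is_derive_cts (dS t).
have com (t : R) : continuous_at t om.
  have z0 : X t ^+ 2 - C t ^+ 2 != 0 by rewrite gt_eqF.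
  exact: (continuous_ell_rates (cX' t) (cY' t) (cC' t) (cS' t) (cu' t) (cv' t) z0).2.
have cxi (t : R) : continuous_at t xi'.
  have z0 : X t ^+ 2 - C t ^+ 2 != 0 by rewrite gt_eqF.
  exact: (continuous_ell_rates (cX' t) (cY' t) (cC' t) (cS' t) (cu' t) (cv' t) z0).1.
have [eta0 [ce se]] : exists t0 : R, cos t0 = C 0 /\ sin t0 = S 0.
  by apply: circle_angle; have [] := rel 0.
have [F [F0 dF]] := antiderivative_exists com.
pose eta t := eta0 + F t.
have deta (t : R) : is_derive t 1 eta (om t).
  by apply: deq; [exact: (dD (dcst eta0 t) (dF t))|rewrite add0r].
have lift t : cos (eta t) = C t /\ sin (eta t) = S t.
  (* [G] is the scalar product of the unit vectors (C, S) and (cos eta, sin eta). It is constant and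
     equals 1 at 0, so the two vectors coincide. *)
  pose G t := C t * cos (eta t) + S t * sin (eta t).
  have dG (s : R) : is_derive s 1 G 0.
    apply: deq; first exact: (dD (dM (dC s) (dcos (deta s))) (dM (dS s) (dsin (deta s)))).
    by cbv beta; ring.
  have G0 : G 0 = 1.
    have [_ _ _ CS _] := rel 0.
    by rewrite /G /eta F0 addr0 ce se -!expr2 CS.
  have Gt : G t = 1 by rewrite -G0; apply: is_derive_0_is_cst.
  have [_ _ _ CS _] := rel t; rewrite -/(C t) -/(S t) in CS.
  have : (C t - cos (eta t)) ^+ 2 + (S t - sin (eta t)) ^+ 2 = 0.
    have -> : (C t - cos (eta t)) ^+ 2 + (S t - sin (eta t)) ^+ 2 =
      (C t ^+ 2 + S t ^+ 2) + (cos (eta t) ^+ 2 + sin (eta t) ^+ 2) - 2 * G t by rewrite /G; ring.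
    by rewrite CS cos2Dsin2 Gt; ring.
  move/eqP; rewrite paddr_eq0 ?sqr_ge0// !sqrf_eq0 !subr_eq0 => /andP[/eqP <- /eqP <-].
  by split.
pose y t := ry (u t) (v t).
have yrel t := ry_relations (X1 t).
have dy (t : R) : is_derive t 1 y (Y t * xi' t / (4 * y t)).
  have [y0 _ _] := yrel t; rewrite -/(y t) in y0.
  have x0 : 0 < (X t - 1) / 2 by have := X1 t; rewrite -/(X t); lra.
  rewrite /y /ry; apply: deq.
    exact: (@dsqrt R (fun s => (X s - 1) / 2) t _ x0
      (dM (dD (dX' t) (dcst (-1) t)) (dcst 2^-1 t))).
  cbv beta; have -> : Num.sqrt ((X t - 1) / 2) = y t by [].
  by field; rewrite gt_eqF.
exists y, eta, (fun t => Y t * xi' t / (4 * y t)), om; split => //.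
- move=> t; have [y0 XE YE] := yrel t; have [cE sE] := lift t.
  have [uE vE _ _ _] := rel t.
  by split => //; rewrite xE /ell_point XE YE cE sE -uE -vE.
- move=> t; have [y0 _ _] := yrel t; rewrite -/(y t) in y0.
  have cy : continuous_at t y := is_derive_cts (dy t).
  have z0 : 4 * y t != 0 by rewrite gt_eqF// mulr_gt0.
  apply: cM; first by apply: cM; [exact: cY'|exact: cxi].
  by apply: (@cV R R (fun s => 4 * y s)); [exact: z0|apply: cM; [exact: ccst|exact: cy]].
Qed.

End elliptic_coordinates.

(** A first exit point would lie in the closure of [Omega] but not in [Omega], hence on its
    boundary. *)
Lemma path_in_open (R : realType) (Omega : set (R * R)) (g : R -> R * R) (T : R) :
  open Omega -> (forall t : R, continuous_at t g) -> Omega (g 0) ->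
  (forall t, 0 <= t <= T -> ~ boundary Omega (g t)) ->
  forall t, 0 <= t <= T -> Omega (g t).
Proof.
move=> oO cg g0 nb; apply: (@real_induction R T (fun t => Omega (g t))) => //.
- move=> t tT IH.
  apply: contrapT => nO; apply: (nb t); first by move: tT; lra.
  split => // B HB.
  have := cvg_at_left_filter (cg t) => /(_ B HB) HB'.
  near (t^'-) => s.
  exists (g s); split; last by near: s.
  apply: IH; apply/andP; split.
    by near: s; apply: nbhs_left_ge; case/andP: tT.
  by near: s; exact: nbhs_left_lt.
- move=> t tT Ot.
  have : \forall s \near t, Omega (g s).
    by apply: (cg t); exact: open_nbhs_nbhs.
  move=> /nbhs_ballP[e /= e0 He]; exists e => // s st; apply: He.
  rewrite /ball/= ltr_norml; move: st; lra.
Unshelve. all: by end_near. Qed.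

(** [b] is the end of the flat piece that starts at [t0]. Without such an end the flat piece could
    always be prolonged, and continuity induction would bring it to [t1]. *)
Lemma flat_right (R : realType) (f : R -> R) (m t0 t1 : R) :
  (forall t : R, continuous_at t f) -> f t0 = m -> t0 < t1 -> f t1 <> m ->
  exists b, [/\ t0 <= b < t1, forall s, t0 <= s <= b -> f s = m &
    forall e, 0 < e -> exists s, b < s < b + e /\ f s <> m].
Proof.
move=> cf f0 t01 f1; apply: contrapT => H; apply: f1.
pose P t := forall s, 0 <= s <= t -> f (t0 + s) = m.
suff : P (t1 - t0).
  by move=> /(_ (t1 - t0)); rewrite [t0 + _]addrC subrK; apply; lra.
apply: (@real_induction R (t1 - t0) P); last by lra.
- by move=> s s0; (have s00 : s = 0 by lra); rewrite s00 addr0.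
- move=> t tT IH s st; have [st'|st'] := ltP s t; first by apply: (IH s); lra.
  have -> : s = t by lra.
  have L1 : f u @[u --> (t0 + t)^'-] --> f (t0 + t) := cvg_at_left_filter (cf (t0 + t)).
  have L2 : f u @[u --> (t0 + t)^'-] --> m.
    apply: cvg_near_cst; near=> u.
    have u1 : u < t0 + t by near: u; exact: nbhs_left_lt.
    have u2 : t0 <= u by near: u; apply: nbhs_left_ge; lra.
    have := IH (u - t0) ltac:(lra) (u - t0) ltac:(lra).
    by rewrite [t0 + _]addrC subrK.
  exact: (cvg_unique _ L1 L2).
- move=> t tT Pt; apply: contrapT => H'; apply: H; exists (t0 + t); split.
  + by lra.
  + by move=> s st; have := Pt (s - t0) ltac:(lra); rewrite [t0 + _]addrC subrK.
  + move=> e e0; apply: contrapT => H2; apply: H'; exists e => // s st r rs.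
    have [rt|rt] := leP r t; first by apply: Pt; lra.
    apply: contrapT => fr; apply: H2; exists (t0 + r); split => //; lra.
Unshelve. all: by end_near. Qed.

Section elliptic_velocity.
Variables (R : realType) (c1 c2 : R * R).
Hypothesis c12 : c1 <> c2.
Local Notation d := (half_dist c1 c2).
Local Notation P := (ell_point c1 c2).
Local Notation V := (ell_vel c1 c2).

Lemma dot_ell_vel y eta p q p' q' : 0 < y ->
  dot (V y eta p q) (V y eta p' q') =
  (p * p' + q * q') / (d ^+ 2 * (chx y ^+ 2 - cos eta ^+ 2)).
Proof.
move=> y0; have d0 := half_dist_gt0 c12; have D0 := ell_disc_gt0 eta y0.
rewrite /ell_vel dot_evec//.
have Y2 : shx y ^+ 2 = chx y ^+ 2 - 1 by rewrite -(chx_shx y); ring.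
have S2 : sin eta ^+ 2 = 1 - cos eta ^+ 2 by rewrite sin2cos2.
transitivity ((p * p' + q * q') * (shx y ^+ 2 * cos eta ^+ 2 + chx y ^+ 2 * sin eta ^+ 2)
   / (d * (chx y ^+ 2 - cos eta ^+ 2)) ^+ 2).
  by field; rewrite !gt_eqF.
by rewrite Y2 S2; field; rewrite !gt_eqF.
Qed.

Lemma ell_vel_lin y eta p q (s : R) : s *: V y eta p q = V y eta (s * p) (s * q).
Proof.
rewrite /ell_vel !evecE; apply/pair_equal_spec.
by split; rewrite /= /GRing.scale /=; ring.
Qed.

Lemma ell_vel_inj y eta p q p' q' : 0 < y -> V y eta p q = V y eta p' q' ->
  p = p' /\ q = q'.
Proof.
move=> y0 E; have d0 := half_dist_gt0 c12; have D0 := ell_disc_gt0 eta y0.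
have k0 : (d ^+ 2 * (chx y ^+ 2 - cos eta ^+ 2))^-1 != 0.
  by rewrite invr_neq0// gt_eqF// mulr_gt0// exprn_gt0.
have h1 := dot_ell_vel eta p q 1 0 y0; have h2 := dot_ell_vel eta p q 0 1 y0.
rewrite E dot_ell_vel// in h1; rewrite E dot_ell_vel// in h2.
have := mulIf k0 h1; have := mulIf k0 h2.
by rewrite !mulr0 !mulr1 !addr0 !add0r.
Qed.

Lemma is_derive_ell_point (y eta : R -> R) (t y' eta' : R) : 0 < y t ->
  is_derive t 1 y y' -> is_derive t 1 eta eta' ->
  is_derive t 1 (fun s => P (y s) (eta s))
    ((d ^+ 2 * (chx (y t) ^+ 2 - cos (eta t) ^+ 2)) *:
       V (y t) (eta t) (2 * y' / rt (y t)) eta').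
Proof.
move=> y0 dy de; have d0 := half_dist_gt0 c12; have D0 := ell_disc_gt0 (eta t) y0.
have w0 := rt_gt0 (y t); have w2 := rt_sqr (y t).
have s0 : 0 < 1 + y t ^+ 2 by rewrite -w2 exprn_gt0.
have dX' : is_derive t 1 (fun s => chx (y s)) (shx (y t) * (2 * y' / rt (y t))).
  rewrite /chx; dtac; rewrite /shx; field; rewrite gt_eqF//.
have dY : is_derive t 1 (fun s => shx (y s)) (chx (y t) * (2 * y' / rt (y t))).
  rewrite /shx /rt; dtac; first exact: s0.
  rewrite -/(rt (y t)).
  transitivity ((rt (y t) ^+ 2 + y t ^+ 2) * (2 * y' / rt (y t))).
    by field; rewrite gt_eqF.
  by rewrite w2 /chx; ring.
have := is_derive_eframe c1 c2 (dM dX' (dcos de)) (dM dY (dsin de)).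
set l := (X in is_derive _ _ _ X); set l' := (X in _ -> is_derive _ _ _ X).
suff -> : l = l' by [].
rewrite /l /l' /ell_vel !evecE; apply/pair_equal_spec; split; rewrite /= /GRing.scale /=;
  by field; rewrite !gt_eqF.
Qed.

Lemma continuous_ell_point (T : topologicalType) (y eta : T -> R) (t : T) :
  continuous_at t y -> continuous_at t eta ->
  continuous_at t (fun s => P (y s) (eta s)).
Proof.
move=> cy ce; rewrite /ell_point.
have : continuous_at t (fun s => (2^-1 * (c1.1 + c2.1) + d * (chx (y s) * cos (eta s) * (axis c1 c2).1 - shx (y s) * sin (eta s) * (axis c1 c2).2),
   2^-1 * (c1.2 + c2.2) + d * (chx (y s) * cos (eta s) * (axis c1 c2).2 + shx (y s) * sin (eta s) * (axis c1 c2).1))).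
  by rewrite /chx /shx /rt; cauto.
by under [X in _ -> continuous_at _ X]eq_fun do rewrite eframeE.
Qed.

Lemma continuous_ell_vel (T : topologicalType) (y eta p q : T -> R) (t : T) : 0 < y t ->
  continuous_at t y -> continuous_at t eta -> continuous_at t p -> continuous_at t q ->
  continuous_at t (fun s => V (y s) (eta s) (p s) (q s)).
Proof.
move=> y0 cy ce cp cq; rewrite /ell_vel.
have D0 : d * (chx (y t) ^+ 2 - cos (eta t) ^+ 2) != 0.
  by rewrite gt_eqF// mulr_gt0 ?half_dist_gt0// ell_disc_gt0.
have cX' : continuous_at t (fun s => chx (y s)) by rewrite /chx; cauto.
have cY : continuous_at t (fun s => shx (y s)) by rewrite /shx /rt; cauto.
have ca1 : continuous_at t (fun s => (p s * shx (y s) * cos (eta s) - q s * chx (y s) * sin (eta s)) /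
  (d * (chx (y s) ^+ 2 - cos (eta s) ^+ 2))) by cauto.
have ca2 : continuous_at t (fun s => (p s * chx (y s) * sin (eta s) + q s * shx (y s) * cos (eta s)) /
  (d * (chx (y s) ^+ 2 - cos (eta s) ^+ 2))) by cauto.
under eq_fun do rewrite evecE.
move: ca1 ca2; set f1 := (fun s => _ / _); set f2 := (fun s => _ / _) => ca1 ca2.
have : continuous_at t (fun s => (f1 s * (axis c1 c2).1 - f2 s * (axis c1 c2).2,
  f1 s * (axis c1 c2).2 + f2 s * (axis c1 c2).1)) by clearbody f1 f2; cauto.
exact.
Qed.

End elliptic_velocity.

(** * The boundary near the minimum of y *)

Lemma IVT_cts (R : realType) (f : R -> R) (a b v : R) : a <= b ->
  (forall t : R, continuous_at t f) ->
  (f a <= v <= f b) \/ (f b <= v <= f a) -> exists2 c, a <= c <= b & f c = v.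
Proof.
move=> ab cf H.
have [||c] := @IVT R f a b v ab.
- by apply: continuous_subspaceT => t; exact: cf.
- rewrite ge_min le_max; case: H => /andP[-> ->]; rewrite ?orbT//.
by rewrite in_itv/= => ci fc; exists c.
Qed.

Lemma thicken (R : realType) (f : R -> R) (a b : R) : a <= b ->
  (forall t : R, continuous_at t f) -> (forall t, a <= t <= b -> 0 < f t) ->
  exists2 r, 0 < r & forall t, a - r <= t <= b + r -> 0 < f t.
Proof.
move=> ab cf f0.
have nb (x : R) : a <= x <= b -> exists2 r, 0 < r & forall t, x - r < t < x + r -> 0 < f t.
  move=> xi; have : \forall t \near x, 0 < f t.
    by apply: (cvgr_gt _ (cf x)); exact: f0.
  move=> /nbhs_ballP[r /= r0 Hr]; exists r => // t ti; apply: Hr.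
  by rewrite /ball/= ltr_norml; move: ti; lra.
have [|ra ra0 Ha] := nb a; first by rewrite lexx.
have [|rb rb0 Hb] := nb b; first by rewrite lexx andbT.
have m0 : 0 < Num.min ra rb by rewrite lt_min ra0.
have ma : Num.min ra rb <= ra by rewrite ge_min lexx.
have mb : Num.min ra rb <= rb by rewrite ge_min lexx orbT.
exists (Num.min ra rb / 2); first by lra.
move=> t ti; have [h|h] := ltP t a; first by apply: Ha; lra.
have [h'|h'] := ltP b t; first by apply: Hb; lra.
by apply: f0; rewrite h h'.
Qed.

(** The inverse function lemma asks for a positive derivative on the whole line, so [f] is replaced
    by a primitive of its derivative frozen outside the interval; the two agree inside. *)
Lemma graph_inverse (R : realType) (f f' : R -> R) (lo hi r : R) : 0 < r -> lo <= hi ->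
  (forall t : R, is_derive t 1 f (f' t)) -> (forall t : R, continuous_at t f') ->
  (forall t, lo - r <= t <= hi + r -> 0 < f' t) ->
  exists G : R -> R, [/\ forall t, lo <= t <= hi -> G (f t) = t,
    forall v, f lo <= v <= f hi -> lo <= G v <= hi /\ f (G v) = v &
    forall v : R, f lo <= v <= f hi -> is_derive v 1 G (f' (G v))^-1].
Proof.
move=> r0 lohi df cf' f'0.
pose c s := Num.max (lo - r) (Num.min (hi + r) s).
pose q s := f' (c s).
have cc (t : R) : continuous_at t c by rewrite /c; apply: cmax; cauto; apply: cmin; cauto.
have ci s : lo - r <= c s <= hi + r.
  by rewrite /c le_max lexx ge_max ge_min lexx !andTb; lra.
have cE s : lo - r < s < hi + r -> c s = s.
  by move=> si; rewrite /c (min_r (_ : s <= _)) ?max_r//; lra.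
have cq (t : R) : continuous_at t q by apply: (@ccomp _ _ _ f' c); [exact: cf'|exact: cc].
have q0 s : 0 < q s by exact: f'0.
have [F [F0 dF]] := antiderivative_exists cq.
have FE s : lo - r < s < hi + r -> f s = F s + (f lo - F lo).
  move=> si.
  suff : f s - F s = f lo - F lo by lra.
  apply: (@derive0_cst R (fun s => f s - F s) (lo - r) (hi + r)); [|exact: si|lra].
  move=> x xi; apply: deq; first exact: (dD (df x) (dN (dF x))).
  by rewrite /q cE// subrr.
pose F1 s := F s + (f lo - F lo).
have dF1 (s : R) : is_derive s 1 F1 (q s).
  by apply: deq; [exact: (dD (dF s) (dcst _ _))|rewrite addr0].
have [G [GK dG]] := gt0_derive_inverse dF1 q0.
have Gf t : lo <= t <= hi -> G (f t) = t.
  by move=> ti; rewrite FE ?GK//; lra.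
have fG v : f lo <= v <= f hi -> lo <= G v <= hi /\ f (G v) = v.
  move=> vi.
  have [||t ti <-] := @IVT_cts _ f lo hi v lohi.
  - by move=> t; exact: (is_derive_cts (df t)).
  - by left.
  by rewrite Gf.
exists G; split => // v vi.
have [Gi E] := fG _ vi.
have Gi' : lo - r < G v < hi + r by lra.
have := dG (G v); rewrite /q cE// (_ : F1 (G v) = v)//.
by rewrite /F1 -FE.
Qed.

(** [u] and [u'] are continuous on the whole line, so that the maps built on them are defined for
    all states. By [ga_only] no other piece of the curve comes below ym + de over this range of
    angles; [ga_low] leaves enough room on both sides for a flight steeper than the arc to remain
    over ]al, be[. *)
Record graph_arc (R : realType) (c1 c2 : R * R) (g : R -> R * R)
    (ym ka al e1 e2 be de : R) (u u' : R -> R) : Prop := GraphArc {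
  ga_order : [/\ al < e1, e1 < e2, e2 < be & be < al + 2 * pi];
  ga_de : 0 < de;
  ga_cu : forall t : R, continuous_at t u;
  ga_cu' : forall t : R, continuous_at t u';
  ga_du : forall t : R, al < t < be -> is_derive t 1 u (u' t);
  ga_bound : forall t, ym <= u t /\ `|u' t| <= ka;
  ga_curve : forall t, al <= t <= be -> exists th la, [/\ la != 0,
    g th = ell_point c1 c2 (u t) t &
    derive1 g th = la *: ell_vel c1 c2 (u t) t (2 * u' t / rt (u t)) 1];
  ga_only : forall th y t, al <= t <= be -> 0 < y < ym + de ->
    g th = ell_point c1 c2 y t -> y = u t;
  ga_low : forall t, e1 <= t <= e2 ->
    [/\ u t < ym + de, u t - ym < 2 * ka * (t - al) & u t - ym < 2 * ka * (be - t)];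
  ga_neg : u' e1 < 0;
  ga_pos : 0 < u' e2 }.

Section arc.
Variables (R : realType) (c1 c2 : R * R) (g : R -> R * R).
Variables (y eta y' eta' : R -> R) (th0 : R).
Hypothesis c12 : c1 <> c2.
Local Notation P := (ell_point c1 c2).
Local Notation V := (ell_vel c1 c2).
Local Notation d := (half_dist c1 c2).
Hypothesis gper : forall s, g (s + 2 * pi) = g s.
Hypothesis ginj : forall s t, g s = g t -> exists k : int, s - t = k%:~R * (2 * pi).
Hypothesis lift : forall t, 0 < y t /\ g t = P (y t) (eta t).
Hypothesis dlift : forall t : R, is_derive t 1 y (y' t) /\ is_derive t 1 eta (eta' t).
Hypothesis cy' : forall t : R, continuous_at t y'.
Hypothesis ce' : forall t : R, continuous_at t eta'.
Hypothesis greg : forall t, derive1 g t != 0.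
Hypothesis ymin : forall t, y th0 <= y t.
Hypothesis eta0 : 0 < eta' th0.
Hypothesis notell : ~ exists2 L : R, enorm (c1 - c2) < L & range g = ellipse c1 c2 L.
Local Notation ym := (y th0).

Lemma arc_cy (t : R) : continuous_at t y.
Proof. by have [dy _] := dlift t; exact: (is_derive_cts dy). Qed.

Lemma arc_ce (t : R) : continuous_at t eta.
Proof. by have [_ de] := dlift t; exact: (is_derive_cts de). Qed.

Lemma arc_same s t : g s = g t -> y s = y t /\ exists k : int, eta s = eta t + k%:~R * (2 * pi).
Proof.
move=> E; have [ys gs] := lift s; have [yt gt] := lift t.
by apply: (ell_point_inj c12 ys yt); rewrite -gs -gt.
Qed.

Lemma arc_per (k : int) s : g (s + k%:~R * (2 * pi)) = g s.
Proof. exact: periodic_int. Qed.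

Lemma arc_derive t : derive1 g t =
  (d ^+ 2 * (chx (y t) ^+ 2 - cos (eta t) ^+ 2)) *:
  V (y t) (eta t) (2 * y' t / rt (y t)) (eta' t).
Proof.
have [y0 _] := lift t; have [dy de] := dlift t.
apply: is_derive_derive1.
have -> : g = fun s => P (y s) (eta s) by apply/funext => s; have [] := lift s.
exact: is_derive_ell_point.
Qed.

Lemma arc_crit t : y t = ym -> y' t = 0.
Proof.
move=> yt; have [dy _] := dlift t.
have := @derive1_at_min R y (t - 1) (t + 1) t.
move=> /(_ ltac:(lra)) H.
have {}H : is_derive t 1 y 0.
  apply: H.
  - by move=> s _; have [[]] := dlift s.
  - by rewrite in_itv/=; lra.
  - by move=> s _; rewrite yt.
by rewrite -(is_derive_derive1 dy) (is_derive_derive1 H).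
Qed.

Lemma arc_eta'_neq0 t : y t = ym -> eta' t != 0.
Proof.
move=> yt; apply/eqP => e0; have := greg t.
rewrite arc_derive (arc_crit yt) e0 mulr0 mul0r ell_vel_lin !mulr0.
rewrite /ell_vel evecE !mul0r subrr addr0 !mul0r.
by rewrite subrr addr0 eqxx.
Qed.

Lemma arc_reduce (t s : R) : exists k : int, t <= s - k%:~R * (2 * pi) < t + 2 * pi /\
  g (s - k%:~R * (2 * pi)) = g s.
Proof.
have [k hk] := floor_mod (s - t) (two_pi_gt0 R).
exists k; split; first by move: hk; lra.
by rewrite -mulNr -mulrNz arc_per.
Qed.

(** If y kept its minimum over a period, y' would vanish throughout and regularity would force eta'
    to have no zero. Then eta would be injective, its increment over a period a nonzero multiple of
    2 pi, and the curve would fill a confocal ellipse. *)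
Lemma arc_not_flat t : exists2 s, t <= s <= t + 2 * pi & y s <> ym.
Proof.
apply: contrapT => H; apply: notell.
have yall s : y s = ym.
  have [k [hk gk]] := arc_reduce t s; have [<- _] := arc_same gk.
  by apply: contrapT => yk; apply: H; exists (s - k%:~R * (2 * pi)) => //; lra.
have [ym0 _] := lift th0; have d0 := half_dist_gt0 c12.
have inj s u : s < u -> eta s <> eta u.
  move=> su E; have [z zi] := MVT_oo su (fun z _ => (dlift z).2).
  rewrite E subrr => /esym/eqP; rewrite mulf_eq0 (negbTE (arc_eta'_neq0 (yall z))) /=.
  by rewrite subr_eq0 gt_eqF.
exists (2 * d * chx ym).
  have -> : enorm (c1 - c2) = 2 * d by rewrite /half_dist; field.
  have D0 : 0 < 2 * d by rewrite mulr_gt0.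
  by rewrite -[ltLHS]mulr1 ltr_pM2l// chx_gt1.
apply/seteqP; split => [_ [s _ <-]|p pL].
  rewrite /ellipse /=; have [_ ->] := lift s.
  have [-> ->] := ell_point_dist c12 (y s) (eta s).
  by rewrite yall; ring.
have [u [v pE]] := eframe_surj c12 p; move: pL; rewrite /ellipse /= pE.
have [-> ->] := eframe_dist c12 u v => pL.
have XE : rX u v = chx ym.
  rewrite /rX /rho1 /rho2.
  have -> : chx ym = (2 * d * chx ym) / (2 * d) by field; rewrite gt_eqF.
  by rewrite -pL; field; rewrite gt_eqF.
have X1 : 1 < rX u v by rewrite XE chx_gt1.
have [uE vE _ CS _] := rho_relations X1.
have [y0 XE' YE] := ry_relations X1.
have [e1 [cE sE]] := circle_angle CS.
have pP : eframe c1 c2 u v = P ym e1.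
  have -> : ym = ry u v.
    apply/eqP; rewrite -(@eqrXn2 _ 2)//; try exact: ltW.
    by apply/eqP; move: XE; rewrite -XE' /chx; lra.
  by rewrite /ell_point XE' YE cE sE -uE -vE.
have g2 : g (2 * pi) = g 0 by rewrite -[X in g X = _]add0r gper.
have pi2 := two_pi_gt0 R.
have [_ [k kE]] := arc_same g2.
have k0 : k <> 0.
  by move=> k0; apply: (inj _ _ pi2); rewrite kE k0 mul0r addr0.
have kge : 2 * pi <= `|eta (2 * pi) - eta 0|.
  rewrite kE addrC addKr normrM (gtr0_norm pi2) -[leLHS]mul1r ler_pM2r//.
  by rewrite -intr_norm ler1z; case: (k) k0 => [[|n]|n].
have [j hj] := floor_mod (e1 - Num.min (eta 0) (eta (2 * pi))) pi2.
have [|||s _ sE'] := @IVT_cts _ eta 0 (2 * pi) (e1 - j%:~R * (2 * pi)).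
- by rewrite ltW.
- exact: arc_ce.
- move: kge hj; case: (leP (eta 0) (eta (2 * pi))) => h.
  + by rewrite ger0_norm ?subr_ge0//; left; lra.
  + by rewrite ltr0_norm ?subr_lt0//; right; lra.
exists s => //; have [_ ->] := lift s.
by rewrite yall sE' pP -mulNr -mulrNz ell_point_period.
Qed.

Lemma arc_flat : exists a b : R, [/\ a <= th0 <= b /\ b - a < 2 * pi,
  forall s, a <= s <= b -> y s = ym,
  forall e, 0 < e -> exists s, b < s < b + e /\ ym < y s &
  forall e, 0 < e -> exists s, a - e < s < a /\ ym < y s].
Proof.
have pi2 := two_pi_gt0 R.
have gt s : y s <> ym -> ym < y s.
  by move=> /eqP; rewrite lt_neqAle ymin andbT eq_sym.
have [t1 t1i yt1] := arc_not_flat th0.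
have th1 : th0 < t1.
  by rewrite lt_neqAle; apply/andP; split; [apply/eqP => E; rewrite E in yt1|case/andP: t1i].
have [b [bi fb nb]] := flat_right arc_cy erefl th1 yt1.
(* The left end is found on the mirrored function; starting one period earlier provides a time
   before [th0] at which y is not minimal. *)
have [t2 t2i yt2] := arc_not_flat (th0 - 2 * pi).
rewrite subrK in t2i.
have th2 : - th0 < - t2.
  rewrite ltrN2 lt_neqAle; apply/andP; split; [|by case/andP: t2i].
  by apply/eqP => E; rewrite E in yt2.
have cyN (t : R) : continuous_at t (fun t => y (- t)).
  apply: (@ccomp _ _ _ y (fun t => - t)); [exact: arc_cy|cauto].
have [||a [ai fa na]] := @flat_right R (fun t => y (- t)) ym _ _ cyN _ th2.
- by rewrite opprK.
- by rewrite opprK.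
have fab s : - a <= s <= b -> y s = ym.
  move=> si; have [h|h] := leP th0 s; first by apply: fb; lra.
  by rewrite -[s]opprK; apply: fa; lra.
exists (- a), b; split => //.
- split; first by move: ai bi; lra.
  rewrite ltNge; apply/negP => ab.
  by have [s si] := arc_not_flat (- a); apply; apply: fab; lra.
- by move=> e /nb [s [si ys]]; exists s; split => //; exact: gt.
- move=> e /na [s [si ys]]; exists (- s); split; first by lra.
  exact: gt.
Qed.


End arc.

Lemma cos_lipschitz (R : realType) (x y : R) : `|cos x - cos y| <= `|x - y|.
Proof.
rewrite -[leRHS]mul1r.
apply: (@MVT_bound R cos (fun x => - sin x) (Num.min x y) (Num.max x y) 1
  (fun z _ => is_derive_cos z)).
- by move=> z _; rewrite normrN ler_norml sin_geN1 sin_le1.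
- by rewrite ge_min le_max !lexx.
- by rewrite ge_min le_max !lexx !orbT.
Qed.

(** Where |y'| < ka eta', the angle is a parameter and y becomes a function u of it with slopes at
    most ka. Beyond each end of the flat interval y exceeds its minimum arbitrarily soon, so the
    mean value theorem yields negative slopes on the left and positive ones on the right, at angles
    within sg / 2 of the flat part. *)
Lemma arc_slope (R : realType) (y eta y' eta' : R -> R) (a b r r1 ka ym sg : R) :
  (forall t : R, is_derive t 1 y (y' t) /\ is_derive t 1 eta (eta' t)) ->
  (forall t : R, continuous_at t y') -> (forall t : R, continuous_at t eta') ->
  (forall t, ym <= y t) -> a <= b -> 0 < r -> 2 * r <= r1 -> 0 < ka ->
  (forall s, a - r1 <= s <= b + r1 -> `|y' s| < ka * eta' s) ->
  (forall s, a <= s <= b -> y s = ym) ->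
  (forall e, 0 < e -> exists s, b < s < b + e /\ ym < y s) ->
  (forall e, 0 < e -> exists s, a - e < s < a /\ ym < y s) ->
  0 < sg -> sg <= eta a - eta (a - r) -> sg <= eta (b + r) - eta b ->
  exists (u u' : R -> R) (e1 e2 : R),
    [/\ [/\ eta a - sg / 2 < e1 < eta a, eta b < e2 < eta b + sg / 2, u' e1 < 0 & 0 < u' e2],
        [/\ forall t : R, continuous_at t u, forall t : R, continuous_at t u',
          forall t : R, eta a - sg < t < eta b + sg -> is_derive t 1 u (u' t) &
          forall t, ym <= u t /\ `|u' t| <= ka],
        forall t, eta a - sg <= t <= eta b + sg -> exists s, [/\ 0 < eta' s, eta s = t, u t = y s &
          u' t = y' s / eta' s],
        forall s, a - r <= s <= b + r -> eta a - sg <= eta s <= eta b + sg -> y s = u (eta s) &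
        forall t, e1 <= t <= e2 -> u t - ym <= ka * sg / 2].
Proof.
move=> dlift cy' ce' ymin ab r0 rr1 ka0 kap flat nb na sg0 sg1 sg2.
have ep1 s : a - r1 <= s <= b + r1 -> 0 < eta' s.
  by move=> /kap h; rewrite -(pmulr_rgt0 _ ka0); apply: le_lt_trans h.
have ep s : a <= s <= b -> 0 < eta' s by move=> si; apply: ep1; olra.
have arc_ce (t : R) : continuous_at t eta by exact: (is_derive_cts (dlift t).2).
have arc_cy (t : R) : continuous_at t y by exact: (is_derive_cts (dlift t).1).
have incr lo hi s t : (forall x, lo <= x <= hi -> 0 < eta' x) -> lo <= s -> s < t -> t <= hi ->
    eta s < eta t.
  move=> e0 los st thi; have [z zi zE] := MVT_oo st (fun z _ => (dlift z).2).
  by rewrite -subr_gt0 zE mulr_gt0 ?subr_gt0//; apply: e0; olra.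
have incrW lo hi s t : (forall x, lo <= x <= hi -> 0 < eta' x) -> lo <= s -> s <= t -> t <= hi ->
    eta s <= eta t.
  move=> e0 los; rewrite le_eqVlt => /orP[/eqP -> //|st] thi.
  by apply: ltW; exact: (incr lo hi).
have eab : eta a <= eta b by apply: (incrW a b).
have [G [GK GI dG]] : exists G : R -> R, [/\ forall t, a - r <= t <= b + r -> G (eta t) = t,
    forall v, eta (a - r) <= v <= eta (b + r) -> a - r <= G v <= b + r /\ eta (G v) = v &
    forall v : R, eta (a - r) <= v <= eta (b + r) -> is_derive v 1 G (eta' (G v))^-1].
  apply: (graph_inverse r0 _ (fun t => (dlift t).2) ce').
    by olra.
  by move=> t ti; apply: ep1; olra.
(* The value is recorded by two inequalities rather than by an equation, since [olra] keeps order
   hypotheses only. *)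
have [al alE] : exists l, eta a - sg <= l <= eta a - sg by exists (eta a - sg); rewrite lexx.
have [be beE] : exists l, eta b + sg <= l <= eta b + sg by exists (eta b + sg); rewrite lexx.
pose cl t := Num.max al (Num.min be t).
have ccl (t : R) : continuous_at t cl by rewrite /cl; apply: cmax; cauto; apply: cmin; cauto.
have abe : al <= be by olra.
have cli t : al <= cl t <= be by rewrite /cl le_max lexx ge_max ge_min lexx abe.
have clE t : al <= t <= be -> cl t = t.
  by move=> /andP[h1 h2]; rewrite /cl (min_r h2) max_r.
have inG t : al <= t <= be -> eta (a - r) <= t <= eta (b + r) by olra.
have cGcl (t : R) : continuous_at t (fun t => G (cl t)).
  apply: (@ccomp _ _ _ G cl); last exact: ccl.
  exact: (is_derive_cts (dG _ (inG _ (cli t)))).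
pose u t := y (G (cl t)); pose u' t := y' (G (cl t)) / eta' (G (cl t)).
have Gr t : al <= t <= be -> a - r1 <= G t <= b + r1.
  by move=> /inG /GI[]; olra.
have u'b t : `|u' t| <= ka.
  have h := Gr _ (cli t); rewrite /u' normrM normfV (gtr0_norm (ep1 _ h)).
  by rewrite ler_pdivrMr ?ep1// ltW// kap.
have du (t : R) : al < t < be -> is_derive t 1 u (u' t).
  move=> ti; have ti' : al <= t <= be by olra.
  apply: (@near_eq_is_derive _ _ _ (fun t => y (G t))).
  - have := @near_in_itvoo R al be t; rewrite in_itv/= => /(_ ti).
    by apply: filterS => s; rewrite in_itv/= => si; rewrite /u clE//; olra.
  - apply: deq; first exact: (dcomp (dlift (G t)).1 (dG _ (inG _ ti'))).
    by rewrite /u' clE.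
have yu s : a - r <= s <= b + r -> al <= eta s <= be -> y s = u (eta s).
  by move=> si ei; rewrite /u clE// GK.
have uflat t : eta a <= t <= eta b -> u t = ym.
  move=> ti; have ti' : al <= t <= be by olra.
  have [s si st] : exists2 s, a <= s <= b & eta s = t.
    by apply: IVT_cts; [exact: ab|exact: arc_ce|left].
  rewrite -st -yu ?flat//; first by olra.
  by rewrite st.
have cly t : ym <= u t by exact: ymin.
have u_lip s t : al < s < be -> al < t < be -> `|u s - u t| <= ka * `|s - t|.
  move=> si ti; have [st|st] := leP s t.
    apply: (@MVT_bound _ u u' s t ka); [|by move=> *; exact: u'b|clear -st; clear -st; lra|clear -st; clear -st; lra].
    by move=> z zi; apply: du; olra.
  apply: (@MVT_bound _ u u' t s ka); [|by move=> *; exact: u'b|clear -st; clear -st; lra|clear -st; clear -st; lra].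
  by move=> z zi; apply: du; olra.
have dsg : 0 < ka * sg by rewrite mulr_gt0.
have [e1 [e1i e1n]] : exists e1, eta a - sg / 2 < e1 < eta a /\ u' e1 < 0.
  have : \forall s \near a, eta a - sg / 2 < eta s.
    by apply: (cvgr_gt _ (arc_ce a)); olra.
  move=> /nbhs_ballP[e /= e0 He].
  have m0 : 0 < Num.min e r by rewrite lt_min e0.
  have m1 : Num.min e r <= e by rewrite ge_min lexx.
  have m2 : Num.min e r <= r by rewrite ge_min lexx orbT.
  have [s [si ys]] := na _ m0.
  have sx : s < a by olra.
  have [z zi zE] := MVT_oo sx (fun z _ => (dlift z).1).
  rewrite (flat a) ?lexx// in zE.
  have y'z : y' z < 0.
    rewrite ltNge; apply/negP => yz; have : 0 <= y' z * (a - s) by rewrite mulr_ge0//; clear -si; lra.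
    by rewrite -zE; olra.
  have hz : eta a - sg / 2 < eta z.
    by apply: He; rewrite /ball/= gtr0_norm; clear -m1 si zi; lra.
  have hz2 : eta z < eta a by apply: (incr (a - r1) (b + r1)) => //; clear -ab m2 r0 rr1 si zi; lra.
  exists (eta z); split; first by rewrite hz hz2.
  rewrite /u' clE; last by clear -alE beE eab hz hz2; lra.
  rewrite GK; last by clear -ab m2 si zi; lra.
  by rewrite pmulr_llt0// invr_gt0; apply: ep1; clear -ab m2 rr1 si zi; lra.
have [e2 [e2i e2p]] : exists e2, eta b < e2 < eta b + sg / 2 /\ 0 < u' e2.
  have : \forall s \near b, eta s < eta b + sg / 2.
    by apply: (cvgr_lt _ (arc_ce b)); olra.
  move=> /nbhs_ballP[e /= e0 He].
  have m0 : 0 < Num.min e r by rewrite lt_min e0.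
  have m1 : Num.min e r <= e by rewrite ge_min lexx.
  have m2 : Num.min e r <= r by rewrite ge_min lexx orbT.
  have [s [si ys]] := nb _ m0.
  have sx : b < s by olra.
  have [z zi zE] := MVT_oo sx (fun z _ => (dlift z).1).
  rewrite (flat b) ?lexx ?andbT// in zE.
  have y'z : 0 < y' z.
    rewrite ltNge; apply/negP => yz; have : y' z * (s - b) <= 0 by rewrite mulr_le0_ge0//; clear -si; lra.
    by rewrite -zE; clear -ys; lra.
  have hz : eta z < eta b + sg / 2.
    by apply: He; rewrite /ball/= ltr0_norm; clear -m1 si zi; lra.
  have hz2 : eta b < eta z by apply: (incr (a - r1) (b + r1)) => //; clear -ab m2 r0 rr1 si zi; lra.
  exists (eta z); split; first by rewrite hz hz2.
  rewrite /u' clE; last by clear -alE beE eab hz hz2; lra.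
  rewrite GK; last by clear -ab m2 si zi; lra.
  by rewrite divr_gt0//; apply: ep1; clear -ab m2 rr1 si zi; lra.
have ulow t : e1 <= t <= e2 -> u t - ym <= ka * sg / 2.
  move=> ti; have [h|h] := ltP t (eta a).
    have := u_lip t (eta a); rewrite (uflat (eta a)) ?lexx//.
    move=> /(_ ltac:(clear -alE beE e1i e2i ti; lra) ltac:(clear -alE beE eab sg0; lra)) H.
    have := ler_norm (u t - ym).
    have : ka * `|t - eta a| <= ka * (sg / 2) by rewrite ler_pM2l// ler_norml; clear -e1i h ti; lra.
    clear -H; lra.
  have [h'|h'] := ltP (eta b) t; last by rewrite uflat ?h ?h'//; clear -dsg; clear -dsg; lra.
  have := u_lip t (eta b); rewrite (uflat (eta b)) ?lexx ?andbT//.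
  move=> /(_ ltac:(clear -alE beE e1i e2i ti; lra) ltac:(clear -alE beE eab sg0; lra)) H.
  have := ler_norm (u t - ym).
  have : ka * `|t - eta b| <= ka * (sg / 2) by rewrite ler_pM2l// ler_norml; clear -e2i h' ti; lra.
  clear -H; lra.
exists u, u', e1, e2; split; [by []| |..].
- split.
  + by move=> t; apply: (@ccomp _ _ _ y (fun t => G (cl t))); [exact: arc_cy|exact: cGcl].
  + move=> t; rewrite /u'; apply: cM.
      by apply: (@ccomp _ _ _ y' (fun t => G (cl t))); [exact: cy'|exact: cGcl].
    apply: (@cV _ _ (fun t => eta' (G (cl t)))).
      by rewrite gt_eqF// ep1// Gr.
    by apply: (@ccomp _ _ _ eta' (fun t => G (cl t))); [exact: ce'|exact: cGcl].
  + by move=> t ti; apply: du; clear -alE beE ti; lra.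
  + by move=> t; split; [exact: cly|exact: u'b].
- move=> t ti0; have ti : al <= t <= be by clear -alE beE ti0; lra.
  have [Gi GE] := GI _ (inG _ ti); exists (G t).
  rewrite /u /u' clE//; split => //; exact: ep1 (Gr _ ti).
- by move=> s si ei; apply: yu; clear -alE beE ei si; lra.
- exact: ulow.
Qed.

Lemma arc_graph (R : realType) (c1 c2 : R * R) (g : R -> R * R)
    (y eta y' eta' : R -> R) (th0 ka : R) :
  c1 <> c2 -> (forall s, g (s + 2 * pi) = g s) ->
  (forall s t, g s = g t -> exists k : int, s - t = k%:~R * (2 * pi)) ->
  (forall t, 0 < y t /\ g t = ell_point c1 c2 (y t) (eta t)) ->
  (forall t : R, is_derive t 1 y (y' t) /\ is_derive t 1 eta (eta' t)) ->
  (forall t : R, continuous_at t y') -> (forall t : R, continuous_at t eta') ->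
  (forall t, derive1 g t != 0) -> (forall t, y th0 <= y t) -> 0 < eta' th0 ->
  ~ (exists2 L : R, enorm (c1 - c2) < L & range g = ellipse c1 c2 L) ->
  0 < ka -> exists al e1 e2 be de u u',
  graph_arc c1 c2 g (y th0) ka al e1 e2 be de u u'.
Proof.
move=> c12 gper ginj lift dlift cy' ce' greg ymin eta0 notell ka0.
have [a [b [[abi ba] flat nb na]]] := arc_flat c12 gper lift dlift greg ymin notell.
set ym := y th0 in flat nb na ymin *.
have arc_eta'_neq0 := arc_eta'_neq0 c12 lift dlift greg ymin.
have arc_crit := arc_crit dlift ymin.
have arc_ce : forall t : R, continuous_at t eta by exact: (arc_ce dlift).
have arc_cy : forall t : R, continuous_at t y by exact: (arc_cy dlift).
have arc_reduce := arc_reduce gper.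
have arc_derive := arc_derive c12 lift dlift.
have pi2 := two_pi_gt0 R.
have ab : a <= b by olra.
have ep s : a <= s <= b -> 0 < eta' s.
  move=> si; rewrite lt_neqAle eq_sym (arc_eta'_neq0 _ (flat _ si)) /= leNgt.
  apply/negP => es.
  have [h|h] := leP th0 s.
    have [|z zi zE] := @IVT_cts _ eta' th0 s 0 h ce'; first by right; rewrite (ltW es) ltW.
    have := arc_eta'_neq0 _ (flat z ltac:(olra)); by rewrite zE eqxx.
  have [|z zi zE] := @IVT_cts _ eta' s th0 0 (ltW h) ce'; first by left; rewrite (ltW es) ltW.
  have := arc_eta'_neq0 _ (flat z ltac:(olra)); by rewrite zE eqxx.
have incr lo hi s t : (forall x, lo <= x <= hi -> 0 < eta' x) -> lo <= s -> s < t -> t <= hi ->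
    eta s < eta t.
  move=> e0 los st thi; have [z zi zE] := MVT_oo st (fun z _ => (dlift z).2).
  by rewrite -subr_gt0 zE mulr_gt0 ?subr_gt0//; apply: e0; olra.
have incrW lo hi s t : (forall x, lo <= x <= hi -> 0 < eta' x) -> lo <= s -> s <= t -> t <= hi ->
    eta s <= eta t.
  move=> e0 los; rewrite le_eqVlt => /orP[/eqP -> //|st] thi.
  by apply: ltW; exact: (incr lo hi).
have eab : eta a <= eta b by apply: (incrW a b).
(* A flat piece sweeping 2 pi would revisit a point of the curve in less than a period. *)
have eba : eta b - eta a < 2 * pi.
  rewrite ltNge; apply/negP => h.
  have [|s si sE] := @IVT_cts _ eta a b (eta a + 2 * pi) ab arc_ce; first by left; olra.
  have gs : g s = g a.
    have [_ ->] := lift s; have [_ ->] := lift a; rewrite (flat s)// (flat a) ?lexx//.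
    by rewrite sE -[2 * pi]mul1r -[X in X * (2 * pi)](mulr1z 1) ell_point_period.
  have [k kE] := ginj _ _ gs.
  have sa : s = a.
    apply: (int_small pi2 (_ : _ = _ + k%:~R * (2 * pi))); first by clear -kE; lra.
    by rewrite ger0_norm; olra.
  by move: sE pi2; rewrite sa; lra.
have cphi (t : R) : continuous_at t (fun s => ka * eta' s - `|y' s|).
  apply: cD; first by apply: cM; [exact: ccst|exact: ce'].
  apply: cN; apply: (@ccomp _ _ _ (fun x : R => `|x|) y'); [exact: norm_continuous|exact: cy'].
have [|r1 r10 Hr1] := thicken ab cphi.
  by move=> t ti; rewrite arc_crit ?flat// normr0 subr0 mulr_gt0// ep.
have cpsi (t : R) : continuous_at t (fun s => 2 * pi - (eta (b + s) - eta (a - s))).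
  have ce1 : continuous_at t (fun s => eta (b + s)).
    by apply: (@ccomp _ _ _ eta (fun s => b + s)); [exact: arc_ce|cauto].
  have ce2 : continuous_at t (fun s => eta (a - s)).
    by apply: (@ccomp _ _ _ eta (fun s => a - s)); [exact: arc_ce|cauto].
  cauto.
have [|r2 r20 Hr2] := thicken (lexx 0) cpsi.
  by move=> t ti; have -> : t = 0 by [olra]; rewrite addr0 subr0; olra.
have [r [r0 [rr1 rr2] rr3]] : exists r, [/\ 0 < r, 2 * r <= r1 /\ r <= r2 & 3 * r < 2 * pi - (b - a)].
  have h1 : Num.min r1 (Num.min r2 ((2 * pi - (b - a)) / 3)) <= r1 by rewrite ge_min lexx.
  have h2 : Num.min r1 (Num.min r2 ((2 * pi - (b - a)) / 3)) <= r2 by rewrite !ge_min lexx orbT.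
  have h3 : Num.min r1 (Num.min r2 ((2 * pi - (b - a)) / 3)) <= (2 * pi - (b - a)) / 3.
    by rewrite !ge_min lexx !orbT.
  have h4 : 0 < Num.min r1 (Num.min r2 ((2 * pi - (b - a)) / 3)).
    by rewrite !lt_min r10 r20 /=; olra.
  by exists (Num.min r1 (Num.min r2 ((2 * pi - (b - a)) / 3)) / 2); split; [|split|]; clear -ba h1 h2 h3 h4 r20; lra.
have kap s : a - r1 <= s <= b + r1 -> `|y' s| < ka * eta' s.
  by move=> /Hr1; rewrite subr_gt0.
have ep1 s : a - r1 <= s <= b + r1 -> 0 < eta' s.
  by move=> /kap h; rewrite -(pmulr_rgt0 _ ka0); apply: le_lt_trans h.
have elen : eta (b + r) - eta (a - r) < 2 * pi.
  by have := Hr2 r ltac:(clear -r0 rr2; lra); olra.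
have ea : eta (a - r) < eta a by apply: (incr (a - r1) (b + r1)) => //; clear -abi r0 r10 rr1; lra.
have eb : eta b < eta (b + r) by apply: (incr (a - r1) (b + r1)) => //; clear -abi r0 r10 rr1; lra.
have [l lE] : exists l, (eta b - eta a) / 2 <= l <= (eta b - eta a) / 2.
  by exists ((eta b - eta a) / 2); rewrite lexx.
have [ec ecE] : exists l, (eta a + eta b) / 2 <= l <= (eta a + eta b) / 2.
  by exists ((eta a + eta b) / 2); rewrite lexx.
have lpi : 0 <= l <= pi by clear -eab eba lE; lra.
(* [phi s] is small only if the level is close to [ym] and the angle, modulo 2 pi, close to the flat
   range, of centre [ec] and half-length [l]. Its minimum over the rest of the period is positive
   and isolates the arc from the remainder of the curve. *)
pose phi s := Num.max (y s - ym) (cos l - cos (eta s - ec)).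
have cphi2 (t : R) : continuous_at t phi.
  have cy0 := arc_cy t; have ce0 := arc_ce t.
  by rewrite /phi; apply: cmax; cauto.
have phi0 s : b + r <= s <= a - r + 2 * pi -> 0 < phi s.
  move=> si; rewrite ltNge ge_max; apply/negP => /andP[h1 h2].
  have ys : y s = ym by apply: le_anti; rewrite ymin andbT; clear -h1; lra.
  have h3 : cos l <= cos (eta s - ec) by clear -h2; lra.
  have [k] := cos_ge_mod lpi h3; rewrite ler_norml => hk.
  have [|z zi zE] := @IVT_cts _ eta a b (eta s - k%:~R * (2 * pi)) ab arc_ce.
    by left; clear -ecE hk lE; lra.
  have gs : g s = g z.
    have [_ ->] := lift s; have [_ ->] := lift z; rewrite ys (flat z zi) zE.
    by rewrite -mulNr -mulrNz ell_point_period.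
  have [j jE] := ginj _ _ gs.
  have sz : s = z.
    by apply: (int_small pi2 (_ : _ = _ + j%:~R * (2 * pi))); [clear -jE; clear -jE; lra|rewrite ger0_norm; clear -r0 si zi; lra].
  by move: si zi; rewrite sz => si zi; clear -r0 si zi; lra.
have [z0 z0i Hz0] : exists2 z0, z0 \in `[b + r, a - r + 2 * pi] & forall t,
    t \in `[b + r, a - r + 2 * pi] -> phi z0 <= phi t.
  by apply: EVT_min; [clear -ba rr3; lra|exact: continuous_subspaceT].
rewrite in_itv/= in z0i.
have [D D0 KD] : exists2 D, 0 < D & forall s, b + r <= s <= a - r + 2 * pi -> D <= phi s.
  exists (phi z0); first exact: phi0.
  by move=> s si; apply: Hz0; rewrite in_itv.
clear z0 z0i Hz0 phi0 cphi2.
(* The cosine being 1-Lipschitz, sg <= D / 2 keeps the angular term of [phi] below [D] over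
   [al, be]; ka * sg <= D / 2 keeps the arc between [e1] and [e2] below ym + D. *)
have [sg [[sg1 sg2] sg3 sg4 sg0]] : exists sg, [/\ sg <= eta a - eta (a - r) /\ sg <= eta (b + r) - eta b,
    sg <= D / 2, ka * sg <= D / 2 & 0 < sg].
  exists (Num.min (Num.min (eta a - eta (a - r)) (eta (b + r) - eta b)) (Num.min (D / 2) (D / 2 / ka))).
  split.
  - by rewrite !ge_min !lexx ?orbT.
  - by rewrite !ge_min lexx !orbT.
  - by rewrite mulrC -ler_pdivlMr// !ge_min lexx !orbT.
  - by rewrite !lt_min !divr_gt0// !andbT; clear -ea eb; lra.
have [al alE] : exists l, eta a - sg <= l <= eta a - sg by exists (eta a - sg); rewrite lexx.
have [be beE] : exists l, eta b + sg <= l <= eta b + sg by exists (eta b + sg); rewrite lexx.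
have be_al : be < al + 2 * pi by clear -alE beE elen sg1 sg2; lra.
have [u [u' [e1 [e2 [[e1i e2i e1n e2p] [cu cu' du ub] uc yu ulow]]]]] :=
  arc_slope dlift cy' ce' ymin ab r0 rr1 ka0 kap flat nb na sg0 sg1 sg2.
clear incr.
exists al, e1, e2, be, D, u, u'; split => //.
- by split=> //; clear -alE beE e1i e2i eab; lra.
- by move=> t ti; apply: du; clear -alE beE ti; lra.
- move=> t ti; have [|s [e'0 <- -> ->]] := uc t; first by clear -alE beE ti; lra.
  have [y0 gE] := lift s.
  exists s, (half_dist c1 c2 ^+ 2 * (chx (y s) ^+ 2 - cos (eta s) ^+ 2) * eta' s); split.
  + rewrite gt_eqF// mulr_gt0// mulr_gt0 ?ell_disc_gt0// exprn_gt0//; exact: half_dist_gt0.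
  + exact: gE.
  + rewrite arc_derive !ell_vel_lin; congr (ell_vel c1 c2 _ _ _ _).
      by field; rewrite !gt_eqF ?rt_gt0.
    by rewrite mulr1.
- move=> th y1 t ti yi gE.
  have [k [ki kE]] := arc_reduce (a - r) th.
  set s := th - _ in ki kE.
  have [ys gs] := lift s.
  have [] := ell_point_inj c12 ys (_ : 0 < y1) (_ : ell_point c1 c2 (y s) (eta s) = ell_point c1 c2 y1 t).
  - by clear -yi; lra.
  - by rewrite -gs kE gE.
  move=> yE [j jE].
  have [h|h] := leP (b + r) s.
    have /KD : b + r <= s <= a - r + 2 * pi by clear -h ki; lra.
    rewrite leNgt => /negP; case.
    rewrite /phi gt_max yE; apply/andP; split; first by clear -yi; lra.
    have [z zi zt] : exists2 z, eta a <= z <= eta b & `|z - t| <= sg.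
      clear h.
      have [h1|h1] := leP (eta b) t.
        by exists (eta b); rewrite ?ler_norml ?lexx ?andbT//; clear -beE h1 ti; lra.
      have [h2|h2] := leP (eta a) t.
        by exists t; rewrite ?subrr ?normr0 ?h2 ?(ltW h1) ?(ltW sg0).
      by exists (eta a); rewrite ?ler_norml ?lexx ?eab//; clear -alE h2 ti; lra.
    have cz : cos l <= cos (z - ec).
      have zl : `|z - ec| <= l by rewrite ler_norml; clear -ecE lE zi; lra.
      rewrite -[cos (z - ec)]cos_norm leNgt ltr_cos ?in_itv/= -?leNgt//.
      by rewrite normr_ge0 (le_trans zl)//; case/andP: lpi.
    have := cos_lipschitz (z - ec) (t - ec).
    have -> : z - ec - (t - ec) = z - t by ring.
    move=> hh.
    have -> : cos (eta s - ec) = cos (t - ec) by rewrite jE addrAC cosD_int.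
    have := ler_norm (cos (z - ec) - cos (t - ec)); clear -D0 cz hh sg3 zt; lra.
  have si : a - r <= s <= b + r by clear -h ki; lra.
  have esi : eta (a - r) <= eta s <= eta (b + r).
    by move: si => /andP[s1 s2]; apply/andP; split; apply: (incrW (a - r1) (b + r1)) => //;
      clear -s1 s2 r0 rr1 ab; clear -r0 rr1 s1 s2; lra.
  have tl : eta (a - r) <= t <= eta (b + r) by clear -alE beE sg1 sg2 ti; lra.
  have et : eta s = t.
    by apply: (int_small pi2 jE); rewrite ltr_norml; clear -alE beE elen esi sg1 sg2 ti; lra.
  by rewrite -yE yu ?et//; clear -alE beE ti; lra.
have dsg : 0 < ka * sg by rewrite mulr_gt0.
move=> t ti; have ut := ulow t ti; split; first by clear -D0 sg4 ut; lra.
    have : 0 < ka * (t - al - sg / 2) by rewrite mulr_gt0//; clear -alE e1i ti; lra.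
    clear -dsg ut; lra.
  have : 0 < ka * (be - t - sg / 2) by rewrite mulr_gt0//; clear -beE e2i ti; lra.
  clear -dsg ut; lra.
Unshelve. all: by end_near. Qed.

Lemma derive1_opp (R : realType) (g : R -> R * R) (t : R) : derivable g (- t) 1 ->
  derive1 (fun s => g (- s)) t = - derive1 g (- t).
Proof.
move=> /derivable_is_derive dg.
have := is_derive_pair (dcomp (is_derive_fst dg) (dN (did t)))
  (dcomp (is_derive_snd dg) (dN (did t))).
rewrite !mulrN1 => H; apply: is_derive_derive1.
have -> : (fun s => g (- s)) = fun s => ((g (- s)).1, (g (- s)).2).
  by apply/funext => s; case: (g (- s)).
exact: H.
Qed.

Lemma graph_arc_opp (R : realType) (c1 c2 : R * R) (g : R -> R * R)
    (ym ka al e1 e2 be de : R) (u u' : R -> R) :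
  (forall t, derivable g t 1) ->
  graph_arc c1 c2 (fun t => g (- t)) ym ka al e1 e2 be de u u' ->
  graph_arc c1 c2 g ym ka al e1 e2 be de u u'.
Proof.
move=> dg [ord d0 cu cu' du bd cv onl lw ng ps].
split; [exact: ord|exact: d0|exact: cu|exact: cu'|exact: du|exact: bd| | |exact: lw|
  exact: ng|exact: ps].
- move=> t /cv[th [la [la0 gE dE]]]; exists (- th), (- la).
  split => //; first by rewrite oppr_eq0.
  rewrite scaleNr -dE.
  by rewrite derive1_opp ?opprK.
- by move=> th y t ti yi gE; apply: (onl (- th) y t ti yi); rewrite opprK.
Qed.

(** The level [ym] precedes [ka] because the admissible slopes are dictated by constants computed
    from [ym]. *)
Lemma boundary_arc (R : realType) (c1 c2 : R * R) (g : R -> R * R) (C : set (R * R)) :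
  c1 <> c2 -> regular_C1_loop g C -> (forall t, ~ segment c1 c2 (g t)) ->
  ~ (exists2 L : R, enorm (c1 - c2) < L & C = ellipse c1 c2 L) ->
  exists ym, [/\ 0 < ym,
    forall th, exists y eta, ym <= y /\ g th = ell_point c1 c2 y eta &
    forall ka, 0 < ka -> exists al e1 e2 be de u u',
      graph_arc c1 c2 g ym ka al e1 e2 be de u u'].
Proof.
move=> c12 [per dg cg inj <-] nseg notell.
have [y [eta [y' [eta' [lift dlift cy' ce']]]]] :=
  elliptic_lift c12 (fun t => (dg t).1) cg nseg.
have cy (t : R) : continuous_at t y by exact: (arc_cy dlift).
have pi2 := two_pi_gt0 R.
have [th0 th0i Hth0] : exists2 c, c \in `[0, 2 * pi] & forall t,
    t \in `[0, 2 * pi] -> y c <= y t.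
  by apply: EVT_min; [exact: ltW|exact: continuous_subspaceT].
have ymin t : y th0 <= y t.
  have [k [ki kE]] := arc_reduce per 0 t.
  have [<- _] := arc_same c12 lift kE.
  by apply: Hth0; rewrite in_itv/=; move: ki; rewrite add0r => /andP[-> /ltW ->].
exists (y th0); split.
- by case: (lift th0).
- by move=> th; exists (y th), (eta th); case: (lift th).
move=> ka ka0.
have greg t : derive1 g t != 0 by case: (dg t).
have e0 := arc_eta'_neq0 c12 lift dlift greg ymin (erefl (y th0)).
(* If eta decreases at the lowest point, the curve is run backwards; being a [graph_arc] does not
   depend on the orientation. *)
have [ep|en] := ltP 0 (eta' th0).
  exact: (arc_graph c12 per inj lift dlift cy' ce' greg ymin ep notell ka0).
have {}en : eta' th0 < 0 by rewrite lt_neqAle e0.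
have dlN (t : R) : is_derive t 1 (fun s => y (- s)) (- y' (- t)) /\
    is_derive t 1 (fun s => eta (- s)) (- eta' (- t)).
  have [d1 d2] := dlift (- t).
  by split; (apply: deq; first exact: (dcomp _ (dN (did t)))); rewrite mulrN1.
have ccN (f : R -> R) : (forall t : R, continuous_at t f) -> forall t : R,
    continuous_at t (fun s => - f (- s)).
  by move=> cf t; apply: cN; apply: (@ccomp _ _ _ f (fun s => - s)); [exact: cf|cauto].
have dgN (t : R) : derive1 (fun s => g (- s)) t = - derive1 g (- t).
  by rewrite derive1_opp//; case: (dg (- t)).
have [||||||al [e1 [e2 [be [de [u [u' H]]]]]]] :=
  @arc_graph R c1 c2 (fun s => g (- s)) (fun s => y (- s)) (fun s => eta (- s))
    _ _ (- th0) ka c12 _ _ (fun t => lift (- t)) dlN (ccN _ cy') (ccN _ ce') _ _ _ _ ka0.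
- move=> s; rewrite -[LHS]per; congr (g _); ring.
- move=> s t /inj[k kE]; exists (- k); rewrite mulrNz; lra.
- by move=> t; rewrite dgN oppr_eq0; case: (dg (- t)).
- by move=> t; rewrite opprK.
- by rewrite opprK oppr_gt0.
- move=> [L Lc rE]; apply: notell; exists L => //; rewrite -rE.
  apply/seteqP; split => [_ [t _ <-]|_ [t _ <-]]; exists (- t) => //.
  by rewrite opprK.
exists al, e1, e2, be, de, u, u'; rewrite opprK in H.
exact: (graph_arc_opp (fun t => (dg t).1) H).
Qed.

(** * Symbolic dynamics of stretching maps *)

Lemma continuous_into_prod_discrete (T : topologicalType) (S : choiceType)
    (f : T -> full_shift_space S) (A : set T) :
  (forall x k, A x -> \forall y \near x, A y -> f y k = f x k) ->
  {within A, continuous f}.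
Proof.
move=> H; apply/subspace_continuousP => x Ax; apply/cvg_sup => k.
move=> U [V [[W oW WV] Vx VU]].
rewrite /nbhs /= /within /=.
have := H x k Ax; apply: filterS => y Hy Ay; apply: VU; rewrite -WV /=.
by move: Vx; rewrite -WV => Wx; change (W (f y k)); rewrite (Hy Ay).
Qed.

Lemma compact_prod_cluster (R : realType) (X : topologicalType) (A : int -> set X)
    (C : nat -> set (prod_topology (fun _ : int => X))) (z : nat -> int -> X) :
  (forall k, compact (A k)) -> (forall n, closed (C n)) ->
  (forall n k, A k (z n k)) -> (forall n m, (n <= m)%N -> C n (z m)) ->
  exists2 z : int -> X, (forall k, A k (z k)) & forall n, C n z.
Proof.
move=> cA cC zA zC.
have cK := @tychonoff int (fun=> X) A cA.
have [|w [wA wc]] := cK (z @ \oo) _ _.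
  by exists 0%N => // n _ k; exact: zA.
exists w => // n; apply: cC => U Uw.
by apply: wc => //; exists n => // m nm; exact: zC.
Qed.

Section symbolic.
Variables (R : realType) (e1 e2 E0 : R) (lo hi : nat -> R).
Variables (F G : nat -> R * R -> R * R) (rho : R * R -> R).
Hypothesis e12 : e1 < e2.
Hypothesis lohi : forall j, 0 < lo j /\ lo j < hi j < E0.
Hypothesis dec : forall j, hi j.+1 < lo j.
Hypothesis cF : forall j, continuous (F j).
Hypothesis F1 : forall j z, e1 <= (F j z).1 <= e2.
Hypothesis Flo : forall j z, e1 <= z.1 <= e2 -> z.2 <= lo j -> E0 <= (F j z).2.
Hypothesis Fhi : forall j z, e1 <= z.1 <= e2 -> hi j <= z.2 -> (F j z).2 <= 0.
Hypothesis cG : forall j, continuous (G j).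
Hypothesis crho : continuous rho.
Hypothesis FG : forall j z, e1 <= z.1 <= e2 -> lo j <= z.2 <= hi j ->
  0 < (F j z).2 < E0 -> z.2 = rho (F j z) /\ z = G j (F j z).

(** The map applied depends on the current symbol, because each window has its own number of
    turns. *)
Definition sym_orbit (s : int -> nat) (z : int -> R * R) : Prop :=
  forall k, [/\ e1 <= (z k).1 <= e2, lo (s k) <= (z k).2 <= hi (s k) &
    F (s k) (z k) = z (k + 1)].

Lemma win_anti i j : (i < j)%N -> hi j < lo i.
Proof.
elim: j => // j IH; rewrite ltnS leq_eqVlt => /orP[/eqP -> //|/IH h].
by have := dec j; have := lohi j; lra.
Qed.

(** The windows accumulate at 0 only, which belongs to none of them, so each one is at a positive
    distance from all the others. *)
Lemma win_isolated j x : lo j <= x <= hi j -> exists2 d, 0 < d &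
  forall x' i, `|x' - x| < d -> lo i <= x' <= hi i -> i = j.
Proof.
move=> xj.
have lo_anti i i' : (i <= i')%N -> lo i' <= lo i.
  rewrite leq_eqVlt => /orP[/eqP -> //|/win_anti].
  by have := lohi i'; lra.
have hi_anti i i' : (i <= i')%N -> hi i' <= hi i.
  rewrite leq_eqVlt => /orP[/eqP -> //|/win_anti].
  by have := lohi i; lra.
have [d d0 Hd] : exists2 d, 0 < d & forall i, (i < j)%N -> hi j + d <= lo i.
  case: j xj => [|j] xj; first by exists 1.
  exists (lo j - hi j.+1); first by rewrite subr_gt0.
  by move=> i ij; have := lo_anti i j ij; lra.
have d1 : 0 < lo j - hi j.+1 by rewrite subr_gt0.
exists (Num.min d (lo j - hi j.+1)); first by rewrite lt_min d0.
move=> x' i; rewrite lt_min => /andP[h1 h2] xi.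
have [ij|ji|//] := ltngtP i j; exfalso.
  have := Hd i ij; have := ler_norm (x' - x); lra.
have := hi_anti j.+1 i ji; have := ler_norm (- (x' - x)); rewrite normrN; lra.
Qed.

(** A one-parameter family of initial states, of angle [e1]: crossing windows concerns the second
    coordinate only, so one parameter is enough. *)
Definition sym_path (s : nat -> nat) (E : R) (k : nat) : R * R :=
  nat_rect (fun=> (R * R)%type) (e1, E) (fun k z => F (s k) z) k.

Lemma sym_path1 s E k : e1 <= (sym_path s E k).1 <= e2.
Proof. by case: k => [|k] /=; [rewrite lexx ltW|exact: F1]. Qed.

Lemma sym_path_continuous s k : continuous (sym_path s ^~ k).
Proof.
elim: k => [|k IH] E /=.
  by apply: cpair; [exact: ccst|exact: cidt].
by apply: (@ccomp _ _ _ (F (s k))); [exact: cF|exact: IH].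
Qed.

(** Each step exchanges the sides: a value at or below its window goes above every window, one at or
    above it goes below all. Hence the ends of the first window are still on opposite sides at time
    N, and a state outside its window never enters one later. Reaching the middle of the last window
    therefore forces the whole itinerary. *)
Lemma sym_path_chain s N : exists z : nat -> R * R,
  (forall k, (k <= N)%N -> e1 <= (z k).1 <= e2 /\ lo (s k) <= (z k).2 <= hi (s k)) /\
  forall k, (k < N)%N -> F (s k) (z k) = z k.+1.
Proof.
pose P E k := (sym_path s E k).2.
have low E k : P E k <= lo (s k) -> hi (s k.+1) <= P E k.+1.
  move=> /(Flo (sym_path1 s E k)); rewrite /P /=.
  by have := lohi (s k.+1); lra.
have high E k : hi (s k) <= P E k -> P E k.+1 <= lo (s k.+1).
  move=> /(Fhi (sym_path1 s E k)); rewrite /P /=.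
  by have := lohi (s k.+1); lra.
have opp k : (P (lo (s 0%N)) k <= lo (s k) /\ hi (s k) <= P (hi (s 0%N)) k) \/
    (hi (s k) <= P (lo (s 0%N)) k /\ P (hi (s 0%N)) k <= lo (s k)).
  elim: k => [|k [[h1 h2]|[h1 h2]]]; first by left.
    by right; split; [exact: low|exact: high].
  by left; split; [exact: high|exact: low].
have lh j : lo j < hi j by have := lohi j; lra.
have [|||E Ei EN] := @IVT_cts R (P^~ N) (lo (s 0%N)) (hi (s 0%N)) ((lo (s N) + hi (s N)) / 2).
- by rewrite ltW.
- by move=> E; apply: csnd; exact: sym_path_continuous.
- by have := lh (s N); case: (opp N) => [[? ?]|[? ?]] ?; [left|right]; lra.
have gen k : (k <= N)%N -> lo (s k) < P E k < hi (s k).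
  move=> kN; rewrite !ltNge; apply: contrapT => /negP; rewrite negb_and !negbK => out.
  have prop m : (P E (k + m)%N <= lo (s (k + m)%N)) || (hi (s (k + m)%N) <= P E (k + m)%N).
    elim: m => [|m IH]; first by rewrite addn0.
    by rewrite addnS; case/orP: IH => [/low ->|/high ->]; rewrite ?orbT.
  by have := prop (N - k)%N; rewrite subnKC// EN; have := lh (s N); lra.
exists (sym_path s E); split => // k kN; split; first exact: sym_path1.
by have := gen k kN; rewrite /P; lra.
Qed.

Lemma closed_step j (k : int) : closed
  [set z : prod_topology (fun _ : int => (R * R)%type) | F j (z k) = z (k + 1)].
Proof.
pose T := prod_topology (fun _ : int => (R * R)%type).
have cp (i : int) (z : T) : continuous_at z (fun z : T => z i).
  exact: (@proj_continuous int (fun=> (R * R)%type) i z).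
pose f (z : T) : R := `|(F j (z k)).1 - (z (k + 1)).1| + `|(F j (z k)).2 - (z (k + 1)).2|.
have cf (z : T) : continuous_at z f.
  have cFz : continuous_at z (fun z : T => F j (z k)).
    by apply: (@ccomp _ _ _ (F j)); [exact: cF|exact: cp].
  have cn (g : T -> R) : continuous_at z g -> continuous_at z (fun z => `|g z|).
    by move=> cg; apply: (@ccomp _ _ _ (fun x : R => `|x|) g); [exact: norm_continuous|].
  apply: cD; apply: cn; apply: cD; [exact: cfst|apply: cN; apply: cfst; exact: cp|
    exact: csnd|apply: cN; apply: csnd; exact: cp].
rewrite (_ : [set z | _] = f @^-1` [set x | x = 0]).
  by apply: preimage_closed; [move=> z _; exact: cf|exact: closed_eq].
apply/seteqP; split => z /=; rewrite /f.
  by move=> ->; rewrite !subrr !normr0 addr0.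
move/eqP; rewrite paddr_eq0// !normr_eq0 !subr_eq0 => /andP[/eqP h1 /eqP h2].
by rewrite [LHS]surjective_pairing h1 h2 -surjective_pairing.
Qed.

Definition sym_box (j : nat) : set (R * R) := `[e1, e2] `*` `[lo j, hi j].

Lemma sym_boxE j z : sym_box j z <-> (e1 <= z.1 <= e2 /\ lo j <= z.2 <= hi j).
Proof. by rewrite /sym_box /= !in_itv. Qed.

Lemma compact_sym_box j : compact (sym_box j).
Proof. by apply: compact_setX; exact: segment_compact. Qed.

Lemma sym_orbit_exists s : exists z, sym_orbit s z.
Proof.
have H n : exists z : int -> R * R, (forall k, sym_box (s k) (z k)) /\
    forall k : int, - n%:Z <= k < n%:Z -> F (s k) (z k) = z (k + 1).
  have [z [z1 z2]] := sym_path_chain (fun i => s (i%:Z - n%:Z)) (n + n).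
  (* Outside [-n, n] any point of the box will do: the step relation is asked for -n <= k < n only,
     where both members come from the finite path. *)
  pose w (k : int) := if (- n%:Z <= k <= n%:Z) then z (absz (k + n%:Z)) else (e1, lo (s k)).
  have az (k : int) : - n%:Z <= k -> (absz (k + n%:Z))%:Z = k + n%:Z.
    by move=> h; rewrite gez0_abs//; lia.
  exists w; split => [k|k kn].
    apply/sym_boxE; rewrite /w; case: ifP => kn.
      have [|h1 h2] := z1 (absz (k + n%:Z)); first by lia.
      by rewrite h1; move: h2; rewrite az ?addrK//; lia.
    by rewrite /= !lexx; have := lohi (s k); have := e12; split; lra.
  rewrite /w ifT; last by lia.
  rewrite ifT; last by lia.
  have -> : absz (k + 1 + n%:Z) = (absz (k + n%:Z)).+1 by lia.
  rewrite -z2; last by lia.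
  by congr (F (s _) _); rewrite az ?addrK//; lia.
have [z Hz] := choice H.
have [||w wA wC] := @compact_prod_cluster R _ (fun k => sym_box (s k))
  (fun n => [set z | forall k : int, - n%:Z <= k < n%:Z -> F (s k) (z k) = z (k + 1)]) z
  (fun k => @compact_sym_box (s k)) _ (fun n => (Hz n).1) _.
- move=> n; rewrite (_ : [set z | _] = \bigcap_(k in [set k : int | - n%:Z <= k < n%:Z])
      [set z | F (s k) (z k) = z (k + 1)]); last by [].
  by apply: closed_bigI => k _; exact: closed_step.
- by move=> n m nm k kn; apply: (Hz m).2; lia.
exists w => k; have /sym_boxE[h1 h2] := wA k; split => //.
by apply: (wC (absz k).+1); lia.
Qed.

(** Induction on k away from 0. Forwards, isolation of the windows makes the symbol locally
    constant, so one fixed [F] gives the next state. Backwards, [rho] yields the previous value of E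
    without knowledge of the symbol; it determines the symbol, and then the right [G] gives the
    previous state. *)
Lemma sym_orbit_continuous s z : sym_orbit s z -> forall k : int,
  (forall U, nbhs (z k) U -> \forall x \near z 0, forall s' z', sym_orbit s' z' ->
     z' 0 = x -> U (z' k)) /\
  (\forall x \near z 0, forall s' z', sym_orbit s' z' -> z' 0 = x -> s' k = s k).
Proof.
move=> oz.
pose near_k (k : int) := forall U, nbhs (z k) U -> \forall x \near z 0, forall s' z',
  sym_orbit s' z' -> z' 0 = x -> U (z' k).
have symb (f : R * R -> R) (k l : int) : continuous f -> f (z k) = (z l).2 ->
    (forall s' z', sym_orbit s' z' -> f (z' k) = (z' l).2) -> near_k k ->
    \forall x \near z 0, forall s' z', sym_orbit s' z' -> z' 0 = x -> s' l = s l.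
  move=> cf fz f' nk; have [_ zs _] := oz l.
  have [d d0 Hd] := win_isolated zs.
  have := nk (fun w => `|f (z k) - f w| < d) _.
  move=> /(_ (@cvgr_dist_lt _ _ _ _ _ _ _ (cf (z k)) _ d0)).
  apply: filterS => x Hx s' z' o' zx; have [_ zs' _] := o' l.
  by apply: (Hd (z' l).2) => //; have := Hx _ _ o' zx; rewrite fz (f' _ _ o') distrC.
have sym_of (k : int) : near_k k -> \forall x \near z 0, forall s' z', sym_orbit s' z' ->
    z' 0 = x -> s' k = s k.
  by move=> nk; apply: (symb snd k k) => //; move=> p; exact: csnd0.
have step (k : int) : near_k k -> near_k (k + 1).
  move=> nk U Uz; have [_ _ Fz] := oz k.
  have FU : nbhs (z k) (F (s k) @^-1` U) by apply: cF; rewrite Fz.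
  near=> x => s' z' o' zx; have [_ _ <-] := o' k.
  have -> : s' k = s k by move: s' z' o' zx; near: x; exact: sym_of.
  by move: s' z' o' zx; near: x; exact: (nk _ FU).
have back s' z' (k : int) : sym_orbit s' z' ->
    (z' (k - 1)).2 = rho (z' k) /\ z' (k - 1) = G (s' (k - 1)) (z' k).
  move=> o'; have [h1 h2 Fz] := o' (k - 1); rewrite subrK in Fz.
  rewrite -Fz; apply: FG => //; rewrite Fz.
  by have [_ + _] := o' k; have := lohi (s' k); lra.
have stepN (k : int) : near_k k -> near_k (k - 1).
  move=> nk U Uz; have [h1 h2] := back s z k oz.
  have GU : nbhs (z k) (G (s (k - 1)) @^-1` U) by apply: cG; rewrite -h2.
  have sk := symb rho k (k - 1) crho (esym h1) (fun s' z' o' => esym (back s' z' k o').1) nk.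
  near=> x => s' z' o' zx; have [_ ->] := back s' z' k o'.
  have -> : s' (k - 1) = s (k - 1) by move: s' z' o' zx; near: x; exact: sk.
  by move: s' z' o' zx; near: x; exact: (nk _ GU).
have all (k : int) : near_k k.
  elim/int_ind: k => [|k IH|k IH].
  - by move=> U Uz; apply: filterS Uz => x Ux s' z' _ ->.
  - by have := step _ IH; rewrite -PoszD addn1.
  - by have := stepN _ IH; rewrite -opprD -PoszD addn1.
by move=> k; split; [exact: all|apply: sym_of; exact: all].
Unshelve. all: by end_near. Qed.

Lemma sym_orbit_uniq s z s' z' : sym_orbit s z -> sym_orbit s' z' -> z 0 = z' 0 ->
  s = s'.
Proof.
move=> oz oz' E; apply/funext => k.
have [_ H] := sym_orbit_continuous oz' k.
by apply: (nbhs_singleton H) oz _.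
Qed.

(** * From pairs (eta, E) to the phase space of the billiard *)

Section coding.
Local Notation W := ((R * R) * (R * R))%type.
Variables (D : set W) (B : W -> W) (Z : R * R -> W).
Hypothesis cZ : continuous Z.
Hypothesis Zinj : forall p q, e1 <= p.1 <= e2 -> 0 <= p.2 <= E0 ->
  e1 <= q.1 <= e2 -> 0 <= q.2 <= E0 -> Z p = Z q -> p = q.
Hypothesis Zstep : forall j z, e1 <= z.1 <= e2 -> lo j <= z.2 <= hi j ->
  0 < (F j z).2 < E0 -> D (Z z) /\ B (Z z) = Z (F j z).

Lemma sym_orbit_in s z k : sym_orbit s z -> e1 <= (z k).1 <= e2 /\ 0 <= (z k).2 <= E0.
Proof. by move=> /(_ k)[h1 h2 _]; split => //; have := lohi (s k); lra. Qed.

Lemma sym_orbit_step s z k : sym_orbit s z -> D (Z (z k)) /\ B (Z (z k)) = Z (z (k + 1)).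
Proof.
move=> oz; have [h1 h2 h3] := oz k; rewrite -h3; apply: Zstep => //.
by rewrite h3; have [_ + _] := oz (k + 1); have := lohi (s (k + 1)); lra.
Qed.

Lemma sym_orbit_shift s z (l : int) : sym_orbit s z ->
  sym_orbit (fun k => s (k + l)) (fun k => z (k + l)).
Proof. by move=> oz k; have [h1 h2 h3] := oz (k + l); split => //; rewrite h3 addrAC. Qed.

Lemma sym_orbit_code s z s' z' : sym_orbit s z -> sym_orbit s' z' ->
  Z (z 0) = Z (z' 0) -> s = s'.
Proof.
move=> oz oz' E; apply: (sym_orbit_uniq oz oz').
have [h1 h2] := sym_orbit_in 0 oz; have [h3 h4] := sym_orbit_in 0 oz'.
exact: Zinj.
Qed.

(** The predicate restricts the itineraries: all of them for the full shift, those with symbols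
    below M for the compact subsystems. *)
Definition sym_set (P : (int -> nat) -> Prop) : set W :=
  [set w | exists s z, [/\ sym_orbit s z, P s & w = Z (z 0)]].

Lemma sym_set_invariant P : (forall s (l : int), P s -> P (fun k => s (k + l))) ->
  invariant_set D B (sym_set P).
Proof.
move=> Psh; split; first by move=> _ [s [z [oz _ ->]]]; case: (sym_orbit_step 0 oz).
apply/seteqP; split => [_ [_ [s [z [oz Ps ->]]] <-]|_ [s [z [oz Ps ->]]]].
  exists (fun k => s (k + 1)), (fun k => z (k + 1)); split; [exact: sym_orbit_shift|exact: Psh|].
  by rewrite (sym_orbit_step 0 oz).2.
exists (Z (z (-1))); last by rewrite (sym_orbit_step (-1) oz).2.
exists (fun k => s (k - 1)), (fun k => z (k - 1)); split; [exact: sym_orbit_shift|exact: Psh|].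
by [].
Qed.

(** The part of [K] outside the interior of [N] has a compact, hence closed, image, which misses
    [Z x] by injectivity. *)
Lemma continuous_inverse_near (K : set (R * R)) x N : compact K -> {in K &, injective Z} ->
  K x -> nbhs x N -> \forall w \near Z x, forall x', K x' -> Z x' = w -> N x'.
Proof.
move=> cK inj Kx Nx.
have cC : compact (K `&` ~` N^°).
  by apply: compact_closedI => //; apply: open_closedC; exact: open_interior.
have cI : compact (Z @` (K `&` ~` N^°)).
  by apply: continuous_compact => //; exact: continuous_subspaceT.
have hW : hausdorff_space W by exact: norm_hausdorff.
have oI : open (~` (Z @` (K `&` ~` N^°))).
  by apply: closed_openC; exact: compact_closed.
have : nbhs (Z x) (~` (Z @` (K `&` ~` N^°))).
  apply: open_nbhs_nbhs; split => // -[x' [Kx' Nx'] E]; apply: Nx'.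
  by have -> : x' = x by apply: inj; rewrite ?inE.
apply: filterS => w Hw x' Kx' E; apply: contrapT => nN; apply: Hw.
by exists x' => //; split => // /interior_subset.
Qed.

Let K : set (R * R) := `[e1, e2] `*` `[0, E0].

Let KE z : K z <-> (e1 <= z.1 <= e2 /\ 0 <= z.2 <= E0).
Proof. by rewrite /K /= !in_itv. Qed.

Let cK : compact K.
Proof. by apply: compact_setX; exact: segment_compact. Qed.

Let Kinj : {in K &, injective Z}.
Proof. by move=> p q; rewrite !inE !KE => -[? ?] [? ?]; exact: Zinj. Qed.

Theorem full_shift_coding :
  exists (S : choiceType) (Lambda : set W) (Pi : W -> full_shift_space S),
    [/\ ([set: S] #= [set: nat])%card,
        invariant_set D B Lambda,
        {within Lambda, continuous Pi},
        Pi @` Lambda = setT &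
        forall z, Lambda z -> Pi (B z) = full_shift (Pi z)].
Proof.
pose Lambda := sym_set (fun=> True).
pose Pi (w : W) : full_shift_space nat :=
  xget (fun=> 0%N) [set s | exists2 z, sym_orbit s z & w = Z (z 0)].
have PiE s z : sym_orbit s z -> Pi (Z (z 0)) = s.
  move=> oz; rewrite /Pi; case: xgetP => [s' _ [z' oz' E]|/(_ s) /= H].
    by apply: (sym_orbit_code oz' oz); rewrite E.
  by exfalso; apply: H; exists z.
exists nat, Lambda, Pi; split.
- exact: card_eqxx.
- exact: sym_set_invariant.
- apply: continuous_into_prod_discrete => _ k [s [z [oz _ ->]]].
  have [_ H] := sym_orbit_continuous oz k.
  have Kz : K (z 0) by apply/KE; exact: sym_orbit_in.
  have := continuous_inverse_near cK Kinj Kz H.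
  apply: filterS => w Hw [s' [z' [oz' _ wE]]].
  rewrite wE (PiE _ _ oz') (PiE _ _ oz); apply: (Hw (z' 0) _ _ s' z' oz') => //.
  by apply/KE; exact: sym_orbit_in.
- apply/seteqP; split => // s _; have [z oz] := sym_orbit_exists s.
  by exists (Z (z 0)); [exists s, z|rewrite (PiE _ _ oz)].
- move=> _ [s [z [oz _ ->]]].
  rewrite (sym_orbit_step 0 oz).2 (PiE _ _ oz).
  by rewrite (PiE _ _ (sym_orbit_shift 1 oz)).
Qed.

(** With finitely many symbols the condition at each time is a finite union of closed ones, so the
    orbits form a closed subset of a product of compact boxes; evaluation at time 0 is
    continuous. *)
Lemma compact_sym_set M : compact (sym_set (fun s => forall k, (s k < M)%N)).
Proof.
pose T := prod_topology (fun _ : int => (R * R)%type).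
pose O : set T := \bigcap_(k in [set: int]) \bigcup_(j in [set j | (j < M)%N])
  ([set z | sym_box j (z k)] `&` [set z | F j (z k) = z (k + 1)]).
have cp (i : int) (z : T) : continuous_at z (fun z : T => z i).
  exact: (@proj_continuous int (fun=> (R * R)%type) i z).
have clO : closed O.
  apply: closed_bigI => k _; apply: closed_bigcup => [|j _]; first exact: finite_II.
  apply: closedI; last exact: closed_step.
  apply: (@preimage_closed T _ (fun z : T => z k)); first by move=> z _; exact: cp.
  apply: compact_closed; [exact: norm_hausdorff|exact: compact_sym_box].
have cO : compact O.
  apply: (subclosed_compact clO (@tychonoff int (fun=> (R * R)%type) (fun=> K) (fun=> cK))).
  move=> z Oz k; have [j _ [/sym_boxE[h1 h2] _]] := Oz k I.
  by apply/KE; split => //; have := lohi j; lra.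
rewrite (_ : sym_set _ = (fun z : T => Z (z 0)) @` O).
  apply: continuous_compact => //; apply: continuous_subspaceT => z.
  by apply: (@ccomp _ _ _ Z (fun z : T => z 0)); [exact: cZ|exact: cp].
apply/seteqP; split => [_ [s [z [oz sM ->]]]|_ [z Oz <-]].
  exists z; last by [].
  move=> k _; exists (s k); first exact: sM.
  by have [h1 h2 h3] := oz k; split => //; apply/sym_boxE.
have ex k : exists j, [/\ (j < M)%N, sym_box j (z k) & F j (z k) = z (k + 1)].
  by have [j jM [h1 h2]] := Oz k I; exists j.
have [s Hs] := choice ex.
exists s, z; split => // k; last by case: (Hs k).
by have [_ /sym_boxE[h1 h2] h3] := Hs k.
Qed.

(** [Z] is injective on a compact strip, so the distance of images has a positive minimum over the
    pairs whose values of E differ by at least [g], a lower bound for the gaps below the first M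
    windows. *)
Lemma sym_box_separated M : exists2 eps, 0 < eps & forall i j p q, (i < M)%N -> (j < M)%N ->
  i <> j -> sym_box i p -> sym_box j q -> ~ ball (Z p) eps (Z q).
Proof.
have [g g0 Hg] : exists2 g, 0 < g & forall i, (i < M)%N -> g <= lo i - hi i.+1.
  elim: M => [|M [g g0 IH]]; first by exists 1.
  have := dec M; rewrite -subr_gt0 => h.
  exists (Num.min g (lo M - hi M.+1)); first by rewrite lt_min g0.
  move=> i; rewrite ltnS leq_eqVlt => /orP[/eqP ->|/IH h']; rewrite ge_min ?lexx ?orbT//.
  by rewrite h'.
have gap i j p q : (i < M)%N -> (i < j)%N -> sym_box i p -> sym_box j q -> g <= p.2 - q.2.
  move=> iM ij /sym_boxE[_ h1] /sym_boxE[_ h2].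
  have := Hg i iM; have : hi j <= hi i.+1.
    move: ij; rewrite leq_eqVlt => /orP[/eqP <- //|/win_anti].
    by have := lohi i.+1; lra.
  by lra.
(* A sum of four coordinate distances, whence the factor 4 between it and the radius of a ball. *)
pose dist (z : (R * R) * (R * R)) : R :=
  `|(Z z.1).1.1 - (Z z.2).1.1| + `|(Z z.1).1.2 - (Z z.2).1.2| +
  (`|(Z z.1).2.1 - (Z z.2).2.1| + `|(Z z.1).2.2 - (Z z.2).2.2|).
have cdist : continuous dist.
  move=> z.
  have cn (f : (R * R) * (R * R) -> R) : continuous_at z f -> continuous_at z (fun z => `|f z|).
    by move=> cg; apply: (@ccomp _ _ _ (fun x : R => `|x|) f); [exact: norm_continuous|].
  have cZ1 : continuous_at z (fun z : (R * R) * (R * R) => Z z.1).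
    by apply: (@ccomp _ _ _ Z fst); [exact: cZ|exact: cfst0].
  have cZ2 : continuous_at z (fun z : (R * R) * (R * R) => Z z.2).
    by apply: (@ccomp _ _ _ Z snd); [exact: cZ|exact: csnd0].
  have c11 := cfst (cfst cZ1); have c12 := csnd (cfst cZ1).
  have c13 := cfst (csnd cZ1); have c14 := csnd (csnd cZ1).
  have c21 := cfst (cfst cZ2); have c22 := csnd (cfst cZ2).
  have c23 := cfst (csnd cZ2); have c24 := csnd (csnd cZ2).
  by apply: cD; apply: cD; apply: cn; apply: cD => //; exact: cN.
pose C := (K `*` K) `&` [set z | g <= `|z.1.2 - z.2.2|].
have cC : compact C.
  apply: compact_closedI; first exact: compact_setX.
  apply: (@preimage_closed _ _ (fun z : (R * R) * (R * R) => `|z.1.2 - z.2.2|) [set x | g <= x]).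
    move=> z _; apply: (@ccomp _ _ _ (fun x : R => `|x|)); first exact: norm_continuous.
    by apply: cD; [exact: csnd (@cfst0 _ _ z)|apply: cN; exact: csnd (@csnd0 _ _ z)].
  exact: closed_ge.
have dball p q eps : ball (Z p) eps (Z q) -> dist (p, q) < 4 * eps.
  by move=> [[b1 b2] [b3 b4]]; move: b1 b2 b3 b4; rewrite /ball /= /dist /=; lra.
have inC i j p q : (i < M)%N -> (j < M)%N -> i <> j -> sym_box i p -> sym_box j q -> C (p, q).
  move=> iM jM /eqP ij pi qj; split.
    have /sym_boxE[? ?] := pi; have /sym_boxE[? ?] := qj.
    by split; apply/KE; split => //=; [have := lohi i|have := lohi j]; lra.
  move: ij; rewrite neq_ltn => /orP[ij|ji] /=.
    by have := gap _ _ _ _ iM ij pi qj; have := ler_norm (p.2 - q.2); lra.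
  by have := gap _ _ _ _ jM ji qj pi; rewrite distrC; have := ler_norm (q.2 - p.2); lra.
have [C0|C0] := pselect (C !=set0); last first.
  exists 1 => // i j p q iM jM ij pi qj; exfalso; apply: C0.
  by exists (p, q); exact: (inC i j).
have [[p0 q0] /set_mem Cpq Hmin] := compact_EVT_min C0 cC (continuous_subspaceT cdist).
have d0 : 0 < dist (p0, q0).
  have dge : 0 <= dist (p0, q0) by rewrite /dist !addr_ge0.
  rewrite lt_neqAle dge andbT eq_sym; apply/eqP => d0.
  have [[/= Kp Kq] /= gpq] := Cpq.
  have E : Z p0 = Z q0.
    move: d0; rewrite /dist /= => /eqP.
    rewrite !paddr_eq0 ?addr_ge0// !normr_eq0 !subr_eq0.
    move=> /andP[/andP[/eqP h1 /eqP h2] /andP[/eqP h3 /eqP h4]].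
    by move: h1 h2 h3 h4; case: (Z p0) => [[? ?] [? ?]]; case: (Z q0) => [[? ?] [? ?]] /= -> -> -> ->.
  have pq : p0 = q0 by apply: Kinj; rewrite ?inE.
  by move: gpq; rewrite pq subrr normr0; lra.
exists (dist (p0, q0) / 4); first by rewrite divr_gt0.
move=> i j p q iM jM ij pi qj /dball.
have := Hmin (p, q) (mem_set (inC _ _ _ _ iM jM ij pi qj)); lra.
Qed.

(** The M^n words of length n, continued by zeros, are realised by orbits, and two different words
    put their orbits in different windows at some time below n. *)
Lemma sym_entropy M : (0 < M)%N ->
  ((ln M%:R)%:E <= topological_entropy B (sym_set (fun s => forall k, (s k < M)%N)))%E.
Proof.
move=> M0; have [eps eps0 Hsep] := sym_box_separated M.
set L := sym_set _.
have iterB s z n : sym_orbit s z -> iter n B (Z (z 0)) = Z (z n%:Z).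
  move=> oz; elim: n => //= n ->.
  by rewrite (sym_orbit_step _ oz).2 -PoszD addn1.
have sep n : exists2 sq, size sq = (M ^ n)%N & Defs.separated B L n eps sq.
  pose T := {ffun 'I_n -> 'I_M}.
  pose word (f : T) (k : int) : nat :=
    if (0 <= k) then (if insub (absz k) is Some i then f i : nat else 0%N) else 0%N.
  have wordM f k : (word f k < M)%N.
    by rewrite /word; case: ifP => // _; case: insubP.
  have ex (f : T) : exists w : W, exists2 z, sym_orbit (word f) z & w = Z (z 0).
    by have [z oz] := sym_orbit_exists (word f); exists (Z (z 0)), z.
  have [pt Hpt] := choice ex.
  have sep (f f' : T) : f != f' -> exists2 k : nat, (k < n)%N &
      ~ ball (iter k B (pt f)) eps (iter k B (pt f')).
    move=> ff'; have [i fi] : exists i, f i <> f' i.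
      apply: contrapT => H; move/eqP: ff'; apply; apply/ffunP => i.
      by apply: contrapT => fi; apply: H; exists i.
    exists i; first exact: ltn_ord.
    have [z oz ->] := Hpt f; have [z' oz' ->] := Hpt f'.
    rewrite (iterB _ _ _ oz) (iterB _ _ _ oz').
    have wi (g : T) : word g i%:Z = g i.
      by rewrite /word /= insubT ?ltn_ord// => lt; congr (nat_of_ord (g _)); exact: val_inj.
    have [h1 h2 _] := oz i%:Z; have [h3 h4 _] := oz' i%:Z.
    apply: (Hsep _ _ _ _ (wordM f i%:Z) (wordM f' i%:Z)); [|exact/sym_boxE|exact/sym_boxE].
    by rewrite !wi => /val_inj.
  have ptinj : injective pt.
    move=> f f' E; apply/eqP; apply: contrapT => /negP /sep[k _]; apply.
    by rewrite E; exact: ballxx.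
  exists [seq pt f | f <- enum T].
    by rewrite size_map -cardE card_ffun !card_ord.
  split.
  - by rewrite map_inj_uniq ?enum_uniq.
  - by move=> _ /mapP[f _ ->]; have [z oz ->] := Hpt f; exists (word f), z; split.
  - move=> _ _ /mapP[f _ ->] /mapP[f' _ ->] ff'; apply: sep.
    by apply: contraNneq ff' => ->.
apply: le_trans; last by apply: ereal_sup_ubound; exists eps => //; exact: eps0.
rewrite limn_esup_lim; apply: lime_ge; first exact: is_cvg_esups.
apply: nearW => n.
(* Any index from n on serves to bound the supremum of the tail; n + 1 has the merit of being
   nonzero in the division. *)
apply: le_trans; last by apply: ereal_sup_ubound; exists n.+1 => //=.
apply: ereal_sup_ubound; have [sq szq Hsq] := sep n.+1.
by exists sq => //; rewrite szq natrX lnXn ?ltr0n// -[ln M%:R *+ _]mulr_natr mulfK//.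
Qed.

Theorem large_entropy (x : R) : exists Lambda : set W,
  [/\ compact Lambda, invariant_set D B Lambda &
      (x%:E <= topological_entropy B Lambda)%E].
Proof.
pose M := (Num.truncn (expR x)).+1.
exists (sym_set (fun s => forall k, (s k < M)%N)); split.
- exact: compact_sym_set.
- by apply: sym_set_invariant => s l sM k; exact: sM.
- apply: le_trans (sym_entropy _) => //; rewrite lee_fin -[leLHS]expRK.
  rewrite ler_ln ?posrE ?expR_gt0 ?ltr0n//; apply: ltW.
  exact: truncnS_gt.
Qed.

End coding.
End symbolic.

(** * Flight times *)

Section flight_time.
Variables (R : realType) (a b c : R).
Hypotheses (b0 : 0 <= b) (c0 : 0 <= c) (ca : c < a).
Local Notation A := (a + 2 * b).
Local Notation E_ := (fl_E a b).
Local Notation S := (fl_S a b).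
Local Notation Q := (fl_Q a b).
Local Notation Theta := (fl_Theta a b c).
Local Notation g := (fl_g a b c).

Let A0 : 0 < A. Proof. exact: (A_gt0 b0 c0 ca). Qed.

Lemma fl_E_incr r s : 0 <= r -> r < s -> E_ r < E_ s.
Proof.
move=> r0 rs; rewrite /fl_E.
have h1 : r ^+ 2 < s ^+ 2 by rewrite ltr_pXn2r// nnegrE; lra.
have h2 : A + 2 * b * r ^+ 2 <= A + 2 * b * s ^+ 2.
  by rewrite lerD2l ler_wpM2l ?mulr_ge0// ltW.
have h3 : 0 < A + 2 * b * r ^+ 2 by rewrite ltr_wpDr// mulr_ge0 ?sqr_ge0// mulr_ge0.
have h4 : 2 * r ^+ 2 * (A + 2 * b * r ^+ 2) <= 2 * r ^+ 2 * (A + 2 * b * s ^+ 2).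
  by rewrite ler_wpM2l// mulr_ge0// sqr_ge0.
apply: (le_lt_trans h4); rewrite ltr_pM2r; last exact: lt_le_trans h3 h2.
by rewrite ltr_pM2l.
Qed.

(** The nonnegative r with [fl_E r = E], from a quadratic equation in r^2. The root is rationalised
    so as to remain valid for b = 0, that is for h = 0. *)
Definition fl_rad (E : R) : R := Num.sqrt (E / (A + Num.sqrt (A ^+ 2 + 4 * b * E))).
Local Notation rad := fl_rad.

Lemma fl_rad_den E : 0 < A + Num.sqrt (A ^+ 2 + 4 * b * E).
Proof. by rewrite ltr_wpDr// sqrtr_ge0. Qed.

Lemma fl_rad_gt0 E : 0 < E -> 0 < rad E.
Proof. by move=> E0; rewrite sqrtr_gt0 divr_gt0// fl_rad_den. Qed.

Lemma fl_radK E : 0 <= E -> E_ (rad E) = E.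
Proof.
move=> E0; have D0 := fl_rad_den E.
have s2 : Num.sqrt (A ^+ 2 + 4 * b * E) ^+ 2 = A ^+ 2 + 4 * b * E.
  by rewrite sqr_sqrtr// addr_ge0 ?sqr_ge0// mulr_ge0// mulr_ge0.
rewrite /fl_E /fl_rad sqr_sqrtr ?divr_ge0 ?(ltW D0)//.
set s := Num.sqrt _ in s2 D0 *.
transitivity (E * (2 * A * (A + s) + (4 * b * E)) / (A + s) ^+ 2).
  by field; rewrite gt_eqF.
have -> : 4 * b * E = s ^+ 2 - A ^+ 2 by rewrite s2; ring.
by field; rewrite gt_eqF.
Qed.

Lemma fl_rad_lt E y : 0 <= E -> 0 <= y -> E < E_ y -> rad E < y.
Proof.
move=> E0 y0 Ey; rewrite ltNge le_eqVlt; apply/negP => /orP[/eqP yE|yr].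
  by move: Ey; rewrite yE fl_radK// ltxx.
by have := fl_E_incr y0 yr; rewrite fl_radK//; lra.
Qed.

Lemma continuous_fl_rad (E : R) : continuous_at E rad.
Proof. by rewrite /fl_rad; have := fl_rad_den E => D0; cauto; rewrite gt_eqF. Qed.

Definition fl_P (E y : R) : R := Num.sqrt (2 * (E_ y - E)).

Lemma fl_pE r tau : 0 < r -> 0 <= tau -> fl_p a b r tau = fl_P (E_ r) (r + tau ^+ 2).
Proof.
move=> r0 t0; have N0 := fl_N_gt0 b0 c0 ca tau r0.
have -> : fl_p a b r tau = Num.sqrt ((2 * tau) ^+ 2) * Num.sqrt (fl_N a b r tau).
  by rewrite sqrtr_sqr ger0_norm ?mulr_ge0.
rewrite -sqrtrM ?sqr_ge0// /fl_P; congr Num.sqrt.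
by rewrite /fl_N /fl_E; ring.
Qed.

Lemma fl_pN r tau : fl_p a b r (- tau) = - fl_p a b r tau.
Proof. by rewrite /fl_p /fl_N sqrrN; ring. Qed.

Lemma fl_S_odd r tau : 0 < r -> S r (- tau) = - S r tau.
Proof.
move=> r0; have [S0 dS] := fl_SP b0 c0 ca r0.
have QN t : Q r (- t) = Q r t by rewrite /fl_Q /fl_N sqrrN.
have H (t : R) : is_derive t 1 (fun t => S r t + S r (- t)) 0.
  apply: deq; first exact: (dD (dS t) (dcomp (dS (- t)) (dN (did t)))).
  by rewrite QN mulrN1 subrr.
have := @derive0_cst R _ (- (`|tau| + 1)) (`|tau| + 1) (fun x _ => H x) tau 0.
rewrite oppr0 S0 addr0 => h; apply/eqP; rewrite -addr_eq0 addrC; apply/eqP; apply: h.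
  by have := ler_norm tau; have := ler_norm (- tau); rewrite normrN; lra.
by have := normr_ge0 tau; lra.
Qed.

Lemma fl_S_incr r s t : 0 < r -> s <= t -> S r s <= S r t.
Proof.
move=> r0; rewrite le_eqVlt => /orP[/eqP -> //|st].
have [_ dS] := fl_SP b0 c0 ca r0; apply/ltW.
by apply: (gt0_derive_incr dS) => // x; rewrite invr_gt0 (fl_Q_gt0 b0 c0 ca).
Qed.

Lemma continuous_fl_S (r tau : R) : 0 < r ->
  continuous_at (r, tau) (fun z : R * R => S z.1 z.2).
Proof.
move=> r0; apply: (@param_antiderivative_continuous R R (fun r t => (Q r t)^-1)).
  move=> x; apply: (@cV _ _ (fun z : R * R => Q z.1 z.2)).
    by rewrite gt_eqF// (fl_Q_gt0 b0 c0 ca).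
  by rewrite /fl_Q /rt /fl_N; cauto.
have : \forall p \near r, 0 < p by exact: lt_nbhsr.
by apply: filterS => p p0; exact: (fl_SP b0 c0 ca p0).
Qed.

Lemma continuous_fl_Theta (E eta : R) : 0 < E ->
  continuous_at (E, eta) (fun z : R * R => Theta z.1 z.2).
Proof.
move=> E0; apply: (@param_antiderivative_continuous R R (fun E x => (g E x)^-1)).
  move=> x; apply: (@cV _ _ (fun z : R * R => g z.1 z.2)).
    by rewrite gt_eqF// (fl_g_gt0 b0 c0 ca)// ltW.
  by rewrite /fl_g; cauto.
have : \forall p \near E, 0 < p by exact: lt_nbhsr.
by apply: filterS => p p0; exact: (fl_ThetaP b0 c0 ca (ltW p0)).
Qed.

Lemma fl_Theta_bounds E gm s t : 0 <= E -> (forall x, g E x <= gm) -> s <= t ->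
  (t - s) / gm <= Theta E t - Theta E s <= (t - s) / Num.sqrt (2 * (a - c)).
Proof.
move=> E0 Hg; rewrite le_eqVlt => /orP[/eqP ->|st]; first by rewrite !subrr !mul0r lexx.
have [_ dT] := fl_ThetaP b0 c0 ca E0.
have [z zi ->] := MVT_oo st (fun z _ => dT z).
have gz := fl_g_gt0 b0 c0 ca z E0; have ts : 0 < t - s by rewrite subr_gt0.
have gm0 : 0 < gm by exact: lt_le_trans gz (Hg z).
have gn0 : 0 < Num.sqrt (2 * (a - c)) by rewrite sqrtr_gt0; have := ca; lra.
by rewrite [(g E z)^-1 * _]mulrC !ler_pM2l// !lef_pV2 ?posrE// Hg fl_g_ge.
Qed.

(** As a function of the level y = r + tau^2 the time has derivative 1 / (2 tau Q), at most 2 / p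
    where p_xi >= p. The restriction to levels above [ym] matters, this derivative being unbounded
    at the turning level. *)
Lemma fl_S_steep E ym p s t : 0 < E -> 0 < p -> p <= fl_P E ym -> 0 < ym ->
  0 <= s -> ym <= rad E + s ^+ 2 -> s <= t ->
  S (rad E) t - S (rad E) s <= 2 / p * (t ^+ 2 - s ^+ 2).
Proof.
move=> E0 p0 pE ym0 s0 yms; rewrite le_eqVlt => /orP[/eqP ->|st].
  by rewrite !subrr mulr0.
have r0 := fl_rad_gt0 E0; set r := rad E in r0 yms *.
have [_ dS] := fl_SP b0 c0 ca r0.
pose F t := S r t - 2 / p * t ^+ 2.
have dF (x : R) : is_derive x 1 F ((Q r x)^-1 - 4 / p * x).
  apply: deq; first exact: (dD (dS x) (dN (dM (dcst (2 / p) x) (dX 2 (did x))))).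
  by rewrite /= expr1; lra.
have [z zi zE] := MVT_oo st (fun z _ => dF z).
suff : F t - F s <= 0 by rewrite /F; lra.
rewrite zE mulr_le0_ge0 ?subr_ge0 ?(ltW st)// subr_le0.
have z0 : 0 < z by lra.
have Q0 := fl_Q_gt0 b0 c0 ca z r0.
have yz : ym <= r + z ^+ 2.
  by apply: (le_trans yms); rewrite lerD2l ler_pXn2r// ?nnegrE; lra.
have pz : p <= fl_p a b r z.
  rewrite fl_pE ?(ltW z0)// fl_radK ?(ltW E0)//; apply: (le_trans pE).
  apply: ler_wsqrtr; rewrite ler_pM2l// lerD2r.
  by move: yz; rewrite le_eqVlt => /orP[/eqP -> //|yz]; apply/ltW/fl_E_incr => //; lra.
have rt1 : 1 <= rt (r + z ^+ 2).
  by rewrite -[leLHS]sqrtr1 ler_wsqrtr// lerDl sqr_ge0.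
have h : p <= 4 * z * Q r z.
  apply: (le_trans pz); rewrite /fl_p /fl_Q.
  have sN := sqrtr_ge0 (fl_N a b r z).
  have : 0 <= (rt (r + z ^+ 2) - 1) * (2 * z * Num.sqrt (fl_N a b r z)).
    by rewrite mulr_ge0 ?subr_ge0// mulr_ge0// mulr_ge0// ltW.
  lra.
rewrite -[leLHS]div1r ler_pdivrMr//.
have -> : 4 / p * z * Q r z = 4 * z * Q r z / p by ring.
by rewrite ler_pdivlMr ?mul1r.
Qed.

(** Regularised time of the climb from the turning level of E to the level y; by symmetry also that
    of the descent. *)
Definition fl_T (E y : R) : R := S (rad E) (Num.sqrt (y - rad E)).

Lemma continuous_fl_T (E y : R) : 0 < E -> continuous_at (E, y) (fun z : R * R => fl_T z.1 z.2).
Proof.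
move=> E0; rewrite /fl_T.
apply: (@ccomp _ _ _ (fun z : R * R => S z.1 z.2)
  (fun z : R * R => (rad z.1, Num.sqrt (z.2 - rad z.1)))).
  by apply: continuous_fl_S; exact: fl_rad_gt0.
have cr : continuous_at (E, y) (fun z : R * R => rad z.1).
  by apply: (@ccomp _ _ _ rad fst); [exact: continuous_fl_rad|exact: cfst0].
by apply: cpair => //; cauto.
Qed.

Lemma fl_T_bounds E ym p y y' : 0 < E -> 0 < p -> p <= fl_P E ym -> 0 < ym ->
  E < E_ ym -> ym <= y -> y <= y' ->
  0 <= fl_T E y' - fl_T E y <= 2 / p * (y' - y).
Proof.
move=> E0 p0 pE ym0 Em yy yy'; have r0 := fl_rad_gt0 E0.
have ry : rad E < ym by apply: fl_rad_lt => //; exact: ltW.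
have st : Num.sqrt (y - rad E) <= Num.sqrt (y' - rad E) by rewrite ler_wsqrtr// lerD2r.
rewrite /fl_T subr_ge0 fl_S_incr//=.
apply: (le_trans (fl_S_steep E0 p0 pE ym0 (sqrtr_ge0 _) _ st)).
  by rewrite sqr_sqrtr; lra.
by rewrite !sqr_sqrtr; lra.
Qed.

End flight_time.

(** Once tau^2 >= 2 r, the factor 2 r + tau^2 of [fl_N] is at most 4 tau^2, so Q <= 2 C tau and the
    integrand is at least k / tau. The time is thus at least k ln (t / s) with s^2 = 2 r, which
    diverges logarithmically as r tends to 0. *)
Lemma fl_T_blowup (R : realType) (a b c ym M : R) :
  0 <= b -> 0 <= c -> c < a -> 0 < ym ->
  exists2 eps, 0 < eps & forall E, 0 < E -> E < eps -> M <= fl_T a b E ym.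
Proof.
move=> b0 c0 ca ym0; have A0 := A_gt0 b0 c0 ca.
pose C := rt ym / 2 * Num.sqrt ((a + 2 * b) + 4 * b * ym ^+ 2).
have By0 : 0 < (a + 2 * b) + 4 * b * ym ^+ 2 by rewrite ltr_wpDr// mulr_ge0 ?sqr_ge0// mulr_ge0.
have C0 : 0 < C by rewrite /C mulr_gt0 ?sqrtr_gt0// divr_gt0// rt_gt0.
pose k := (2 * C)^-1; have k0 : 0 < k by rewrite invr_gt0 mulr_gt0.
pose ts := Num.sqrt (ym / 2); have ts0 : 0 < ts by rewrite sqrtr_gt0 divr_gt0.
pose M1 := `|M| + 1; have M10 : 0 < M1 by rewrite ltr_wpDl.
(* Chosen so that k ln (ts / sg) = M1; the bound on r will give s < sg and ts <= t. *)
pose sg := ts * expR (- (M1 / k)).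
have sg0 : 0 < sg by rewrite mulr_gt0 ?expR_gt0.
have sgts : sg < ts.
  by rewrite -[ltRHS]mulr1 ltr_pM2l// -expR0 ltr_expR oppr_lt0 divr_gt0.
pose rho := Num.min (ym / 2) (sg ^+ 2 / 2).
have rho0 : 0 < rho by rewrite lt_min !divr_gt0// exprn_gt0.
exists (fl_E a b rho).
  by rewrite -(_ : fl_E a b 0 = 0) ?(fl_E_incr b0 c0 ca)// /fl_E expr0n /= mulr0 mul0r.
move=> E E0 Er; have r0 := fl_rad_gt0 b0 c0 ca E0.
have /(fl_rad_lt b0 c0 ca) : E < fl_E a b rho by [].
move=> /(_ (ltW E0) (ltW rho0)) rr; rewrite /fl_T; set r := fl_rad a b E in r0 rr *.
have [rr1 rr2] : r < ym / 2 /\ r < sg ^+ 2 / 2 by move: rr; rewrite lt_min => /andP[].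
pose s := Num.sqrt (2 * r); pose t := Num.sqrt (ym - r).
have s0 : 0 < s by rewrite sqrtr_gt0 mulr_gt0.
have ssg : s < sg.
  by rewrite -[ltRHS]gtr0_norm// -sqrtr_sqr ltr_sqrt ?exprn_gt0//; clear -rr2; lra.
have tst : ts <= t by rewrite ler_wsqrtr//; clear -rr1; lra.
have t2 : t ^+ 2 = ym - r by rewrite sqr_sqrtr; clear -rr1 ym0; lra.
have s2 : s ^+ 2 = 2 * r by rewrite sqr_sqrtr; clear -r0; lra.
have [S0 dS] := fl_SP b0 c0 ca r0.
have st : s < t by clear -sgts ssg tst; lra.
have dF (x : R) : s <= x <= t -> is_derive x 1 (fun x => fl_S a b r x - k * ln x) ((fl_Q a b r x)^-1 - k * x^-1).
  move=> xi; have x0 : 0 < x by clear -s0 xi; lra.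
  apply: deq; first exact: (dD (dS x) (dN (dM (dcst k x) (is_derive1_ln x0)))).
  by rewrite mul0r add0r.
have [z zi zE] := MVT_oo st dF.
have z0 : 0 < z by clear -s0 zi; lra.
have Q0 := fl_Q_gt0 b0 c0 ca z r0.
have zz : s ^+ 2 <= z ^+ 2 <= t ^+ 2 by rewrite !ler_pXn2r// ?nnegrE; clear -s0 ts0 tst zi; lra.
have Qb : fl_Q a b r z <= C * (2 * z).
  have e1 : rt (r + z ^+ 2) <= rt ym.
    rewrite ler_wsqrtr// lerD2l ler_pXn2r// ?nnegrE; clear -r0 s2 t2 ym0 zz; lra.
  have yz : (r + z ^+ 2) ^+ 2 + r ^+ 2 <= 2 * ym ^+ 2.
    have : (r + z ^+ 2) ^+ 2 <= ym ^+ 2 by rewrite ler_pXn2r// ?nnegrE; clear -r0 s2 t2 ym0 zz; lra.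
    have : r ^+ 2 <= ym ^+ 2 by rewrite ler_pXn2r// ?nnegrE; clear -r0 rr1 ym0; lra.
    lra.
  have e2 : Num.sqrt (fl_N a b r z) <= 2 * z * Num.sqrt ((a + 2 * b) + 4 * b * ym ^+ 2).
    have -> : 2 * z = Num.sqrt ((2 * z) ^+ 2) by rewrite sqrtr_sqr gtr0_norm// mulr_gt0.
    rewrite -sqrtrM ?sqr_ge0// ler_wsqrtr// /fl_N ler_pM//.
    - by rewrite addr_ge0// ?sqr_ge0// mulr_ge0// ltW.
    - by rewrite addr_ge0 ?(ltW A0)// mulr_ge0 ?addr_ge0 ?sqr_ge0// mulr_ge0.
    - by rewrite exprMn; have := sqr_ge0 z; clear -s2 zz; lra.
    - rewrite lerD2l; have : 0 <= 2 * b * (2 * ym ^+ 2 - ((r + z ^+ 2) ^+ 2 + r ^+ 2)).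
        by rewrite mulr_ge0 ?subr_ge0// mulr_ge0.
      lra.
  rewrite /fl_Q /C.
  apply: (@le_trans _ _ (rt ym / 2 * (2 * z * Num.sqrt ((a + 2 * b) + 4 * b * ym ^+ 2)))); last by lra.
  apply: ler_pM => //; rewrite ?sqrtr_ge0 ?divr_ge0 ?sqrtr_ge0//.
  by rewrite ler_pM2r ?invr_gt0.
have h : 0 <= (fl_Q a b r z)^-1 - k * z^-1.
  have h1 : 0 < 2 * C * z by rewrite mulr_gt0// mulr_gt0.
  rewrite subr_ge0 /k -invfM lef_pV2 ?posrE//.
  by apply: (le_trans Qb); rewrite mulrCA mulrA.
have Ss : 0 <= fl_S a b r s by rewrite -S0 (fl_S_incr b0 c0 ca)// ltW.
have : 0 <= ((fl_Q a b r z)^-1 - k / z) * (t - s) by rewrite mulr_ge0// subr_ge0 ltW.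
rewrite -zE => H.
have lnt : ln ts <= ln t by rewrite ler_ln ?posrE//; clear -ts0 tst; lra.
have lns : ln s <= ln ts - M1 / k.
  have : ln s < ln sg by rewrite ltr_ln ?posrE.
  by rewrite /sg lnM ?posrE ?expR_gt0// expRK; lra.
have : k * (M1 / k) <= k * (ln t - ln s) by rewrite ler_pM2l//; clear -lns lnt; lra.
rewrite mulrCA divff ?gt_eqF// mulr1 /M1 => H2.
have := ler_norm M; rewrite -/t; clear -H H2 Ss; lra.
Qed.

(** * Reflection and return map *)

Section reflection.
Variables (R : realType) (w P g : R).

(** Reflection of the momenta (P, g) in a line of slope w = d xi / d eta. Elliptic coordinates being
    conformal, this is the Euclidean formula with normal (-1, w). *)
Definition refl_p : R := ((w ^+ 2 - 1) * P + 2 * w * g) / (1 + w ^+ 2).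
Definition refl_g : R := ((1 - w ^+ 2) * g + 2 * w * P) / (1 + w ^+ 2).

Lemma refl_den : 0 < 1 + w ^+ 2.
Proof. by rewrite ltr_wpDr// sqr_ge0. Qed.

Lemma refl_sqr : refl_p ^+ 2 + refl_g ^+ 2 = P ^+ 2 + g ^+ 2.
Proof. by rewrite /refl_p /refl_g; field; rewrite gt_eqF// refl_den. Qed.

Lemma refl_p_lt0 ka : 0 < P -> 0 < g -> `|w| <= ka -> ka <= 2^-1 -> 4 * ka * g < P ->
  refl_p < 0.
Proof.
move=> P0 g0 wk k2 kg; rewrite /refl_p pmulr_llt0 ?invr_gt0 ?refl_den//.
have w2 : w ^+ 2 <= 4^-1.
  rewrite -real_normK ?num_real//; have := normr_ge0 w; nra.
have : w * g <= ka * g by rewrite ler_pM2r//; have := ler_norm w; lra.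
have : (w ^+ 2 - 4^-1) * P <= 0 by rewrite mulr_le0_ge0 ?subr_le0// ltW.
lra.
Qed.

Lemma refl_g_gt0 ka : 0 < P -> 0 < g -> `|w| <= ka -> ka <= 2^-1 -> 4 * ka * P < g ->
  0 < refl_g.
Proof.
move=> P0 g0 wk k2 kg; rewrite /refl_g divr_gt0 ?refl_den//.
have w2 : w ^+ 2 <= 4^-1.
  rewrite -real_normK ?num_real//; have := normr_ge0 w; nra.
have : - w * P <= ka * P by rewrite ler_pM2r//; have := ler_norm (- w); rewrite normrN; lra.
have : (w ^+ 2 - 4^-1) * g <= 0 by rewrite mulr_le0_ge0 ?subr_le0// ltW.
lra.
Qed.

Lemma refl_pB : refl_p = - P + 2 * w * (g + w * P) / (1 + w ^+ 2).
Proof. by rewrite /refl_p; field; rewrite gt_eqF// refl_den. Qed.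

End reflection.

Lemma refl_invol (R : realType) (w P g : R) :
  refl_p w (refl_p w P g) (refl_g w P g) = P.
Proof. by rewrite /refl_p /refl_g; field; rewrite gt_eqF// refl_den. Qed.

Section return_map.
Variables (R : realType) (a b c : R).
Hypotheses (b0 : 0 <= b) (c0 : 0 <= c) (ca : c < a).
Local Notation E_ := (fl_E a b).
Local Notation S := (fl_S a b).
Local Notation Theta := (fl_Theta a b c).
Local Notation T := (fl_T a b).
Local Notation P := (fl_P a b).
Local Notation g := (fl_g a b c).
Variables (u u' : R -> R) (e1 e2 ym ka p gm pm E0 : R).
Hypothesis e12 : e1 < e2.
Hypothesis ym0 : 0 < ym.
Hypothesis cu : forall t : R, continuous_at t u.
Hypothesis cu' : forall t : R, continuous_at t u'.
Hypothesis ub : forall t, ym <= u t.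
Hypothesis u'b : forall t, `|u' t| <= ka.
Hypothesis ulip : forall s t, e1 <= s <= e2 -> e1 <= t <= e2 -> `|u s - u t| <= ka * `|s - t|.
Hypothesis p0 : 0 < p.
Hypothesis E00 : 0 < E0.
Hypothesis E0ym : E0 < E_ ym.
Hypothesis pP : p <= P E0 ym.
Hypothesis gmP : forall E x, 0 <= E <= E0 -> g E x <= gm.
Hypothesis pmP : forall E t, e1 <= t <= e2 -> 0 <= E -> P E (u t) <= pm.
Hypothesis ka4 : ka <= 4^-1.
Hypothesis kagm : 8 * ka * gm < p.
Hypothesis kapm : 8 * ka * pm < Num.sqrt (2 * (a - c)).
Hypothesis ka0 : 0 < ka.

(** The slope d xi / d eta of the arc; y = sinh (xi / 2) gives dy = (rt y / 2) d xi. *)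
Definition slope (t : R) : R := 2 * u' t / rt (u t).
Definition refl_E (t E : R) : R := E_ (u t) - refl_p (slope t) (P E (u t)) (g E t) ^+ 2 / 2.
(** The value of E before the reflection that produced the state (t, E): an involution, it is
    applied to the outgoing momenta (-P, g). *)
Definition unrefl_E (t E : R) : R :=
  E_ (u t) - refl_p (slope t) (- P E (u t)) (g E t) ^+ 2 / 2.

Hypothesis reflE1 : forall E, 0 <= E <= E0 -> refl_E e1 E <= 0.
Hypothesis reflE2 : forall E, 0 <= E <= E0 -> E0 <= refl_E e2 E.

Lemma gm_gt0 : 0 < gm.
Proof.
have h := gmP (E := 0) 0; apply: (lt_le_trans (fl_g_gt0 b0 c0 ca 0 (lexx 0))).
by apply: h; rewrite lexx ltW.
Qed.

Lemma slope_bound t : `|slope t| <= 2 * ka.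
Proof.
have rt1 : 1 <= rt (u t) by rewrite -[leLHS]sqrtr1 ler_wsqrtr// lerDl sqr_ge0.
have r0 : 0 < rt (u t) by exact: rt_gt0.
rewrite /slope normrM normfV (gtr0_norm r0) ler_pdivrMr// normrM (gtr0_norm (ltr0n _ 2)).
have := u'b t; have : 0 <= 2 * ka * (rt (u t) - 1).
  by rewrite mulr_ge0 ?subr_ge0// mulr_ge0// ltW.
lra.
Qed.

Lemma fl_P_ge E t : 0 <= E <= E0 -> p <= P E (u t).
Proof.
move=> Ei; apply: (le_trans pP); rewrite ler_wsqrtr// ler_pM2l//.
have : E_ ym <= E_ (u t).
  by have := ub t; rewrite le_eqVlt => /orP[/eqP <- //|h]; apply/ltW/(fl_E_incr b0 c0 ca) => //; exact: ltW.
lra.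
Qed.

Lemma fl_P_sqr E t : 0 <= E <= E0 -> P E (u t) ^+ 2 = 2 * (E_ (u t) - E).
Proof.
(* A negative radicand would make the square root 0, against the lower bound [p]. *)
move=> Ei; apply: sqr_sqrtr; rewrite leNgt; apply/negP => h.
have := fl_P_ge t Ei; rewrite /fl_P (ler0_sqrtr (ltW h)); have := p0; lra.
Qed.

(** The outgoing particle descends again with eta increasing. The signs of both momenta are thus
    fixed, and this is why (eta, E) is enough to describe a state. *)
Lemma refl_signs E t : e1 <= t <= e2 -> 0 <= E <= E0 ->
  refl_p (slope t) (P E (u t)) (g E t) < 0 /\ 0 < refl_g (slope t) (P E (u t)) (g E t).
Proof.
move=> ti Ei; have PE := fl_P_ge t Ei.
have P0 : 0 < P E (u t) by have := p0; lra.
have [EE0 _] := andP Ei.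
have g0 := fl_g_gt0 b0 c0 ca t EE0.
have k2 : 2 * ka <= 2^-1 by have := ka4; lra.
split.
  apply: (refl_p_lt0 P0 g0 (slope_bound t) k2).
  have : 8 * ka * g E t <= 8 * ka * gm by rewrite ler_pM2l ?gmP// mulr_gt0.
  by have := kagm; lra.
apply: (refl_g_gt0 P0 g0 (slope_bound t) k2).
have : 8 * ka * P E (u t) <= 8 * ka * pm by rewrite ler_pM2l ?pmP// mulr_gt0.
have := fl_g_ge a b0 c0 t EE0; have := kapm; lra.
Qed.

Lemma refl_E_vel E t : e1 <= t <= e2 -> 0 <= E <= E0 -> 0 <= refl_E t E ->
  P (refl_E t E) (u t) = - refl_p (slope t) (P E (u t)) (g E t) /\
  g (refl_E t E) t = refl_g (slope t) (P E (u t)) (g E t).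
Proof.
move=> ti Ei E'0; have [q1 q2] := refl_signs ti Ei.
have P2 := fl_P_sqr t Ei; have [EE0 _] := andP Ei.
have g2 : g E t ^+ 2 = 2 * (a + b + E - c * cos t - b * cos t ^+ 2).
  by apply: sqr_sqrtr; apply/ltW/(fl_g_arg_gt0 b0 c0 ca).
have := refl_sqr (slope t) (P E (u t)) (g E t).
rewrite /fl_P /fl_g /refl_E -/(P E (u t)) -/(g E t).
set q := refl_p _ _ _ in q1 *; set q' := refl_g _ _ _ in q2 *.
rewrite P2 g2 => sq; split.
  have -> : 2 * (E_ (u t) - (E_ (u t) - q ^+ 2 / 2)) = q ^+ 2 by field.
  by rewrite sqrtr_sqr ltr0_norm.
rewrite (_ : 2 * _ = q' ^+ 2); last by lra.
by rewrite sqrtr_sqr gtr0_norm.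
Qed.

Lemma unrefl_EK E t : e1 <= t <= e2 -> 0 <= E <= E0 -> 0 <= refl_E t E ->
  unrefl_E t (refl_E t E) = E.
Proof.
move=> ti Ei E'0; have [h1 h2] := refl_E_vel ti Ei E'0.
rewrite /unrefl_E h1 h2 opprK refl_invol fl_P_sqr//; lra.
Qed.

Lemma continuous_slope (t : R) : continuous_at t slope.
Proof.
have w0 := rt_gt0 (u t).
by rewrite /slope /rt; have cu0 := cu (t := t); have cu0' := cu' (t := t); cauto; rewrite gt_eqF.
Qed.

Lemma continuous_refl_E (X : topologicalType) (x : X) (f h : X -> R) :
  continuous_at x f -> continuous_at x h ->
  continuous_at x (fun x => refl_E (f x) (h x)) /\
  continuous_at x (fun x => unrefl_E (f x) (h x)).
Proof.
move=> cf ch.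
have cuf : continuous_at x (fun x => u (f x)) by apply: (@ccomp _ _ _ u f); [exact: cu|].
have cwf : continuous_at x (fun x => slope (f x)).
  by apply: (@ccomp _ _ _ slope f); [exact: continuous_slope|].
have w0 := refl_den (slope (f x)).
by split; rewrite /refl_E /unrefl_E /refl_p /fl_P /fl_g /fl_E; cauto; rewrite gt_eqF.
Qed.

Lemma slope_g_lt E t : e1 <= t <= e2 -> 0 <= E <= E0 ->
  `|slope t| * g E t < P E (u t) /\ `|slope t| * P E (u t) < g E t.
Proof.
move=> ti Ei; have [EE0 _] := andP Ei; have PE := fl_P_ge t Ei.
have P0 : 0 < P E (u t) by have := p0; lra.
have g0 := fl_g_gt0 b0 c0 ca t EE0; have sb := slope_bound t.
have h1 : `|slope t| * g E t <= 2 * ka * g E t by rewrite ler_wpM2r// ltW.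
have h2 : `|slope t| * P E (u t) <= 2 * ka * P E (u t) by rewrite ler_wpM2r// ltW.
have h3 : 2 * ka * g E t <= 2 * ka * gm by rewrite ler_pM2l ?gmP// mulr_gt0.
have h4 : 2 * ka * P E (u t) <= 2 * ka * pm by rewrite ler_pM2l ?pmP// mulr_gt0.
have k1 : 0 <= 2 * ka * g E t by rewrite !mulr_ge0// ltW.
have k2 : 0 <= 2 * ka * P E (u t) by rewrite !mulr_ge0// ltW.
have := fl_g_ge a b0 c0 t EE0; have := kapm; have := kagm; split; lra.
Qed.

(** At E = 0 the new value is (P^2 - q^2) / 2, where q is the reflected p_xi; P - q is positive and
    P + q = 2 w (g + w P) / (1 + w^2) has the sign of the slope w, because g dominates w P. *)
Lemma refl_E_sign t : e1 <= t <= e2 ->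
  (u' t < 0 -> refl_E t 0 < 0) /\ (0 < u' t -> 0 < refl_E t 0).
Proof.
move=> ti; have Ei : 0 <= (0 : R) <= E0 by rewrite lexx ltW.
have [q1 q2] := refl_signs ti Ei; have [s1 s2] := slope_g_lt ti Ei.
have P2 := fl_P_sqr t Ei; rewrite subr0 in P2.
have PE := fl_P_ge t Ei.
have P0 : 0 < P 0 (u t) by have := p0; lra.
have w0 := rt_gt0 (u t).
rewrite /refl_E; set w := slope t in q1 s2 *.
set PP := P 0 (u t) in P2 P0 q1 s2 *; set gg := g 0 t in s2 q1 *.
set q := refl_p _ _ _ in q1 *.
have D0 := refl_den w.
have gw : 0 < gg + w * PP.
  have : - w * PP <= `|w| * PP by rewrite ler_pM2r//; have := ler_norm (- w); rewrite normrN.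
  lra.
have qE : q = - PP + 2 * w * (gg + w * PP) / (1 + w ^+ 2) by exact: refl_pB.
have -> : E_ (u t) - q ^+ 2 / 2 = (PP - q) * (PP + q) / 2 by rewrite -subr_sqr P2; field.
have Pq : PP + q = w * (2 * (gg + w * PP) / (1 + w ^+ 2)) by rewrite qE; field; rewrite gt_eqF.
have k0 : 0 < 2 * (gg + w * PP) / (1 + w ^+ 2) by rewrite divr_gt0// mulr_gt0.
have Pmq : 0 < PP - q by lra.
split => h.
  have wn : w < 0 by rewrite /w /slope pmulr_llt0 ?invr_gt0// pmulr_rlt0.
  by rewrite pmulr_llt0 ?invr_gt0// pmulr_rlt0// Pq pmulr_llt0.
have wp : 0 < w by rewrite /w /slope divr_gt0// mulr_gt0.
by rewrite divr_gt0// mulr_gt0// Pq mulr_gt0.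
Qed.

(** Zero when the flight leaving the arc at angle [z.1] with E = [z.2] is back on it at angle y + 2
    pi m: the time told by the angle equals descent plus climb. [dep_H] is its opposite, read as a
    function of the departure angle. *)
Definition arr_H (m : nat) (z : R * R) (y : R) : R :=
  Theta z.2 (y + m%:R * (2 * pi)) - T z.2 (u y) - (Theta z.2 z.1 + T z.2 (u z.1)).
Definition dep_H (m : nat) (z : R * R) (y : R) : R :=
  Theta z.2 y + T z.2 (u y) - (Theta z.2 (z.1 + m%:R * (2 * pi)) - T z.2 (u z.1)).

Lemma T_lip E s t : 0 < E -> E <= E0 -> e1 <= s <= e2 -> e1 <= t <= e2 ->
  `|T E (u s) - T E (u t)| <= 2 / p * (ka * `|s - t|).
Proof.
move=> Ep Ei; wlog ust : s t / u s <= u t.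
  move=> H si ti; have [h|/ltW h] := leP (u s) (u t); first exact: H.
  by rewrite distrC [`|s - t|]distrC; exact: H.
move=> si ti.
have pE : p <= P E ym.
  by apply: (le_trans pP); rewrite ler_wsqrtr// ler_pM2l//; lra.
have Em : E < E_ ym by have := E0ym; lra.
have /andP[h1 h2] := fl_T_bounds b0 c0 ca Ep p0 pE ym0 Em (ub s) ust.
have h3 : `|T E (u s) - T E (u t)| = T E (u t) - T E (u s) by rewrite distrC ger0_norm.
rewrite h3; apply: (le_trans h2); rewrite ler_pM2l ?divr_gt0//.
apply: le_trans (ulip si ti); rewrite distrC; exact: ler_norm.
Qed.

(** Along the arc the climbing time varies at a rate at most 2 ka / p, the time told by the angle at
    a rate at least 1 / gm, and [8 * ka * gm < p] lets the latter win. Hence [arr_H] and [dep_H] are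
    strictly increasing in y. *)
Lemma flight_incr E s t : 0 < E -> E <= E0 -> e1 <= s -> s < t -> t <= e2 -> forall m : nat,
  `|T E (u s) - T E (u t)| < Theta E (t + m%:R * (2 * pi)) - Theta E (s + m%:R * (2 * pi)).
Proof.
move=> Ep Ei s1 st t2 m.
have gE x : g E x <= gm by apply: gmP; rewrite Ei ltW.
have st' : s + m%:R * (2 * pi) <= t + m%:R * (2 * pi) by rewrite lerD2r ltW.
have /andP[h1 _] := fl_Theta_bounds b0 c0 ca (ltW Ep) gE st'.
apply: lt_le_trans h1.
have -> : t + m%:R * (2 * pi) - (s + m%:R * (2 * pi)) = t - s by ring.
have si : e1 <= s <= e2 by rewrite s1; lra.
have ti : e1 <= t <= e2 by rewrite t2; lra.
apply: (le_lt_trans (T_lip Ep Ei si ti)).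
have g0 := gm_gt0; have d0 : 0 < t - s by rewrite subr_gt0.
have -> : `|s - t| = t - s by rewrite distrC gtr0_norm.
rewrite ltr_pdivlMr//.
have -> : 2 / p * (ka * (t - s)) * gm = (2 * ka * gm) / p * (t - s) by ring.
rewrite -[ltRHS]mul1r ltr_pM2r// ltr_pdivrMr// mul1r.
have : 0 < ka * gm by rewrite mulr_gt0.
have := kagm; lra.
Qed.

(** The top [hi] comes first, then a number m of turns so large that from every departure angle the
    flight at [hi] is back by e1 + 2 pi m, and last a bottom [lo] so small that the flight at [lo]
    lasts beyond e2 + 2 pi m. *)
Lemma return_window e : 0 < e -> exists lh : R * R * nat,
  [/\ 0 < lh.1.1 /\ lh.1.1 < lh.1.2, lh.1.2 < e,
   forall t, e1 <= t <= e2 -> 0 <= arr_H lh.2 (t, lh.1.2) e1 &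
   forall t, e1 <= t <= e2 -> arr_H lh.2 (t, lh.1.1) e2 <= 0].
Proof.
move=> ep; pose hi := Num.min e E0 / 2.
have [hi0 [hie hiE]] : 0 < hi /\ hi < e /\ hi < E0.
  have : 0 < Num.min e E0 by rewrite lt_min ep.
  have : Num.min e E0 <= e by rewrite ge_min lexx.
  have : Num.min e E0 <= E0 by rewrite ge_min lexx orbT.
  by rewrite /hi; lra.
have gm0 := gm_gt0; have pi2 := two_pi_gt0 R.
have e1i : e1 <= e1 <= e2 by rewrite lexx ltW.
have e2i : e1 <= e2 <= e2 by rewrite lexx ltW.
have Tb t : e1 <= t <= e2 -> T hi (u t) <= T hi (u e1) + 2 / p * (ka * (e2 - e1)).
  move=> ti; have h := T_lip hi0 (ltW hiE) ti e1i.
  have : 2 / p * (ka * `|t - e1|) <= 2 / p * (ka * (e2 - e1)).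
    by rewrite ler_pM2l ?divr_gt0// ler_pM2l// ger0_norm; lra.
  have := ler_norm (T hi (u t) - T hi (u e1)); lra.
have ThI E s t : 0 < E -> E <= E0 -> s <= t ->
    (t - s) / gm <= Theta E t - Theta E s <= (t - s) / Num.sqrt (2 * (a - c)).
  move=> Ep Ei st; apply: fl_Theta_bounds => //; first exact: ltW.
  by move=> x; apply: gmP; rewrite Ei ltW.
pose K := Theta hi e2 + (2 * T hi (u e1) + 2 / p * (ka * (e2 - e1))) - Theta hi e1.
pose m := (Num.truncn (`|K| * gm / (2 * pi))).+1.
have mK : K <= m%:R * (2 * pi) / gm.
  apply: (le_trans (ler_norm _)); rewrite ler_pdivlMr// -ler_pdivrMr//.
  by apply: ltW; exact: truncnS_gt.
pose N := (e2 + m%:R * (2 * pi) - e1) / Num.sqrt (2 * (a - c)).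
have [eps eps0 Heps] := fl_T_blowup N b0 c0 ca ym0.
pose lo := Num.min eps hi / 2.
have [lo0 [loe loh]] : 0 < lo /\ lo < eps /\ lo < hi.
  have : 0 < Num.min eps hi by rewrite lt_min eps0.
  have : Num.min eps hi <= eps by rewrite ge_min lexx.
  have : Num.min eps hi <= hi by rewrite ge_min lexx orbT.
  by rewrite /lo; lra.
have m0 : 0 <= m%:R * (2 * pi) :> R by rewrite mulr_ge0// ltW.
exists (lo, hi, m); split => //= t ti; rewrite /arr_H /=.
  have h1 := Tb t ti.
  have h2 : Theta hi t <= Theta hi e2.
    have /andP[+ _] := ThI hi t e2 hi0 (ltW hiE) ltac:(lra).
    have : 0 <= (e2 - t) / gm by rewrite divr_ge0 ?subr_ge0 ?(ltW gm0)//; lra.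
    lra.
  have /andP[h3 _] := ThI hi e1 (e1 + m%:R * (2 * pi)) hi0 (ltW hiE) ltac:(lra).
  rewrite addrAC subrr add0r in h3.
  by move: mK h3; rewrite /K; lra.
have loE : lo <= E0 by lra.
have /andP[_ h1] := ThI lo t (e2 + m%:R * (2 * pi)) lo0 loE ltac:(lra).
have h2 : (e2 + m%:R * (2 * pi) - t) / Num.sqrt (2 * (a - c)) <= N.
  rewrite /N ler_pM2r ?invr_gt0 ?sqrtr_gt0; first by lra.
  by have := ca; lra.
have pE : p <= P lo ym.
  by apply: (le_trans pP); rewrite ler_wsqrtr// ler_pM2l//; lra.
have Em : lo < E_ ym by have := E0ym; lra.
have h3 := Heps lo lo0 loe.
have /andP[h4 _] := fl_T_bounds b0 c0 ca lo0 p0 pE ym0 Em (lexx ym) (ub e2).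
have /andP[h5 _] := fl_T_bounds b0 c0 ca lo0 p0 pE ym0 Em (lexx ym) (ub t).
have N0 : 0 <= N by rewrite /N divr_ge0 ?sqrtr_ge0//; lra.
lra.
Qed.


Definition wclamp (lo hi x : R) : R := Num.max lo (Num.min hi x).

Lemma wclampP lo hi x : lo <= hi -> lo <= wclamp lo hi x <= hi.
Proof. by move=> lh; rewrite /wclamp le_max lexx ge_max ge_min lexx lh. Qed.

Lemma wclampE lo hi x : lo <= x <= hi -> wclamp lo hi x = x.
Proof. by move=> /andP[h1 h2]; rewrite /wclamp (min_r h2) max_r. Qed.

Lemma wclamp_lo lo hi x : lo <= hi -> x <= lo -> wclamp lo hi x = lo.
Proof. by move=> lh xl; rewrite /wclamp min_r ?max_l//; exact: le_trans xl lh. Qed.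

Lemma wclamp_hi lo hi x : lo <= hi -> hi <= x -> wclamp lo hi x = hi.
Proof. by move=> lh xl; rewrite /wclamp min_l ?max_r. Qed.

Lemma continuous_wclamp lo hi (x : R) : continuous_at x (wclamp lo hi).
Proof. by rewrite /wclamp; apply: cmax; cauto; apply: cmin; cauto. Qed.

Lemma continuous_arr_T (X : topologicalType) (x : X) (f h : X -> R) (k : nat) :
  0 < f x -> continuous_at x f -> continuous_at x h ->
  [/\ continuous_at x (fun x => Theta (f x) (h x + k%:R * (2 * pi))),
    continuous_at x (fun x => T (f x) (u (h x))) &
    continuous_at x (fun x => Theta (f x) (h x))].
Proof.
move=> f0 cf ch; split; last first.
- apply: (@ccomp _ _ _ (fun z : R * R => Theta z.1 z.2) (fun x => (f x, h x))).
    exact: continuous_fl_Theta.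
  exact: cpair.
- apply: (@ccomp _ _ _ (fun z : R * R => T z.1 z.2) (fun x => (f x, u (h x)))).
    exact: (continuous_fl_T b0 c0 ca f0).
  by apply: cpair => //; apply: (@ccomp _ _ _ u h); [exact: cu|].
apply: (@ccomp _ _ _ (fun z : R * R => Theta z.1 z.2) (fun x => (f x, h x + k%:R * (2 * pi)))).
  exact: continuous_fl_Theta.
by apply: cpair => //; cauto.
Qed.

Lemma arrival_map lo hi m : 0 < lo -> lo < hi -> hi < E0 ->
  (forall t, e1 <= t <= e2 -> 0 <= arr_H m (t, hi) e1) ->
  (forall t, e1 <= t <= e2 -> arr_H m (t, lo) e2 <= 0) ->
  exists arr : R * R -> R, [/\ continuous arr, forall z, e1 <= arr z <= e2,
    forall z, lo <= z.2 <= hi -> e1 < arr z < e2 -> arr_H m z (arr z) = 0,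
    forall z, e1 <= z.1 <= e2 -> hi <= z.2 -> arr z = e1 &
    forall z, e1 <= z.1 <= e2 -> z.2 <= lo -> arr z = e2].
Proof.
move=> lo0 lohi hiE Hhi Hlo.
(* E is clamped to the window, where it is positive and the flight times are continuous and monotone
   as needed; outside, the arrival angle keeps its value at the end of the window. *)
pose H (z : R * R) y := arr_H m (z.1, wclamp lo hi z.2) y.
have wi z : lo <= wclamp lo hi z <= hi by apply: wclampP; exact: ltW.
have inc z s t : e1 <= s -> s < t -> t <= e2 -> H z s < H z t.
  move=> s1 st t2; rewrite /H /arr_H /=.
  have wz := wi z.2; set E := wclamp _ _ _ in wz *.
  have Ep : 0 < E by lra.
  have Ei : E <= E0 by lra.
  have := flight_incr Ep Ei s1 st t2 m.
  have := ler_norm (- (T E (u s) - T E (u t))); rewrite normrN; lra.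
have cy z (t : R) : e1 <= t <= e2 -> continuous_at t (H z).
  move=> ti; have wz := wi z.2.
  have w0 : 0 < wclamp lo hi z.2 by lra.
  have [h1 h2 h1'] := @continuous_arr_T R t (fun=> wclamp lo hi z.2) (fun t => t) m
    w0 (@ccst _ _ _ _) (@cidt _ _).
  by rewrite /H /arr_H /=; apply: cD; [apply: cD => //; exact: cN|exact: ccst].
have cp (t : R) : e1 <= t <= e2 -> continuous (H^~ t).
  move=> ti z; have wz := wi z.2.
  have w0 : 0 < wclamp lo hi z.2 by lra.
  have cw : continuous_at z (fun z : R * R => wclamp lo hi z.2).
    by apply: (@ccomp _ _ _ (wclamp lo hi) snd); [exact: continuous_wclamp|exact: csnd0].
  have [h1 h2 h1'] := @continuous_arr_T (R * R)%type z (fun z => wclamp lo hi z.2) (fun=> t) m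
    w0 cw (@ccst _ _ _ _).
  have [h3 h4 h3'] := @continuous_arr_T (R * R)%type z (fun z => wclamp lo hi z.2) fst 0%N
    w0 cw (@cfst0 _ _ z).
  rewrite /H /arr_H /=; apply: cD; first by apply: cD => //; exact: cN.
  by apply: cN; apply: cD.
have [arr [ca' ab a0 a1 a2]] := @clamped_root R (R * R)%type H e1 e2 e12 inc cy cp.
exists arr; split => //.
- move=> z zi azi.
  have -> : arr_H m z (arr z) = H z (arr z) by rewrite /H wclampE// -surjective_pairing.
  have [h1|h1] := leP 0 (H z e1); first by move: azi; rewrite a1// ltxx.
  have [h2|h2] := leP (H z e2) 0; first by move: azi; rewrite a2// ltxx andbF.
  by apply: a0; rewrite !ltW.
- by move=> z zi hz; apply: a1; rewrite /H wclamp_hi ?(ltW lohi)//; exact: Hhi.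
- by move=> z zi hz; apply: a2; rewrite /H wclamp_lo ?(ltW lohi)//; exact: Hlo.
Qed.

(** Reconstructs the previous state: undoing the reflection at the arrival point gives the E of the
    flight, and the departure angle is then the root of [dep_H]. *)
Lemma departure_map lo hi m : 0 < lo -> lo < hi -> hi < E0 ->
  exists G : R * R -> R * R, continuous G /\
    forall z t E', e1 <= z.1 <= e2 -> lo <= z.2 <= hi -> e1 <= t <= e2 ->
      arr_H m z t = 0 -> unrefl_E t E' = z.2 -> G (t, E') = z.
Proof.
move=> lo0 lohi hiE.
pose rho (z : R * R) := wclamp lo hi (unrefl_E z.1 z.2).
have wi z : lo <= rho z <= hi by apply: wclampP; exact: ltW.
have crho (z : R * R) : continuous_at z rho.
  apply: (@ccomp _ _ _ (wclamp lo hi)); first exact: continuous_wclamp.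
  by have [_] := continuous_refl_E (@cfst0 _ _ z) (@csnd0 _ _ z).
pose H (z : R * R) y := dep_H m (z.1, rho z) y.
have inc z s t : e1 <= s -> s < t -> t <= e2 -> H z s < H z t.
  move=> s1 st t2; rewrite /H /dep_H /=.
  have wz := wi z; set E := rho z in wz *.
  have Ep : 0 < E by lra.
  have Ei : E <= E0 by lra.
  have := flight_incr Ep Ei s1 st t2 0; rewrite mul0r !addr0.
  have := ler_norm (T E (u s) - T E (u t)); lra.
have cy z (t : R) : e1 <= t <= e2 -> continuous_at t (H z).
  move=> ti; have wz := wi z.
  have w0 : 0 < rho z by lra.
  have [h1 h2 h1'] := @continuous_arr_T R t (fun=> rho z) (fun t => t) 0%N
    w0 (@ccst _ _ _ _) (@cidt _ _).
  rewrite /H /dep_H /=; apply: cD; last exact: ccst.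
  exact: cD.
have cp (t : R) : e1 <= t <= e2 -> continuous (H^~ t).
  move=> ti z; have wz := wi z.
  have w0 : 0 < rho z by lra.
  have [h1 h2 h1'] := @continuous_arr_T (R * R)%type z rho (fun=> t) 0%N
    w0 (crho z) (@ccst _ _ _ _).
  have [h3 h4 h3'] := @continuous_arr_T (R * R)%type z rho fst m
    w0 (crho z) (@cfst0 _ _ z).
  rewrite /H /dep_H /=; apply: cD; last by apply: cN; apply: cD => //; exact: cN.
  exact: cD.
have [dep [cd db d0 d1 d2]] := @clamped_root R (R * R)%type H e1 e2 e12 inc cy cp.
exists (fun z => (dep z, rho z)); split.
  by move=> z; apply: cpair; [exact: cd|exact: crho].
move=> z t E' zi z2 ti arr0 unE.
have rE : rho (t, E') = z.2 by rewrite /rho /= unE wclampE.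
have Hz : H (t, E') z.1 = 0.
  by rewrite /H /dep_H /= rE; move: arr0; rewrite /arr_H; lra.
rewrite rE [RHS]surjective_pairing; congr (_, _).
have [zd|zd|//] := ltgtP (dep (t, E')) z.1.
+ have := db (t, E') => dbi.
  have h : H (t, E') e2 <> 0 -> False.
    move=> _; have := inc (t, E') _ _ _ zd _; rewrite Hz.
    case/andP: dbi => h1 h2; case/andP: zi => h3 h4.
    move=> /(_ h1 h4); rewrite d0 ?ltxx//; apply/andP; split.
      rewrite -Hz; move: h3; rewrite le_eqVlt => /orP[/eqP -> //|h3].
      by apply/ltW/inc.
    by rewrite -Hz; move: h4; rewrite le_eqVlt => /orP[/eqP -> //|h4]; apply/ltW/inc.
  have [/eqP h'|h'] := boolP (H (t, E') e2 == 0); last by exfalso; apply: h; exact/eqP.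
  by exfalso; have := d2 (t, E') ltac:(by rewrite h'); move: zd zi; lra.
+ have := db (t, E') => dbi.
  have h : H (t, E') (dep (t, E')) = 0.
    apply: d0; rewrite -Hz; case/andP: zi => h3 h4; apply/andP; split.
      by move: h3; rewrite le_eqVlt => /orP[/eqP -> //|h3]; apply/ltW/inc.
    by move: h4; rewrite le_eqVlt => /orP[/eqP -> //|h4]; apply/ltW/inc.
  case/andP: dbi => h1 h2; case/andP: zi => h3 h4.
  by have := inc (t, E') _ _ h3 zd h2; rewrite Hz h ltxx.
Qed.

Lemma return_map : exists (lo hi : nat -> R) (m : nat -> nat) (F G : nat -> R * R -> R * R)
    (rho : R * R -> R),
  [/\ [/\ forall j, 0 < lo j /\ lo j < hi j < E0 & forall j, hi j.+1 < lo j],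
    [/\ forall j, continuous (F j), forall j z, e1 <= (F j z).1 <= e2,
      forall j z, e1 <= z.1 <= e2 -> z.2 <= lo j -> E0 <= (F j z).2 &
      forall j z, e1 <= z.1 <= e2 -> hi j <= z.2 -> (F j z).2 <= 0],
    [/\ forall j, continuous (G j), continuous rho &
      forall j z, e1 <= z.1 <= e2 -> lo j <= z.2 <= hi j ->
        0 < (F j z).2 < E0 -> z.2 = rho (F j z) /\ z = G j (F j z)] &
    forall j z, e1 <= z.1 <= e2 -> lo j <= z.2 <= hi j -> 0 < (F j z).2 < E0 ->
      [/\ e1 < (F j z).1 < e2, arr_H (m j) z (F j z).1 = 0 &
        (F j z).2 = refl_E (F j z).1 z.2]].
Proof.
have [W HW] : exists W : R -> R * R * nat, forall e, 0 < e ->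
    [/\ 0 < (W e).1.1 /\ (W e).1.1 < (W e).1.2, (W e).1.2 < e,
     forall t, e1 <= t <= e2 -> 0 <= arr_H (W e).2 (t, (W e).1.2) e1 &
     forall t, e1 <= t <= e2 -> arr_H (W e).2 (t, (W e).1.1) e2 <= 0].
  have H e : exists lh : R * R * nat, 0 < e ->
      [/\ 0 < lh.1.1 /\ lh.1.1 < lh.1.2, lh.1.2 < e,
       forall t, e1 <= t <= e2 -> 0 <= arr_H lh.2 (t, lh.1.2) e1 &
       forall t, e1 <= t <= e2 -> arr_H lh.2 (t, lh.1.1) e2 <= 0].
    have [ep|ep] := ltP 0 e; last by exists (0, 0, 0%N).
    by have [lh Hlh] := return_window ep; exists lh.
  have [W HW] := choice H; by exists W.
(* Each window is taken below the bottom of the preceding one. *)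
pose w := nat_rect (fun=> (R * R * nat)%type) (W E0) (fun _ v => W v.1.1).
have Hw j : [/\ 0 < (w j).1.1 /\ (w j).1.1 < (w j).1.2, (w j).1.2 < E0,
     forall t, e1 <= t <= e2 -> 0 <= arr_H (w j).2 (t, (w j).1.2) e1 &
     forall t, e1 <= t <= e2 -> arr_H (w j).2 (t, (w j).1.1) e2 <= 0].
  elim: j => [|j [[l1 l2] l3 _ _]]; first exact: HW.
  by have [[h1 h2] h3 h4 h5] := HW _ l1; split => //=; lra.
have Hdec j : (w j.+1).1.2 < (w j).1.1.
  by have [[l1 _] _ _ _] := Hw j; have [] := HW _ l1.
pose lo j := (w j).1.1; pose hi j := (w j).1.2; pose m j := (w j).2.
have Harr j : exists arr : R * R -> R, [/\ continuous arr, forall z, e1 <= arr z <= e2,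
    forall z, lo j <= z.2 <= hi j -> e1 < arr z < e2 -> arr_H (m j) z (arr z) = 0,
    forall z, e1 <= z.1 <= e2 -> hi j <= z.2 -> arr z = e1 &
    forall z, e1 <= z.1 <= e2 -> z.2 <= lo j -> arr z = e2].
  by have [[l1 l2] l3 l4 l5] := Hw j; exact: arrival_map.
have [arr Ha] := choice Harr.
have Hdep j : exists G : R * R -> R * R, continuous G /\
    forall z t E', e1 <= z.1 <= e2 -> lo j <= z.2 <= hi j -> e1 <= t <= e2 ->
      arr_H (m j) z t = 0 -> unrefl_E t E' = z.2 -> G (t, E') = z.
  by have [[l1 l2] l3 l4 l5] := Hw j; exact: departure_map.
have [G HG] := choice Hdep.
pose cl j x := wclamp (lo j) (hi j) x.
have lh j : lo j <= hi j by have [[l1 l2] l3 l4 l5] := Hw j; exact: ltW.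
have cli j x : 0 <= cl j x <= E0.
  by have := wclampP x (lh j); rewrite -/(cl j x); have [[l1 l2] l3 _ _] := Hw j;
    move: l1 l3; rewrite -/(lo j) -/(hi j); lra.
(* Clamping does no harm to itineraries: an arrival angle [e1] or [e2] yields a second coordinate <=
   0 or >= E0, so one in ]0, E0[ certifies a genuine arrival inside the arc. *)
pose F j (z : R * R) := (arr j z, refl_E (arr j z) (cl j z.2)).
have gen j z : e1 <= z.1 <= e2 -> lo j <= z.2 <= hi j -> 0 < (F j z).2 < E0 ->
    [/\ e1 < (F j z).1 < e2, arr_H (m j) z (F j z).1 = 0 &
      (F j z).2 = refl_E (F j z).1 z.2].
  move=> z1 z2 Fi; have [_ ai a0 _ _] := Ha j.
  have ai' : e1 < (F j z).1 < e2.
    rewrite !lt_neqAle; have /andP[-> ->] := ai z; rewrite !andbT.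
    apply/andP; split; apply/eqP => h; move: Fi; rewrite /F /= in h *.
      by rewrite -h; have := reflE1 (cli j z.2); lra.
    by rewrite h; have := reflE2 (cli j z.2); lra.
  by split => //; [exact: a0|rewrite /F /= /cl wclampE].
exists lo, hi, m, F, G, (fun z => unrefl_E z.1 z.2); split => //.
- by split=> // j; have [[l1 l2] l3 _ _] := Hw j; rewrite l1 l2.
- split.
  + move=> j z; have [ca' _ _ _ _] := Ha j; apply: cpair; first exact: ca'.
    have cw : continuous_at z (fun z : R * R => cl j z.2).
      by apply: (@ccomp _ _ _ (wclamp (lo j) (hi j)) snd); [exact: continuous_wclamp|exact: csnd0].
    by have [+ _] := continuous_refl_E (ca' z) cw.
  + by move=> j z; have [_ + _ _ _] := Ha j; exact.
  + move=> j z z1 z2; have [_ _ _ _ a2] := Ha j.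
    by rewrite /F /= a2//; exact: reflE2.
  + move=> j z z1 z2; have [_ _ _ a1 _] := Ha j.
    by rewrite /F /= a1//; exact: reflE1.
- split.
  + by move=> j; case: (HG j).
  + by move=> z; have [_] := continuous_refl_E (@cfst0 _ _ z) (@csnd0 _ _ z).
  + move=> j z z1 z2 Fi; have [g1 g2 g3] := gen j z z1 z2 Fi.
    have t1 : e1 <= (F j z).1 <= e2 by lra.
    have zE : 0 <= z.2 <= E0 by have := cli j z.2; rewrite /cl wclampE.
    have r0 : 0 <= refl_E (F j z).1 z.2 by rewrite -g3; lra.
    have h := unrefl_EK t1 zE r0; rewrite -g3 in h.
    split => //; have [_ H] := HG j; apply/esym.
    by rewrite [F j z]surjective_pairing; exact: H.
Qed.

End return_map.

(** * Bouncing off the boundary arc *)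

Section bounce_step.
Variables (R : realType) (c1 c2 : R * R) (m1 m2 h : R).
Variables (Omega : set (R * R)) (gam : R -> R * R).
Variables (ym ka al e1 e2 be de : R) (u u' : R -> R).
Hypotheses (c12 : c1 <> c2) (m20 : 0 < m2) (m21 : m2 <= m1) (h0 : 0 <= h).
Hypothesis Oopen : open Omega.
Hypothesis Oseg : segment c1 c2 `<=` Omega.
Hypothesis gloop : regular_C1_loop gam (boundary Omega).
Hypothesis ym0 : 0 < ym.
Hypothesis gym : forall th, exists y eta, ym <= y /\ gam th = ell_point c1 c2 y eta.
Hypothesis ga : graph_arc c1 c2 gam ym ka al e1 e2 be de u u'.
Local Notation Pt := (ell_point c1 c2).
Local Notation V := (ell_vel c1 c2).
Local Notation d := (half_dist c1 c2).
Local Notation w := (slope u u').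

Let b0 : 0 <= cB c1 c2 h. Proof. exact: cB_ge0. Qed.
Let c0 : 0 <= cC c1 c2 m1 m2. Proof. exact: cC_ge0. Qed.
Let ca : cC c1 c2 m1 m2 < cA c1 c2 m1 m2. Proof. exact: cC_lt. Qed.

Lemma boundary_notin x : boundary Omega x -> ~ Omega x.
Proof. by case. Qed.

Lemma boundary_gam x : boundary Omega x -> exists th, gam th = x.
Proof. by case: gloop => _ _ _ _ <- [th _ <-]; exists th. Qed.

Lemma gam_boundary th : boundary Omega (gam th).
Proof. by case: gloop => _ _ _ _ <-; exists th. Qed.

Lemma u_gt0 t : 0 < u t.
Proof. by have [uy _] := ga_bound ga t; exact: lt_le_trans ym0 uy. Qed.

(** The curve eta = t rises from the segment, which is inside [Omega]; by [ga_only] the only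
    boundary point it can meet below ym + de is at the level u t. *)
Lemma below_arc y t : al <= t <= be -> 0 <= y -> y < ym + de -> y < u t -> Omega (Pt y t).
Proof.
move=> ti y0 yd yu.
apply: (@path_in_open R Omega (fun s => Pt s t) y Oopen _ _ _ y); last by rewrite y0 lexx.
- by move=> s; apply: continuous_ell_point; [exact: cidt|exact: ccst].
- exact/Oseg/ell_point_segment.
- move=> s si /boundary_gam[th gE].
  have [s0|s0|sE] := ltgtP 0 s; [|by move: si; lra|].
    by have := ga_only ga ti (_ : 0 < s < ym + de) gE; move=> /(_ ltac:(lra)) E; move: si; lra.
  apply: (boundary_notin (gam_boundary th)); rewrite gE -sE; exact/Oseg/ell_point_segment.
Qed.

(** The tangent has elliptic components (w, 1), so (-1, w) is normal to it and points towards
    smaller y; the square root normalises it in the conformal metric. *)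
Definition arc_normal (t : R) : R * R :=
  Num.sqrt (d ^+ 2 * (chx (u t) ^+ 2 - cos t ^+ 2) / (1 + w t ^+ 2)) *: V (u t) t (- 1) (w t).

Lemma arc_disc t : 0 < d ^+ 2 * (chx (u t) ^+ 2 - cos t ^+ 2).
Proof. by rewrite mulr_gt0 ?exprn_gt0 ?half_dist_gt0// ell_disc_gt0// u_gt0. Qed.

Lemma arc_normal_coef t :
  0 < Num.sqrt (d ^+ 2 * (chx (u t) ^+ 2 - cos t ^+ 2) / (1 + w t ^+ 2)).
Proof. by rewrite sqrtr_gt0 divr_gt0 ?arc_disc// refl_den. Qed.

Lemma dot_arc_normal t p q : dot (V (u t) t p q) (arc_normal t) =
  Num.sqrt (d ^+ 2 * (chx (u t) ^+ 2 - cos t ^+ 2) / (1 + w t ^+ 2)) * (w t * q - p) /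
  (d ^+ 2 * (chx (u t) ^+ 2 - cos t ^+ 2)).
Proof.
rewrite /arc_normal ell_vel_lin (dot_ell_vel _ _ _ _ _ _ (u_gt0 t))//; congr (_ / _); ring.
Qed.

Lemma arc_normal_unit t : enorm (arc_normal t) = 1.
Proof.
have D0 := arc_disc t; have W0 := refl_den (w t).
have K0 := arc_normal_coef t.
have K2 : Num.sqrt (d ^+ 2 * (chx (u t) ^+ 2 - cos t ^+ 2) / (1 + w t ^+ 2)) ^+ 2 =
  d ^+ 2 * (chx (u t) ^+ 2 - cos t ^+ 2) / (1 + w t ^+ 2).
  by rewrite sqr_sqrtr// divr_ge0 ?ltW.
rewrite /enorm {1}/arc_normal ell_vel_lin dot_arc_normal.
set k := Num.sqrt (_ / _) in K0 K2 *.
rewrite (_ : k * _ / _ = 1) ?sqrtr1//.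
transitivity (k ^+ 2 * (1 + w t ^+ 2) / (d ^+ 2 * (chx (u t) ^+ 2 - cos t ^+ 2))).
  by congr (_ / _); ring.
by rewrite K2 divfK ?gt_eqF// divff// gt_eqF.
Qed.

Lemma arc_at t : al <= t <= be -> exists th la, [/\ la != 0, gam th = Pt (u t) t &
  derive1 gam th = la *: V (u t) t (w t) 1].
Proof. exact: (ga_curve ga). Qed.

Lemma arc_not_segment t : al <= t <= be -> ~ segment c1 c2 (Pt (u t) t).
Proof.
move=> /arc_at[th [la [_ gE _]]]; rewrite -gE => /Oseg.
exact: boundary_notin (gam_boundary th).
Qed.

Lemma reflect_arc t p q : Defs.reflect (arc_normal t) (V (u t) t p q) =
  V (u t) t (refl_p (w t) p q) (refl_g (w t) p q).
Proof.
have D0 := arc_disc t; have W0 := refl_den (w t); have K0 := arc_normal_coef t.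
have K2 : Num.sqrt (d ^+ 2 * (chx (u t) ^+ 2 - cos t ^+ 2) / (1 + w t ^+ 2)) ^+ 2 =
  d ^+ 2 * (chx (u t) ^+ 2 - cos t ^+ 2) / (1 + w t ^+ 2).
  by rewrite sqr_sqrtr// divr_ge0 ?ltW.
rewrite /Defs.reflect dot_arc_normal /arc_normal scalerA ell_vel_lin.
move: K0 K2; set D := d ^+ 2 * _ in D0 *; set k := Num.sqrt _ => K0 K2.
have kk : 2 * (k * (w t * q - p) / D) * k = 2 * (w t * q - p) / (1 + w t ^+ 2).
  transitivity (2 * (w t * q - p) * k ^+ 2 / D); first by ring.
  by rewrite K2; field; rewrite !gt_eqF.
rewrite kk.
have sub p' q' : V (u t) t p q - V (u t) t p' q' = V (u t) t (p - p') (q - q').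
  rewrite /ell_vel !evecE; apply/pair_equal_spec.
  by split; rewrite /= /GRing.scale /=; ring.
by rewrite sub /refl_p /refl_g; congr (ell_vel c1 c2 _ _ _ _); field; rewrite gt_eqF.
Qed.


End bounce_step.

(** The normal is straight in the plane, while the domain is known in elliptic coordinates. There
    the normal line starts downwards relative to the arc: u(eta) - y vanishes at 0 with positive
    derivative, so nearby points are under the arc and [below_arc] applies. *)
Lemma arc_inward (R : realType) (c1 c2 : R * R) (Omega : set (R * R)) (gam : R -> R * R)
    (ym ka al e1 e2 be de : R) (u u' : R -> R) (t : R) :
  c1 <> c2 -> open Omega -> segment c1 c2 `<=` Omega ->
  regular_C1_loop gam (boundary Omega) -> 0 < ym ->
  graph_arc c1 c2 gam ym ka al e1 e2 be de u u' -> e1 <= t <= e2 ->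
  \forall s \near 0^'+, Omega (ell_point c1 c2 (u t) t + s *: arc_normal c1 c2 u u' t).
Proof.
move=> c12 Oopen Oseg gloop ym0 ga.
have [h1 h2 h3 h4] := ga_order ga.
have u_gt0 := u_gt0 ym0 ga.
move=> ti; have ti' : al < t < be by lra.
have ti2 : al <= t <= be by lra.
pose p := ell_point c1 c2 (u t) t; pose n := arc_normal c1 c2 u u' t.
have n1 := arc_normal_unit c12 ym0 ga t; rewrite -/n in n1.
have [eps eps0 Heps] : exists2 eps, 0 < eps & forall s, `|s| < eps -> ~ segment c1 c2 (p + s *: n).
  have cseg : closed (segment c1 c2).
    apply: compact_closed; first exact: norm_hausdorff.
    apply: continuous_compact; last exact: segment_compact.
    apply: continuous_subspaceT => s.
    by apply: cvgD; [exact: cvg_cst|apply: cvgZr_tmp; exact: cvg_id].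
  have cl : continuous_at (0 : R) (fun s => p + s *: n).
    by apply: cvgD; [exact: cvg_cst|apply: cvgZr_tmp; exact: cvg_id].
  have : \forall s \near (0 : R), (~` segment c1 c2) (p + s *: n).
    apply: cl; apply: open_nbhs_nbhs; split; first exact: closed_openC.
    by rewrite /= scale0r addr0; exact: (arc_not_segment Oseg gloop ga).
  move=> /nbhs_ballP[eps /= eps0 H]; exists eps => // s se; apply: H.
  by rewrite /ball/= sub0r normrN.
(* [elliptic_lift] wants a curve defined for all times and off the segment; the sine keeps the
   normal line within [eps] of [p]. *)
pose x (s : R) := p + (eps / 2 * sin s) *: n.
have dx (s : R) : is_derive s 1 x ((eps / 2 * cos s) *: n).
  have ds : is_derive s 1 (fun s => eps / 2 * sin s) (eps / 2 * cos s).
    by apply: deq; [exact: (dM (dcst (eps / 2) s) (dsin (did s)))|rewrite mul0r add0r mulr1].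
  have dk (k q : R) : is_derive s 1 (fun s => q + (eps / 2 * sin s) * k) ((eps / 2 * cos s) * k).
    by apply: deq; [exact: (dD (dcst q s) (dM ds (dcst k s)))|rewrite mulr0 addr0 add0r].
  have := is_derive_pair (dk n.1 p.1) (dk n.2 p.2).
  exact.
have [|||y [et [y' [et' [lift dlift cy' ce']]]]] := @elliptic_lift R c1 c2 c12 x.
- by move=> s; case: (dx s).
- rewrite (_ : derive1 x = fun s => (eps / 2 * cos s) *: n).
    move=> s.
    have : continuous_at s (fun s : R => (eps / 2 * cos s * n.1, eps / 2 * cos s * n.2)).
      by clearbody n; cauto.
    exact.
  by apply/funext => s; exact: is_derive_derive1.
- move=> s; apply: Heps; rewrite normrM gtr0_norm ?divr_gt0//.
  have : `|sin s| <= 1 by rewrite ler_norml sin_geN1 sin_le1.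
  move=> sn; have : eps / 2 * `|sin s| <= eps / 2 * 1 by rewrite ler_pM2l ?divr_gt0.
  by lra.
have x0 : x 0 = p by rewrite /x sin0 mulr0 scale0r addr0.
have [y00 xP0] := lift 0.
have [yE [k kE]] := ell_point_inj c12 y00 (u_gt0 t) (etrans (esym xP0) x0).
pose eta s := et s - k%:~R * (2 * pi).
have lift' s : x s = ell_point c1 c2 (y s) (eta s).
  have [_ ->] := lift s; rewrite /eta -mulNr -mulrNz.
  by rewrite ell_point_period.
have eta0 : eta 0 = t by rewrite /eta kE addrK.
have deta (s : R) : is_derive s 1 eta (et' s).
  by apply: deq; [exact: (dD (dlift s).2 (dcst _ s))|rewrite addr0].
have cy (s : R) : continuous_at s y by exact: (is_derive_cts (dlift s).1).
have ceta (s : R) : continuous_at s eta by exact: (is_derive_cts (deta s)).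
have J0 := arc_disc c12 ym0 ga t.
have w0 := rt_gt0 (u t).
have [vy ve] : 2 * y' 0 / rt (u t) < 0 /\ et' 0 = - (2 * y' 0 / rt (u t)) * slope u u' t.
  have D1 := is_derive_derive1 (dx 0).
  have : is_derive (0 : R) 1 x ((half_dist c1 c2 ^+ 2 * (chx (y 0) ^+ 2 - cos (eta 0) ^+ 2)) *:
       ell_vel c1 c2 (y 0) (eta 0) (2 * y' 0 / rt (y 0)) (et' 0)).
    rewrite (_ : x = fun s => ell_point c1 c2 (y s) (eta s)); last by apply/funext => s; exact: lift'.
    exact: (is_derive_ell_point c12 y00 (dlift 0).1 (deta 0)).
  move=> /is_derive_derive1; rewrite D1 cos0 mulr1 yE eta0 /n /arc_normal !ell_vel_lin.
  move=> /(ell_vel_inj c12 (u_gt0 t))[E1 E2].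
  have K0 := arc_normal_coef c12 ym0 ga t.
  set kk := Num.sqrt _ in K0 E1 E2; set J := half_dist c1 c2 ^+ 2 * _ in J0 E1 E2.
  have v1 : 2 * y' 0 / rt (u t) = - (eps / 2 * kk / J).
    by apply: (mulfI (lt0r_neq0 J0)); rewrite -E1; field; rewrite gt_eqF.
  have q0 : 0 < eps / 2 * kk / J.
    by apply: divr_gt0 => //; apply: mulr_gt0 => //; exact: divr_gt0.
  rewrite v1 opprK oppr_lt0 q0; split => //.
  by apply: (mulfI (lt0r_neq0 J0)); rewrite -E2; field; rewrite gt_eqF.
pose f s := u (eta s) - y s.
pose f' s := u' (eta s) * et' s - y' s.
have cf' (s : R) : continuous_at s f'.
  have cue : continuous_at s (fun s => u' (eta s)).
    by apply: (@ccomp _ _ _ u' eta); [exact: (ga_cu' ga)|exact: ceta].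
  have c1' := ce' s; have c2' := cy' s.
  by apply: cD; [exact: cM|exact: cN].
have f'0 : 0 < f' 0.
  rewrite /f' eta0 ve.
  have -> : u' t = slope u u' t * rt (u t) / 2 by rewrite /slope; field; rewrite gt_eqF.
  have -> : slope u u' t * rt (u t) / 2 * (- (2 * y' 0 / rt (u t)) * slope u u' t) - y' 0 =
     - (2 * y' 0 / rt (u t)) * (rt (u t) / 2 * (1 + slope u u' t ^+ 2)) by field; rewrite gt_eqF.
  by rewrite mulr_gt0 ?oppr_gt0// mulr_gt0 ?refl_den// divr_gt0.
have [|r1 r10 Hr1] := thicken (lexx 0) cf'.
  by move=> s si; have -> : s = 0 by [clear -si; lra]; exact: f'0.
have near0 (q : R -> R) : (forall s : R, continuous_at s q) -> 0 < q 0 ->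
    exists2 r, 0 < r & forall s, 0 - r <= s <= 0 + r -> 0 < q s.
  by move=> cq q0; apply: thicken => // s si; have -> : s = 0 by [clear -si; lra].
have [||r2 r20 Hr2] := near0 (fun s => eta s - al) _.
- by move=> s; apply: cD; [exact: ceta|exact: ccst].
- by rewrite eta0; clear -h1 ti; lra.
have [||r3 r30 Hr3] := near0 (fun s => be - eta s) _.
- by move=> s; apply: cD; [exact: ccst|apply: cN; exact: ceta].
- by rewrite eta0; clear -h3 ti; lra.
have [||r4 r40 Hr4] := near0 (fun s => ym + de - y s) _.
- by move=> s; apply: cD; [exact: ccst|apply: cN; exact: cy].
- by rewrite yE; have [l1 _ _] := ga_low ga ti; clear -l1; lra.
pose r := Num.min (Num.min r1 r2) (Num.min r3 r4).
have r0 : 0 < r by rewrite !lt_min r10 r20 r30.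
have [[rr1 rr2] [rr3 rr4]] : (r <= r1 /\ r <= r2) /\ (r <= r3 /\ r <= r4).
  by rewrite /r !ge_min !lexx ?orbT.
have inO s : 0 < s <= r -> Omega (x s).
  move=> si; rewrite lift'; have [ys0 _] := lift s.
  have e_in z : 0 <= z <= r -> al < eta z < be.
    move=> zi; have := Hr2 z ltac:(clear -rr2 zi; lra); have := Hr3 z ltac:(clear -rr3 zi; lra); lra.
  apply: (below_arc c12 Oopen Oseg gloop ga).
  - by have := e_in s ltac:(clear -si; lra); lra.
  - exact: ltW.
  - by have := Hr4 s ltac:(clear -rr4 si; lra); lra.
  - have s0 : 0 < s by clear -si; lra.
    have df (z : R) : 0 <= z <= s -> is_derive z 1 f (f' z).
      move=> zi; have ez := e_in z ltac:(clear -si zi; lra).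
      apply: deq; first exact: (dD (dcomp (ga_du ga ez) (deta z)) (dN (dlift z).1)).
      by [].
    have [z zi] := MVT_oo s0 df.
    rewrite {2}/f eta0 yE subrr subr0 => fE.
    have : 0 < f' z * (s - 0) by rewrite mulr_gt0 ?subr0//; apply: Hr1; clear -rr1 si zi; lra.
    by rewrite -fE /f subr_gt0.
(* every small s is (eps / 2) sin s' *)
pose s1 := Num.min r 1.
have s10 : 0 < s1 by rewrite lt_min r0 ltr01.
have s1r : s1 <= r by rewrite ge_min lexx.
have s11 : s1 <= 1 by rewrite ge_min lexx orbT.
have sn0 : 0 < sin s1.
  apply: sin_gt0_pi; rewrite s10 /=.
  by have := pi_ge2 R; clear -s11; lra.
near=> s.
have sp : 0 < s by near: s; exact: nbhs_right_gt.
have sl : s < eps / 2 * sin s1.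
  by near: s; apply: nbhs_right_lt; rewrite mulr_gt0// divr_gt0.
have [|||z zi zE] := @IVT_cts R (fun z => eps / 2 * sin z) 0 s1 s.
- exact: ltW.
- by move=> z; cauto.
- by left; rewrite sin0 mulr0 !ltW.
have := inO z; rewrite /x zE; apply.
have [z0|z0|zz] := ltgtP 0 z; [|by move: zi; clear -z0; lra|].
  by rewrite /=; move: zi; clear -s1r; lra.
by move: zE; rewrite -zz sin0 mulr0 => zs; move: sp; rewrite -zs ltxx.
Unshelve. all: by end_near. Qed.

Lemma arc_inward_normal (R : realType) (c1 c2 : R * R) (Omega : set (R * R))
    (gam : R -> R * R) (ym ka al e1 e2 be de : R) (u u' : R -> R) (t th la : R) :
  c1 <> c2 -> open Omega -> segment c1 c2 `<=` Omega ->
  regular_C1_loop gam (boundary Omega) -> 0 < ym ->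
  graph_arc c1 c2 gam ym ka al e1 e2 be de u u' -> e1 <= t <= e2 ->
  gam th = ell_point c1 c2 (u t) t ->
  derive1 gam th = la *: ell_vel c1 c2 (u t) t (slope u u' t) 1 ->
  inward_normal Omega gam th (arc_normal c1 c2 u u' t).
Proof.
move=> c12 Oopen Oseg gloop ym0 ga ti gE dE.
split; [exact: (arc_normal_unit c12 ym0 ga)| |
  by rewrite gE; exact: (arc_inward c12 Oopen Oseg gloop ym0 ga)].
rewrite dE ell_vel_lin /arc_normal ell_vel_lin (dot_ell_vel _ _ _ _ _ _ (u_gt0 ym0 ga t))//.
by rewrite (_ : _ + _ = 0) ?mul0r//; ring.
Qed.

Lemma arc_lipschitz (R : realType) (u u' : R -> R) (al be ka : R) :
  (forall t : R, al < t < be -> is_derive t 1 u (u' t)) -> (forall t, `|u' t| <= ka) ->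
  forall s t, al < s < be -> al < t < be -> `|u s - u t| <= ka * `|s - t|.
Proof.
move=> du ub s t si ti; have [st|st] := leP s t.
  apply: (@MVT_bound _ u u' s t ka); [|by move=> *; exact: ub|clear -st; lra|clear -st; lra].
  by move=> z zi; apply: du; lra.
apply: (@MVT_bound _ u u' t s ka); [|by move=> *; exact: ub|lra|lra].
by move=> z zi; apply: du; lra.
Qed.

(* A trajectory steeper than the arc stays below it. *)
Lemma graph_below (R : realType) (u : R -> R) (al be ka ym t1 y eta : R) : 0 < ka ->
  (forall s t, al < s < be -> al < t < be -> `|u s - u t| <= ka * `|s - t|) ->
  al < t1 < be -> u t1 - ym < 2 * ka * (t1 - al) -> u t1 - ym < 2 * ka * (be - t1) ->
  ym <= y -> y < u t1 -> 4 * ka * `|t1 - eta| <= u t1 - y ->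
  al < eta < be /\ y < u eta.
Proof.
move=> ka0 ul t1i h1 h2 yy yu h.
have e1 : 4 * ka * (t1 - eta) <= 4 * ka * `|t1 - eta|.
  by rewrite ler_pM2l ?mulr_gt0// ler_norm.
have e2 : 4 * ka * (eta - t1) <= 4 * ka * `|t1 - eta|.
  by rewrite ler_pM2l ?mulr_gt0// distrC ler_norm.
have ei : al < eta < be.
  have g1 : 0 < ka * ((t1 - al) - 2 * (t1 - eta)) by lra.
  have g2 : 0 < ka * ((be - t1) - 2 * (eta - t1)) by lra.
  move: g1 g2; rewrite !pmulr_rgt0// => g1 g2.
  by apply/andP; split; clear -g1 g2 t1i; lra.
split => //.
have := ul _ _ t1i ei; have := ler_norm (u t1 - u eta).
have : 0 <= ka * `|t1 - eta| by rewrite mulr_ge0// ltW.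
lra.
Qed.

Section bounce_map.
Variables (R : realType) (c1 c2 : R * R) (m1 m2 h : R).
Variables (Omega : set (R * R)) (gam : R -> R * R).
Variables (ym ka al e1 e2 be de : R) (u u' : R -> R).
Hypotheses (c12 : c1 <> c2) (m20 : 0 < m2) (m21 : m2 <= m1) (h0 : 0 <= h).
Hypothesis Oopen : open Omega.
Hypothesis Oseg : segment c1 c2 `<=` Omega.
Hypothesis gloop : regular_C1_loop gam (boundary Omega).
Hypothesis ym0 : 0 < ym.
Hypothesis gym : forall th, exists y eta, ym <= y /\ gam th = ell_point c1 c2 y eta.
Hypothesis ga : graph_arc c1 c2 gam ym ka al e1 e2 be de u u'.
Local Notation Pt := (ell_point c1 c2).
Local Notation V := (ell_vel c1 c2).
Local Notation d := (half_dist c1 c2).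
Local Notation w := (slope u u').
Local Notation a := (cA c1 c2 m1 m2).
Local Notation b := (cB c1 c2 h).
Local Notation c := (cC c1 c2 m1 m2).
Local Notation E_ := (fl_E a b).
Local Notation S := (fl_S a b).
Local Notation Theta := (fl_Theta a b c).
Local Notation T := (fl_T a b).
Local Notation P := (fl_P a b).
Local Notation g := (fl_g a b c).
Variables (p gm pm E0 : R).
Hypothesis p0 : 0 < p.
Hypothesis E00 : 0 < E0.
Hypothesis E0ym : E0 < E_ ym.
Hypothesis pP : p <= P E0 ym.
Hypothesis gmP : forall E x, 0 <= E <= E0 -> g E x <= gm.
Hypothesis pmP : forall E t, e1 <= t <= e2 -> 0 <= E -> P E (u t) <= pm.
Hypothesis ka4 : ka <= 4^-1.
Hypothesis kagm : 8 * ka * gm < p.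
Hypothesis kapm : 8 * ka * pm < Num.sqrt (2 * (a - c)).
Hypothesis ka0 : 0 < ka.

Let b0 : 0 <= b. Proof. exact: cB_ge0. Qed.
Let c0 : 0 <= c. Proof. exact: cC_ge0. Qed.
Let ca : c < a. Proof. exact: cC_lt. Qed.
Let ub t : ym <= u t. Proof. by case: (ga_bound ga t). Qed.
Let u'b t : `|u' t| <= ka. Proof. by case: (ga_bound ga t). Qed.

(** The state just after a reflection: p_xi = - P is downward and p_eta = g positive. *)
Definition bounce_state (z : R * R) : (R * R) * (R * R) :=
  (Pt (u z.1) z.1, V (u z.1) z.1 (- P z.2 (u z.1)) (g z.2 z.1)).
Local Notation Z := bounce_state.

Lemma bounce_state_continuous : continuous Z.
Proof.
move=> z.
have cf : continuous_at z (fst : R * R -> R) by exact: cfst0.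
have cs : continuous_at z (snd : R * R -> R) by exact: csnd0.
have cu : continuous_at z (fun z : R * R => u z.1).
  by apply: (@ccomp _ _ _ u fst); [exact: (ga_cu ga)|].
apply: cpair; first exact: continuous_ell_point.
apply: continuous_ell_vel => //.
- exact: lt_le_trans ym0 (ub _).
- by rewrite /fl_P /fl_E; cauto.
- by rewrite /fl_g; cauto.
Qed.

Lemma bounce_state_inj q q' : e1 <= q.1 <= e2 -> 0 <= q.2 <= E0 ->
  e1 <= q'.1 <= e2 -> 0 <= q'.2 <= E0 -> Z q = Z q' -> q = q'.
Proof.
move=> q1 q2 q'1 q'2 /pair_equal_spec[E1 E2].
have u0 t : 0 < u t by exact: lt_le_trans ym0 (ub t).
have [_ [k kE]] := ell_point_inj c12 (u0 _) (u0 _) E1.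
have [h1 h2 h3 h4] := ga_order ga.
have tE : q.1 = q'.1.
  apply: (int_small (two_pi_gt0 R) kE); rewrite ltr_norml; lra.
have sE : q.2 = q'.2.
  move: E2; rewrite tE => /(ell_vel_inj c12 (u0 _))[/oppr_inj PE _].
  have := fl_P_sqr b0 c0 ca ym0 ub p0 pP q'.1 q2.
  by rewrite PE (fl_P_sqr b0 c0 ca ym0 ub p0 pP _ q'2); lra.
by rewrite [q]surjective_pairing tE sE -surjective_pairing.
Qed.

Lemma below_min y t : 0 < y -> y < ym -> ~ boundary Omega (Pt y t).
Proof.
move=> y0 yy /(boundary_gam gloop)[th gE]; have [y' [t' [yy' gE']]] := gym th.
have y'0 : 0 < y' by exact: lt_le_trans ym0 yy'.
have [E _] := ell_point_inj c12 y0 y'0 (etrans (esym gE) gE').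
by move: yy yy'; rewrite E; lra.
Qed.

Lemma near_arc t1 y eta : e1 <= t1 <= e2 -> ym <= y -> y < u t1 ->
  4 * ka * `|t1 - eta| <= u t1 - y -> ~ boundary Omega (Pt y eta).
Proof.
move=> ti yy yu he.
have [i1 i2 i3 i4] := ga_order ga; have [l1 l2 l3] := ga_low ga ti.
have t1i : al < t1 < be by lra.
have ul := arc_lipschitz (ga_du ga) u'b.
have [ei yu'] := graph_below ka0 ul t1i l2 l3 yy yu he.
move=> /boundary_notin; apply; apply: (below_arc c12 Oopen Oseg gloop ga) => //; last by lra.
  by lra.
by have := ym0; lra.
Qed.

(* The time needed to climb from [y] to the arc bounds the angle swept. *)
Lemma climb_angle E s t tau tau1 : 0 < E -> E <= E0 -> s <= t -> 0 <= tau -> tau <= tau1 ->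
  ym <= fl_rad a b E + tau ^+ 2 ->
  Theta E t - Theta E s = S (fl_rad a b E) tau1 - S (fl_rad a b E) tau ->
  4 * ka * (t - s) <= tau1 ^+ 2 - tau ^+ 2.
Proof.
move=> Ep Ei st tau0 tau01 yy ThE.
have pE : p <= P E ym.
  by apply: (le_trans pP); rewrite ler_wsqrtr// ler_pM2l//; lra.
have := fl_S_steep b0 c0 ca Ep p0 pE ym0 tau0 yy tau01; rewrite -ThE => h1.
have gE x : g E x <= gm by apply: gmP; rewrite Ei ltW.
have /andP[h2 _] := fl_Theta_bounds b0 c0 ca (ltW Ep) gE st.
have g0 : 0 < gm by exact: lt_le_trans (fl_g_gt0 b0 c0 ca 0 (ltW Ep)) (gE 0).
have h3 := le_trans h2 h1.
have dt : 0 <= tau1 ^+ 2 - tau ^+ 2.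
  by rewrite subr_ge0 ler_pXn2r// ?nnegrE//; exact: le_trans tau01.
move: h3; rewrite ler_pdivrMr// => h3.
have h4 : 4 * ka * (t - s) <= 4 * ka * (2 / p * (tau1 ^+ 2 - tau ^+ 2) * gm).
  by rewrite ler_pM2l// mulr_gt0.
apply: (le_trans h4).
have -> : 4 * ka * (2 / p * (tau1 ^+ 2 - tau ^+ 2) * gm) =
  (8 * ka * gm / p) * (tau1 ^+ 2 - tau ^+ 2) by ring.
by rewrite -[leRHS]mul1r ler_wpM2r// ler_pdivrMr// mul1r ltW.
Qed.

Lemma ell_vel_period y t (k : int) q q' : V y (t + k%:~R * (2 * pi)) q q' = V y t q q'.
Proof. by rewrite /ell_vel cosD_int sinD_int. Qed.

Lemma fl_g_period E t (k : int) : g E (t + k%:~R * (2 * pi)) = g E t.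
Proof. by rewrite /fl_g cosD_int. Qed.

Lemma arc_data t : e1 <= t <= e2 -> exists th,
  [/\ gam th = Pt (u t) t & inward_normal Omega gam th (arc_normal c1 c2 u u' t)].
Proof.
move=> ti; have [i1 i2 i3 i4] := ga_order ga.
have ti' : al <= t <= be by lra.
have [th [la [la0 gE dE]]] := arc_at ga ti'.
exists th; split => //.
exact: (arc_inward_normal c12 Oopen Oseg gloop ym0 ga ti gE dE).
Qed.

Lemma dot_normal_out t E : e1 <= t <= e2 -> 0 <= E <= E0 ->
  dot (V (u t) t (- P E (u t)) (g E t)) (arc_normal c1 c2 u u' t) > 0 /\
  dot (V (u t) t (P E (u t)) (g E t)) (arc_normal c1 c2 u u' t) < 0.
Proof.
move=> ti Ei; have [s1 _] := slope_g_lt b0 c0 ca ym0 ub u'b p0 pP gmP pmP kagm kapm ka0 ti Ei.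
have [EE0 _] := andP Ei; have g0 := fl_g_gt0 b0 c0 ca t EE0.
have D0 := arc_disc c12 ym0 ga t; have K0 := arc_normal_coef c12 ym0 ga t.
have h1 : w t * g E t <= `|w t| * g E t by rewrite ler_pM2r// ler_norm.
have h2 : - w t * g E t <= `|w t| * g E t by rewrite ler_pM2r// -normrN ler_norm.
rewrite !(dot_arc_normal c12 ym0 ga); split.
  apply: divr_gt0 => //; apply: mulr_gt0 => //; lra.
by rewrite pmulr_llt0 ?invr_gt0// pmulr_rlt0//; lra.
Qed.

End bounce_map.

Lemma bounce_step (R : realType) (c1 c2 : R * R) (m1 m2 h : R)
    (Omega : set (R * R)) (gam : R -> R * R) (ym ka al e1 e2 be de : R) (u u' : R -> R)
    (p gm pm E0 t0 t1 E : R) (m : nat) :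
  let a := cA c1 c2 m1 m2 in let b := cB c1 c2 h in let c := cC c1 c2 m1 m2 in
  let Z := bounce_state c1 c2 m1 m2 h u in
  let z1 := Z (t1, refl_E a b c u u' t1 E) in
  c1 <> c2 -> 0 < m2 -> m2 <= m1 -> 0 <= h ->
  open Omega -> segment c1 c2 `<=` Omega -> regular_C1_loop gam (boundary Omega) ->
  0 < ym -> (forall th, exists y eta, ym <= y /\ gam th = ell_point c1 c2 y eta) ->
  graph_arc c1 c2 gam ym ka al e1 e2 be de u u' ->
  0 < p -> E0 < fl_E a b ym -> p <= fl_P a b E0 ym ->
  (forall E x, 0 <= E <= E0 -> fl_g a b c E x <= gm) ->
  (forall E t, e1 <= t <= e2 -> 0 <= E -> fl_P a b E (u t) <= pm) ->
  ka <= 4^-1 -> 8 * ka * gm < p -> 8 * ka * pm < Num.sqrt (2 * (a - c)) -> 0 < ka ->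
  e1 <= t0 <= e2 -> e1 <= t1 <= e2 -> 0 < E -> E <= E0 ->
  arr_H a b c u m (t0, E) t1 = 0 -> 0 <= refl_E a b c u u' t1 E ->
  billiard_dom c1 c2 m1 m2 h Omega gam (Z (t0, E)) /\
  billiard_map c1 c2 m1 m2 h Omega gam (Z (t0, E)) = z1.
Proof.
cbv zeta => c12 m20 m21 h0 Oopen Oseg gloop ym0 gym ga p0 E0ym pP gmP pmP ka4 kagm kapm ka0.
move=> t0i t1i Ep Ei arr0 rE0.
have b0 := cB_ge0 c1 c2 h0; have c0 := cC_ge0 c12 m21; have ca := cC_lt m1 c12 m20.
have ub t : ym <= u t by case: (ga_bound ga t).
have u'b t : `|u' t| <= ka by case: (ga_bound ga t).
have arc_data := arc_data c12 Oopen Oseg gloop ym0 ga.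
have dot_normal_out := dot_normal_out c12 m20 m21 h0 ym0 ga p0 pP gmP pmP kagm kapm ka0.
have climb_angle := climb_angle c12 m20 m21 h0 ym0 p0 pP gmP kagm ka0.
have below_min := below_min c12 gloop ym0 gym.
have near_arc := near_arc c12 Oopen Oseg gloop ym0 ga ka0.
have EE : 0 <= E <= E0 by rewrite Ei ltW.
have Em : E < fl_E (cA c1 c2 m1 m2) (cB c1 c2 h) ym := le_lt_trans Ei E0ym.
pose r := fl_rad (cA c1 c2 m1 m2) (cB c1 c2 h) E.
have r0 : 0 < r by exact: (fl_rad_gt0 b0 c0 ca).
have ry : r < ym by exact: (fl_rad_lt b0 c0 ca (ltW Ep) (ltW ym0) Em).
have rK : fl_E (cA c1 c2 m1 m2) (cB c1 c2 h) r = E by exact: (fl_radK b0 c0 ca (ltW Ep)).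
(* The flight runs over tau from - ta0, on the arc, through 0, at the turning level, up to ta1, on
   the arc again. *)
pose ta0 := Num.sqrt (u t0 - r); pose ta1 := Num.sqrt (u t1 - r).
have ur t : 0 < u t - r by have := ub t; clear -ry; lra.
have ta00 : 0 < ta0 by rewrite sqrtr_gt0.
have ta10 : 0 < ta1 by rewrite sqrtr_gt0.
have ta02 : r + ta0 ^+ 2 = u t0 by rewrite sqr_sqrtr ?ltW//; ring.
have ta12 : r + ta1 ^+ 2 = u t1 by rewrite sqr_sqrtr ?ltW//; ring.
have ta01 : - ta0 < ta1 by clear -ta00 ta10; lra.
have [al' [Tf [be' [tau [eta]]]]] := bounce_trajectory c12 m20 m21 h0 t0 r0 ta01.
rewrite rK; set x := (fun t => ell_point c1 c2 _ _) => -[[a0 Tb] Htr [tau00 tauT eta00] Htau HTh].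
have [dT0 dT] := fl_ThetaP b0 c0 ca (ltW Ep).
have gp s : 0 < (fl_g (cA c1 c2 m1 m2) (cB c1 c2 h) (cC c1 c2 m1 m2) E s)^-1 by rewrite invr_gt0 (fl_g_gt0 b0 c0 ca)// ltW.
have Thinj : injective (fl_Theta (cA c1 c2 m1 m2) (cB c1 c2 h) (cC c1 c2 m1 m2) E) := gt0_derive_inj dT gp.
have ThW s t : fl_Theta (cA c1 c2 m1 m2) (cB c1 c2 h) (cC c1 c2 m1 m2) E s <= fl_Theta (cA c1 c2 m1 m2) (cB c1 c2 h) (cC c1 c2 m1 m2) E t -> s <= t.
  move=> h'; rewrite leNgt; apply/negP => /(gt0_derive_incr dT gp); clear -h'; lra.
have Sodd t : fl_S (cA c1 c2 m1 m2) (cB c1 c2 h) r (- t) = - fl_S (cA c1 c2 m1 m2) (cB c1 c2 h) r t by exact: (fl_S_odd b0 c0 ca).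
have ThA : fl_Theta (cA c1 c2 m1 m2) (cB c1 c2 h) (cC c1 c2 m1 m2) E (t1 + m%:R * (2 * pi)) = fl_Theta (cA c1 c2 m1 m2) (cB c1 c2 h) (cC c1 c2 m1 m2) E t0 + (fl_S (cA c1 c2 m1 m2) (cB c1 c2 h) r ta1 + fl_S (cA c1 c2 m1 m2) (cB c1 c2 h) r ta0).
  by move: arr0; rewrite /arr_H /fl_T /= -/r -/ta0 -/ta1; lra.
have etaT : eta Tf = t1 + m%:R * (2 * pi).
  apply: Thinj; rewrite HTh ?tauT ?Sodd ?ThA ?opprK//; clear -Tb a0; lra.
have x0 : x 0 = ell_point c1 c2 (u t0) t0 by rewrite /x tau00 eta00 sqrrN ta02.
have mk : m%:R = m%:Z%:~R :> R by rewrite -pmulrn.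
have xT : x Tf = ell_point c1 c2 (u t1) t1 by rewrite /x tauT etaT ta12 mk ell_point_period.
have dx0 : derive1 x 0 = ell_vel c1 c2 (u t0) t0 (- fl_P (cA c1 c2 m1 m2) (cB c1 c2 h) E (u t0)) (fl_g (cA c1 c2 m1 m2) (cB c1 c2 h) (cC c1 c2 m1 m2) E t0).
  have [_ _ _ ->] := Htr 0 ltac:(clear -Tb a0; lra).
  rewrite tau00 eta00 sqrrN ta02 fl_pN (fl_pE b0 c0 ca r0 (ltW ta00)).
  by rewrite rK ta02.
have dxT : derive1 x Tf = ell_vel c1 c2 (u t1) t1 (fl_P (cA c1 c2 m1 m2) (cB c1 c2 h) E (u t1)) (fl_g (cA c1 c2 m1 m2) (cB c1 c2 h) (cC c1 c2 m1 m2) E t1).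
  have [_ _ _ ->] := Htr Tf ltac:(clear -Tb a0; lra).
  rewrite tauT etaT ta12 mk ell_vel_period fl_g_period.
  by rewrite (fl_pE b0 c0 ca r0 (ltW ta10)) rK ta12.
have [th0 [gE0 in0]] := arc_data _ t0i; have [th1 [gE1 in1]] := arc_data _ t1i.
have [q1 q2] := dot_normal_out _ _ t0i EE; have [_ q4] := dot_normal_out _ _ t1i EE.
(* Below [ym] there is no boundary. Above it, the climbing half is compared with the arc near [t1]
   and the descending half with the arc near [t0], the oddness of [fl_S] reversing time. *)
have nohit t : 0 < t < Tf -> ~ boundary Omega (x t).
  move=> ti; have tai := Htau t ti; have ti' : al' < t < be' by clear -Tb a0 ti; lra.
  have HT := HTh t ti'.
  have y0 : 0 < r + tau t ^+ 2 by have := sqr_ge0 (tau t); clear -r0; lra.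
  have [yy|yy] := ltP (r + tau t ^+ 2) ym; first exact: below_min.
  have [s0|s0] := leP 0 (tau t).
    have ThE : fl_Theta (cA c1 c2 m1 m2) (cB c1 c2 h) (cC c1 c2 m1 m2) E (t1 + m%:R * (2 * pi)) - fl_Theta (cA c1 c2 m1 m2) (cB c1 c2 h) (cC c1 c2 m1 m2) E (eta t) = fl_S (cA c1 c2 m1 m2) (cB c1 c2 h) r ta1 - fl_S (cA c1 c2 m1 m2) (cB c1 c2 h) r (tau t).
      by rewrite ThA HT Sodd; ring.
    have st : tau t <= ta1 by clear -tai; lra.
    have et1 : eta t <= t1 + m%:R * (2 * pi).
      by apply: ThW; have := fl_S_incr b0 c0 ca r0 st; clear -ThE; lra.
    have cl := climb_angle _ _ _ _ _ Ep Ei et1 s0 st yy ThE.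
    have ss : tau t ^+ 2 < ta1 ^+ 2 by rewrite ltr_pXn2r// ?nnegrE; clear -ta10 tai; lra.
    rewrite /x; have -> : ell_point c1 c2 (r + tau t ^+ 2) (eta t) =
        ell_point c1 c2 (r + tau t ^+ 2) (eta t - m%:R * (2 * pi)).
      by rewrite mk -mulNr -mulrNz ell_point_period.
    apply: (near_arc _ _ _ t1i yy); first by clear -ss ta12; lra.
    have -> : t1 - (eta t - m%:R * (2 * pi)) = t1 + m%:R * (2 * pi) - eta t by ring.
    rewrite ger0_norm ?subr_ge0//; clear -cl ta12; lra.
  have ThE : fl_Theta (cA c1 c2 m1 m2) (cB c1 c2 h) (cC c1 c2 m1 m2) E (eta t) - fl_Theta (cA c1 c2 m1 m2) (cB c1 c2 h) (cC c1 c2 m1 m2) E t0 = fl_S (cA c1 c2 m1 m2) (cB c1 c2 h) r ta0 - fl_S (cA c1 c2 m1 m2) (cB c1 c2 h) r (- tau t).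
    by rewrite HT !Sodd; ring.
  have s0' : 0 <= - tau t by clear -s0; lra.
  have st : - tau t <= ta0 by clear -tai; lra.
  have et1 : t0 <= eta t.
    by apply: ThW; have := fl_S_incr b0 c0 ca r0 st; clear -ThE; lra.
  have yy' : ym <= r + (- tau t) ^+ 2 by rewrite sqrrN.
  have cl := climb_angle _ _ _ _ _ Ep Ei et1 s0' st yy' ThE.
  have ss : (- tau t) ^+ 2 < ta0 ^+ 2 by rewrite ltr_pXn2r// ?nnegrE; clear -ta00 tai; lra.
  rewrite sqrrN in cl ss.
  apply: (near_arc _ _ _ t0i yy); first by clear -ss ta02; lra.
  by rewrite distrC ger0_norm ?subr_ge0//; clear -cl ta02; lra.
have bT : boundary Omega (x Tf) by rewrite xT -gE1; exact: (gam_boundary gloop).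
have z'E : bounce_state c1 c2 m1 m2 h u (t1, refl_E (cA c1 c2 m1 m2) (cB c1 c2 h) (cC c1 c2 m1 m2) u u' t1 E) = (x Tf, Defs.reflect (arc_normal c1 c2 u u' t1) (derive1 x Tf)).
  rewrite xT dxT (reflect_arc c12 ym0 ga).
  have [h1 h2] := refl_E_vel b0 c0 ca ym0 ub u'b p0 pP gmP pmP ka4 kagm kapm ka0 t1i EE rE0.
  by rewrite /bounce_state /= h1 h2 opprK.
have tr : trajectory c1 c2 m1 m2 h al' be' x.
  move=> t ti; have [nw nc1 nc2 _] := Htr t ti; split; first by [].
  by case.
have xz : x 0 = (bounce_state c1 c2 m1 m2 h u (t0, E)).1 /\ derive1 x 0 = (bounce_state c1 c2 m1 m2 h u (t0, E)).2 by [].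
have en0 : enorm (bounce_state c1 c2 m1 m2 h u (t0, E)).2 ^+ 2 / 2 - potential c1 c2 m1 m2 (bounce_state c1 c2 m1 m2 h u (t0, E)).1 = h.
  have [[_ _ en] _ _ _] := Htr 0 ltac:(clear -Tb a0; lra).
  by rewrite -xz.1 -xz.2.
have br : billiard_rel c1 c2 m1 m2 h Omega gam (bounce_state c1 c2 m1 m2 h u (t0, E))
    (bounce_state c1 c2 m1 m2 h u (t1, refl_E (cA c1 c2 m1 m2) (cB c1 c2 h) (cC c1 c2 m1 m2) u u' t1 E)).
  split.
    exists th0, (arc_normal c1 c2 u u' t0); split => //.
  exists x, al', be', Tf; split => //.
  exists th1, (arc_normal c1 c2 u u' t1); split => //; first by rewrite xT.
  by rewrite dxT lt_eqF.
split; first by eexists; exact: br.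
rewrite /billiard_map; case: xgetP => [z _|/(_ _ br) //].
apply: (billiard_rel_unique c12 (lt_le_trans m20 m21) m20 gloop (conj a0 Tb) tr
  _ xz (conj bT nohit) _ in1 z'E).
  by move=> t ti; have [_ ? ? _] := Htr t ltac:(clear -Tb a0 ti; lra).
by rewrite xT.
Qed.

(** * Choice of the constants and conclusion *)

Lemma arc_dynamics (R : realType) (c1 c2 : R * R) (m1 m2 h : R)
    (Omega : set (R * R)) (gam : R -> R * R) : c1 <> c2 -> m2 <= m1 -> 0 < m2 -> 0 <= h ->
  open Omega -> segment c1 c2 `<=` Omega -> regular_C1_loop gam (boundary Omega) ->
  ~ (exists2 L : R, enorm (c1 - c2) < L & boundary Omega = ellipse c1 c2 L) ->
  exists (ym ka al e1 e2 be de : R) (u u' : R -> R) (p gm pm Eb : R),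
    [/\ graph_arc c1 c2 gam ym ka al e1 e2 be de u u' /\
        (forall th, exists y eta, ym <= y /\ gam th = ell_point c1 c2 y eta),
      [/\ 0 < ym, 0 < ka, 0 < p, 0 < Eb & Eb < fl_E (cA c1 c2 m1 m2) (cB c1 c2 h) ym],
      p <= fl_P (cA c1 c2 m1 m2) (cB c1 c2 h) Eb ym,
      (forall E x, 0 <= E <= Eb ->
        fl_g (cA c1 c2 m1 m2) (cB c1 c2 h) (cC c1 c2 m1 m2) E x <= gm) /\
      (forall E t, e1 <= t <= e2 -> 0 <= E ->
        fl_P (cA c1 c2 m1 m2) (cB c1 c2 h) E (u t) <= pm) &
      [/\ ka <= 4^-1, 8 * ka * gm < p &
        8 * ka * pm < Num.sqrt (2 * (cA c1 c2 m1 m2 - cC c1 c2 m1 m2))]].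
Proof.
move=> c12 m21 m20 h0 Oo Oseg gl notell.
have b0 := cB_ge0 c1 c2 h0; have c0 := cC_ge0 c12 m21; have ca := cC_lt m1 c12 m20.
have nseg t : ~ segment c1 c2 (gam t).
  by move=> /Oseg; exact: boundary_notin (gam_boundary gl t).
have [ym [ym0 gym arcs]] := boundary_arc c12 gl nseg notell.
set a := cA c1 c2 m1 m2 in ca *; set b := cB c1 c2 h in b0 *.
set c := cC c1 c2 m1 m2 in ca c0 *.
have Eym : 0 < fl_E a b ym.
  by have := fl_E_incr b0 c0 ca (lexx 0) ym0; rewrite {1}/fl_E expr0n /= mulr0 mul0r.
(* Half the value at which [ym] becomes the turning level: up to [Eb], p_xi at the level [ym] is
   bounded below by a positive [p]. *)
pose Eb := fl_E a b ym / 2; have Eb0 : 0 < Eb by rewrite divr_gt0.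
have Ebym : Eb < fl_E a b ym by rewrite /Eb; lra.
pose p := fl_P a b Eb ym; have p0 : 0 < p by rewrite sqrtr_gt0 mulr_gt0 ?subr_gt0.
pose gm := Num.sqrt (2 * (a + b + c + Eb)).
have gm0 : 0 < gm by rewrite sqrtr_gt0; lra.
(* For ka <= 1/4 the used part of the arc is below [Y], its height over [ym] being less than 2 ka (t
   - al) <= pi. So [pm], and with it [ka], can be fixed before the arc is known. *)
pose Y := ym + 2 * pi; pose pm := fl_P a b 0 Y.
have pm0 : 0 <= pm by exact: sqrtr_ge0.
pose gn := Num.sqrt (2 * (a - c)); have gn0 : 0 < gn by rewrite sqrtr_gt0; lra.
have [ka [ka0 k1 k2 k3]] : exists ka, [/\ 0 < ka, ka <= 4^-1, 8 * ka * gm < p & 8 * ka * pm < gn].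
  exists (Num.min 4^-1 (Num.min (p / (16 * gm)) (gn / (16 * (pm + 1))))).
  have pm1 : 0 < 16 * (pm + 1) by rewrite mulr_gt0// ltr_wpDl.
  have gm1 : 0 < 16 * gm by rewrite mulr_gt0.
  have pos : 0 < Num.min 4^-1 (Num.min (p / (16 * gm)) (gn / (16 * (pm + 1)))).
    by rewrite !lt_min invr_gt0 !divr_gt0// ltr0n.
  split => //; first by rewrite ge_min lexx.
    have : Num.min 4^-1 (Num.min (p / (16 * gm)) (gn / (16 * (pm + 1)))) <= p / (16 * gm).
      by rewrite !ge_min lexx !orbT.
    by rewrite ler_pdivlMr//; lra.
  have : Num.min 4^-1 (Num.min (p / (16 * gm)) (gn / (16 * (pm + 1)))) <= gn / (16 * (pm + 1)).
    by rewrite !ge_min lexx !orbT.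
  by rewrite ler_pdivlMr//; lra.
have [al [e1 [e2 [be [de [u [u' ga]]]]]]] := arcs ka ka0.
exists ym, ka, al, e1, e2, be, de, u, u', p, gm, pm, Eb; split => //.
split.
  move=> E x /andP[E1 E2]; apply: (le_trans (fl_g_le a b0 c0 x E1)).
  by rewrite ler_wsqrtr// ler_pM2l// lerD2l.
move=> E t ti E1; rewrite ler_wsqrtr// ler_pM2l// subr0.
have [_ h1 _] := ga_low ga ti; have [i1 i2 i3 i4] := ga_order ga.
have [uy _] := ga_bound ga t.
have uY : u t < Y.
  have : 2 * ka * (t - al) <= 2 * 4^-1 * (2 * pi).
    apply: ler_pM; [|lra| |lra]; last by lra.
    by rewrite mulr_ge0// ltW.
  by have := two_pi_gt0 R; rewrite /Y; lra.
have := fl_E_incr b0 c0 ca (ltW (lt_le_trans ym0 uy)) uY; lra.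
Qed.

Theorem theorem1 (R : realType) (c1 c2 : R * R) (m1 m2 : R)
    (Omega : set (R * R)) (gam : R -> R * R)
    (hc : c1 <> c2) (hm : m2 <= m1) (hm2 : 0 < m2)
    (Omega_open : open Omega) (Omega_conn : connected Omega)
    (Omega_bounded : bounded_set Omega)
    (Omega_segment : segment c1 c2 `<=` Omega)
    (gam_param : regular_C1_loop gam (boundary Omega))
    (not_ellipse : ~ exists2 L : R, enorm (c1 - c2) < L &
                       boundary Omega = ellipse c1 c2 L) :
  forall h : R, 0 <= h ->
    let D := billiard_dom c1 c2 m1 m2 h Omega gam in
    let B := billiard_map c1 c2 m1 m2 h Omega gam in
    (exists (S : choiceType) (Lambda : set ((R * R) * (R * R)))
        (Pi : (R * R) * (R * R) -> full_shift_space S),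
      [/\ ([set: S] #= [set: nat])%card,
          invariant_set D B Lambda,
          {within Lambda, continuous Pi},
          Pi @` Lambda = setT &
          forall z, Lambda z -> Pi (B z) = full_shift (Pi z)]) /\
    (forall M : R, exists Lambda : set ((R * R) * (R * R)),
      [/\ compact Lambda, invariant_set D B Lambda &
          (M%:E <= topological_entropy B Lambda)%E]).
Proof.
move=> h h0; cbv zeta.
have b0 := cB_ge0 c1 c2 h0; have c0 := cC_ge0 hc hm; have ca := cC_lt m1 hc hm2.
have [ym [ka [al [e1 [e2 [be [de [u [u' [p [gm [pm [Eb [[ga gym]
  [ym0 ka0 p0 Eb0 Ebym] pP [gmP pmP] [ka4 kagm kapm]]]]]]]]]]]]]]] :=
  arc_dynamics hc hm hm2 h0 Omega_open Omega_segment gam_param not_ellipse.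
have [i1 i2 i3 i4] := ga_order ga.
have ub t : ym <= u t by case: (ga_bound ga t).
have u'b t : `|u' t| <= ka by case: (ga_bound ga t).
have e1i : e1 <= e1 <= e2 by rewrite lexx ltW.
have e2i : e1 <= e2 <= e2 by rewrite lexx ltW.
have [/(_ (ga_neg ga)) r1 _] :=
  refl_E_sign b0 c0 ca ym0 ub u'b p0 Eb0 pP gmP pmP ka4 kagm kapm ka0 e1i.
have [_ /(_ (ga_pos ga)) r2] :=
  refl_E_sign b0 c0 ca ym0 ub u'b p0 Eb0 pP gmP pmP ka4 kagm kapm ka0 e2i.
pose rE := refl_E (cA c1 c2 m1 m2) (cB c1 c2 h) (cC c1 c2 m1 m2) u u'.
have crE t : continuous_at (0 : R) (rE t).
  by have [] := continuous_refl_E (cA c1 c2 m1 m2) (cB c1 c2 h) (cC c1 c2 m1 m2)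
    (ga_cu ga) (ga_cu' ga) (@ccst R R t 0) (@cidt R 0).
have near0 (P : R -> Prop) : (\forall E \near (0 : R), P E) ->
    exists2 r, 0 < r & forall E, 0 <= E <= r -> P E.
  move=> /nbhs_ballP[r /= rp H]; exists (r / 2); first by rewrite divr_gt0.
  by move=> E Ei; apply: H; rewrite /ball/= sub0r normrN ger0_norm; lra.
have [s1 s10 Hs1] := near0 _ (cvgr_lt _ (crE e1) _ r1).
have r2' : rE e2 0 / 2 < rE e2 0 by rewrite /rE; lra.
have [s2 s20 Hs2] := near0 _ (cvgr_gt _ (crE e2) _ r2').
have r20 : 0 < rE e2 0 / 2 by rewrite divr_gt0.
(* Up to [E0] the value reflected at [e1] stays negative and the one reflected at [e2] stays above
   half its value at E = 0; taking E0 below that half makes it exceed every window. *)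
have [E0 [E00 [Es1 Es2] [Er Eb1]]] : exists E0, [/\ 0 < E0, E0 <= s1 /\ E0 <= s2 &
    E0 <= rE e2 0 / 2 /\ E0 <= Eb].
  exists (Num.min (Num.min s1 s2) (Num.min (rE e2 0 / 2) Eb)).
  by rewrite !lt_min !ge_min s10 s20 r20 Eb0 !lexx ?orbT.
have E0ym := le_lt_trans Eb1 Ebym.
have pP0 : p <= fl_P (cA c1 c2 m1 m2) (cB c1 c2 h) E0 ym.
  by apply: (le_trans pP); rewrite ler_wsqrtr// ler_pM2l// lerD2l lerN2.
have gmP0 E x : 0 <= E <= E0 ->
    fl_g (cA c1 c2 m1 m2) (cB c1 c2 h) (cC c1 c2 m1 m2) E x <= gm.
  by move=> Ei; apply: gmP; lra.
have ulip s t : e1 <= s <= e2 -> e1 <= t <= e2 -> `|u s - u t| <= ka * `|s - t|.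
  by move=> si ti; apply: (arc_lipschitz (ga_du ga) u'b); lra.
have R1 E : 0 <= E <= E0 -> rE e1 E <= 0.
  by move=> Ei; apply/ltW/Hs1; lra.
have R2 E : 0 <= E <= E0 -> E0 <= rE e2 E.
  by move=> Ei; apply: (le_trans Er); apply/ltW/Hs2; lra.
have [lo [hi [m [F [G [rho [[lohi dec] [cF F1 Flo Fhi] [cG crho FG] gen]]]]]]] :=
  return_map b0 c0 ca i2 ym0 (ga_cu ga) (ga_cu' ga) ub u'b ulip p0 E00 E0ym pP0
    gmP0 pmP ka4 kagm kapm ka0 R1 R2.
pose Z := bounce_state c1 c2 m1 m2 h u.
have cZ : continuous Z by exact: (bounce_state_continuous hc ym0 ga).
have Zinj := bounce_state_inj hc hm2 hm h0 ym0 ga p0 pP0.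
have Zstep j z : e1 <= z.1 <= e2 -> lo j <= z.2 <= hi j -> 0 < (F j z).2 < E0 ->
    billiard_dom c1 c2 m1 m2 h Omega gam (Z z) /\
    billiard_map c1 c2 m1 m2 h Omega gam (Z z) = Z (F j z).
  move=> z1 z2 Fi; have := gen j z z1 z2 Fi; have [l1 l2] := lohi j.
  case: z z1 z2 Fi => t E z1 z2; case: (F j (t, E)) => t1 E1 /= Fi [g1 g2 g3].
  rewrite g3; have t1i : e1 <= t1 <= e2 by lra.
  have Ep : 0 < E by move: z2 => /=; lra.
  have EE : E <= E0 by move: z2 => /=; lra.
  have rE0 : 0 <= rE t1 E by rewrite /rE -g3; lra.
  exact: (bounce_step hc hm2 hm h0 Omega_open Omega_segment gam_param ym0 gym ga p0
    E0ym pP0 gmP0 pmP ka4 kagm kapm ka0 z1 t1i Ep EE g2 rE0).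
split.
  exact: (full_shift_coding i2 lohi dec cF F1 Flo Fhi cG crho FG cZ Zinj Zstep).
exact: (large_entropy i2 lohi dec cF F1 Flo Fhi cZ Zinj Zstep).
Qed.
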